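(* Let $0<\alpha\le 1$. Let $q,\tilde q$ be real-valued continuous functions on $[0,\pi]$ and $h,H,\tilde h,\tilde H\in\mathbb{R}$. Let $\{\lambda_n\}_{n\ge0}$ be the eigenvalues and $\{\alpha_n\}_{n\ge0}$ the norming constants (defined in the context) of the problem $L_\alpha(q,h,H)$: $$-D_x^\alpha D_x^\alpha y+q(x)y=\lambda y,\ 0<x<\pi,\qquad D_x^\alpha y(0)-hy(0)=0,\qquad D_x^\alpha y(\pi)+Hy(\pi)=0,$$ and let $\{\tilde\lambda_n\}_{n\ge0}$, $\{\tilde\alpha_n\}_{n\ge0}$ be those of $L_\alpha(\tilde q,\tilde h,\tilde H)$. If $\lambda_n=\tilde\lambda_n$ and $\alpha_n=\tilde\alpha_n$ for all $n\ge0$, then $q(x)=\tilde q(x)$ a.e. on $[0,\pi]$, $h=\tilde h$ and $H=\tilde H$.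
   Context: $D_x^\alpha$ denotes the conformable fractional derivative of order $\alpha$: for $x>0$, $D^\alpha f(x)=\lim_{\varepsilon\to 0}\frac{f(x+\varepsilon x^{1-\alpha})-f(x)}{\varepsilon}$, and $D^\alpha f(0)=\lim_{x\to0^+}D^\alpha f(x)$ (for differentiable $f$, $D^\alpha f(x)=x^{1-\alpha}f'(x)$). $\lambda$ is a complex spectral parameter. The eigenvalues are real and simple, enumerated in increasing order. Let $\varphi(x,\lambda)$ be the solution of $-D_x^\alpha D_x^\alpha y+q(x)y=\lambda y$ with $\varphi(0,\lambda)=1$, $D_x^\alpha\varphi(0,\lambda)=h$. The norming constants are $\alpha_n=\int_0^\pi \varphi^2(x,\lambda_n)\,x^{\alpha-1}\,dx$ (the symbol $\alpha_n$ is unrelated to the order $\alpha$). Tilded objects are defined analogously for $\tilde q,\tilde h,\tilde H$. *)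

(* Defs.v *)
From Stdlib Require Import Reals.
From Coquelicot Require Import Coquelicot.
Open Scope R_scope.

(* Conformable fractional derivative of order a at a point x > 0, by the
   paper's limit definition:
   D^a f(x) = lim_{e -> 0} (f(x + e x^(1-a)) - f(x)) / e. *)
Definition conf_deriv (a : R) (f : R -> R) (x l : R) : Prop :=
  is_lim (fun e => (f (x + e * Rpower x (1 - a)) - f x) / e) 0 l.

Definition cont_on_0pi (q : R -> R) : Prop :=
  forall x, 0 <= x <= PI ->
    filterlim q (within (fun y => 0 <= y <= PI) (locally x)) (locally (q x)).

(* y solves  -D^a D^a y + q y = lam y  on (0, pi), with Dy = D^a y there,
   y continuous on [0,pi] (one-sided at the endpoints), and
   D^a y(0) := lim_{x->0+} D^a y(x) = d0,  D^a y(pi) := lim_{x->pi-} D^a y(x) = dpi. *)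
Definition conf_solution (a : R) (q : R -> R) (lam : R)
    (y Dy : R -> R) (d0 dpi : R) : Prop :=
  (forall x, 0 < x < PI -> conf_deriv a y x (Dy x)) /\
  (forall x, 0 < x < PI -> conf_deriv a Dy x (q x * y x - lam * y x)) /\
  (forall x, 0 < x < PI -> continuous y x) /\
  filterlim y (at_right 0) (locally (y 0)) /\
  filterlim y (at_left PI) (locally (y PI)) /\
  filterlim Dy (at_right 0) (locally d0) /\
  filterlim Dy (at_left PI) (locally dpi).

Definition is_eigenvalue (a : R) (q : R -> R) (h H lam : R) : Prop :=
  exists (y Dy : R -> R) (d0 dpi : R),
    conf_solution a q lam y Dy d0 dpi /\
    d0 - h * y 0 = 0 /\ dpi + H * y PI = 0 /\
    (exists x, 0 <= x <= PI /\ y x <> 0).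

Definition eigen_enum (a : R) (q : R -> R) (h H : R) (lams : nat -> R) : Prop :=
  (forall n m, (n < m)%nat -> lams n < lams m) /\
  (forall n, is_eigenvalue a q h H (lams n)) /\
  (forall mu, is_eigenvalue a q h H mu -> exists n, lams n = mu).

Definition is_phi (a : R) (q : R -> R) (h lam : R) (phi : R -> R) : Prop :=
  exists (Dphi : R -> R) (dpi : R),
    conf_solution a q lam phi Dphi h dpi /\ phi 0 = 1.

Definition norming_const (a : R) (phi : R -> R) (c : R) : Prop :=
  is_RInt_gen (fun x => phi x ^ 2 * Rpower x (a - 1)) (at_right 0) (at_point PI) c.

(* Main.v *)
Require Import Defs.
From Stdlib Require Import Reals Factorial Lra Lia Classical ClassicalEpsilon.
From Coquelicot Require Import Coquelicot.
Open Scope R_scope.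

(** With [t = x^a / a] the conformable derivative becomes [d/dt], so both problems are
    classical Robin problems [-u'' + Q u = lam u] on [[0, T]], [T = PI^a / a].

    Eigenfunction expansions converge in the energy norm: on the orthogonal complement of
    [phi_0, ..., phi_(N-1)] the best lower bound [m] of the quadratic form must be at least
    [lam_N], since otherwise the resolvent at [m] is bounded there and [m] could be
    increased; and [lam_N] tends to infinity.

    Let [U] be the map [phi_n -> phit_n], an isometry because the norming constants agree.
    If [f = sum c_n phi_n] vanishes on [[0, b]], then [w(t, s) = sum c_n phit_n(t) phi_n(s)]
    solves the hyperbolic equation [w_tt - Qt(t) w = w_ss - Q(s) w] with vanishing Cauchy
    data on [[0, b]], so by finite propagation speed [w(t, 0) = (U f)(t)] vanishes on
    [[0, b]] too.  By symmetry the same holds for the inverse of [U], and hence the integrals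
    of [phi_0^2] and [phit_0^2] over every [[0, b]] agree.  So [phi_0^2 = phit_0^2], and
    [Q], [h] and [H] are read off from [phi_0^2]. *)

(** * Continuous functions and Riemann integrals *)

(** The partial sums of [w] solve the hyperbolic equation exactly, since the two factors of each
    term share the same [lam n]; only the Cauchy data at [t = 0] are approximate. As every solution
    equals 1 at 0, these data are the partial sum of [f] and a multiple of it, so on [[0, b]] they
    are minus the expansion errors of [f]. Convergence in the energy norm is exactly what an energy
    estimate consumes, and a trace inequality turns it into bounds at [s = 0], where [w] is the
    partial sum of [U f]; neither eigenvalue asymptotics nor pointwise convergence of expansions is
    required. A sharp truncation of [phi_0] at [b] leaves the domain of the operator. Hence [phi_0]
    is cut by two C^2 steps into a head, a thin middle and a tail. The tail is sent by [U] away from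
    the head of [phit_0], the middle is small, and the pairing of the two heads is the same number
    whether computed with [U] or with its inverse; this compares the two local norms up to an
    arbitrary error. Potentials are extended by constants outside [[0, T]], so that all functions
    are continuous on the whole line. *)

Definition C0 (f : R -> R) : Prop := forall x, continuous f x.

Lemma C0_const (c : R) : C0 (fun _ => c).
Proof. intros x; apply continuous_const. Qed.

Lemma C0_id : C0 (fun x => x).
Proof. intros x; apply continuous_id. Qed.

Lemma C0_plus f g : C0 f -> C0 g -> C0 (fun x => f x + g x).
Proof. intros Hf Hg x; apply (continuous_plus f g); auto. Qed.

Lemma C0_opp f : C0 f -> C0 (fun x => - f x).
Proof. intros Hf x; apply (continuous_opp f); auto. Qed.

Lemma C0_minus f g : C0 f -> C0 g -> C0 (fun x => f x - g x).
Proof. intros Hf Hg x; apply (continuous_minus f g); auto. Qed.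

Lemma C0_mult f g : C0 f -> C0 g -> C0 (fun x => f x * g x).
Proof. intros Hf Hg x; apply (continuous_mult f g); auto. Qed.

Lemma C0_pow f n : C0 f -> C0 (fun x => f x ^ n).
Proof.
  intros Hf; induction n as [|n IH]; simpl.
  - apply C0_const.
  - apply C0_mult; auto.
Qed.

Lemma C0_div f c : C0 f -> C0 (fun x => f x / c).
Proof. intros Hf; apply C0_mult; [auto | apply C0_const]. Qed.

Lemma C0_derive (f df : R -> R) : (forall x, is_derive f x (df x)) -> C0 f.
Proof. intros H x; apply (ex_derive_continuous f); exists (df x); apply H. Qed.

Ltac c0 := repeat lazymatch goal with
  | |- C0 (fun _ => ?c) => apply (C0_const c)
  | |- C0 (fun x => x) => apply C0_id
  | |- C0 (fun x => @?f x + @?g x) => apply (C0_plus f g)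
  | |- C0 (fun x => @?f x - @?g x) => apply (C0_minus f g)
  | |- C0 (fun x => - @?f x) => apply (C0_opp f)
  | |- C0 (fun x => @?f x * @?g x) => apply (C0_mult f g)
  | |- C0 (fun x => @?f x / ?c) => apply (C0_div f c)
  | |- C0 (fun x => @?f x ^ ?n) => apply (C0_pow f n)
  | |- _ => assumption
  end.

Lemma ex_RInt_C0 f a b : C0 f -> ex_RInt f a b.
Proof. intros Hf; apply (@ex_RInt_continuous R_CompleteNormedModule); intros; apply Hf. Qed.

Lemma RInt_derive (f df : R -> R) a b :
  (forall x, is_derive f x (df x)) -> C0 df -> RInt df a b = f b - f a :> R.
Proof.
  intros Hd Hc; apply is_RInt_unique.
  apply (is_RInt_derive f df); intros; auto.
Qed.

Lemma is_derive_RInt_C0 f a x : C0 f -> is_derive (fun t => RInt f a t) x (f x).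
Proof.
  intros Hf; apply (is_derive_RInt f _ a).
  - apply filter_forall; intros y; apply (@RInt_correct R_CompleteNormedModule), ex_RInt_C0, Hf.
  - apply Hf.
Qed.

Lemma C0_RInt f a : C0 f -> C0 (fun t => RInt f a t).
Proof. intros Hf; apply (C0_derive _ f); intros; apply is_derive_RInt_C0, Hf. Qed.

Lemma RInt_add f g a b : C0 f -> C0 g ->
  RInt (fun x => f x + g x) a b = RInt f a b + RInt g a b :> R.
Proof. intros Hf Hg; apply (RInt_plus f g); apply ex_RInt_C0; auto. Qed.

Lemma RInt_sub f g a b : C0 f -> C0 g ->
  RInt (fun x => f x - g x) a b = RInt f a b - RInt g a b :> R.
Proof. intros Hf Hg; apply (RInt_minus f g); apply ex_RInt_C0; auto. Qed.

Lemma RInt_mulc c f a b : C0 f ->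
  RInt (fun x => c * f x) a b = c * RInt f a b :> R.
Proof. intros Hf; apply (RInt_scal f); apply ex_RInt_C0; auto. Qed.

Lemma RInt_eq (f g : R -> R) (a b : R) : (forall x, f x = g x) -> RInt f a b = RInt g a b :> R.
Proof. intros H; apply RInt_ext; intros x _; apply H. Qed.

Lemma RInt_0 a b : RInt (fun _ => 0) a b = 0 :> R.
Proof. rewrite RInt_const; unfold scal; simpl; unfold mult; simpl; ring. Qed.

Lemma RInt_split f a b c : C0 f -> RInt f a c = RInt f a b + RInt f b c :> R.
Proof. intros Hf; symmetry; apply (RInt_Chasles f); apply ex_RInt_C0; auto. Qed.

Lemma RInt_le_C0 f g a b : a <= b -> C0 f -> C0 g ->
  (forall x, a < x < b -> f x <= g x) -> RInt f a b <= RInt g a b.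
Proof. intros Hab Hf Hg H; apply RInt_le; auto; apply ex_RInt_C0; auto. Qed.

Lemma RInt_ge0 f a b : a <= b -> C0 f -> (forall x, a < x < b -> 0 <= f x) ->
  0 <= RInt f a b.
Proof.
  intros Hab Hf H; rewrite <- (RInt_0 a b); apply RInt_le_C0; auto; apply C0_const.
Qed.

Lemma RInt_subinterval f a b : 0 <= a -> a <= b -> C0 f -> (forall x, 0 <= f x) ->
  RInt f 0 a <= RInt f 0 b.
Proof.
  intros Ha Hab Hf H; rewrite (RInt_split f 0 a b) by auto.
  assert (0 <= RInt f a b) by (apply RInt_ge0; auto); lra.
Qed.

(** The point 0 is singled out because the solutions to which this is applied equal 1 there. *)
Lemma RInt_sqr_pos f T : 0 < T -> C0 f -> f 0 <> 0 -> 0 < RInt (fun x => f x * f x) 0 T.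
Proof.
  intros HT Hf H0.
  assert (Hc : C0 (fun x => f x * f x)) by c0.
  assert (Hp : 0 < f 0 * f 0) by nra.
  assert (HL : locally 0 (fun x => 0 < f x * f x))
    by (apply (Hc 0); apply (open_gt 0); exact Hp).
  destruct HL as [d Hd].
  pose proof (cond_pos d) as Hd0.
  set (e := Rmin d T / 2).
  assert (He : 0 < e /\ e < d /\ e < T).
  { unfold e; assert (0 < Rmin d T) by (apply Rmin_glb_lt; lra).
    pose proof (Rmin_l d T); pose proof (Rmin_r d T); lra. }
  rewrite (RInt_split _ 0 e T) by auto.
  apply Rplus_lt_le_0_compat.
  - apply RInt_gt_0; try lra.
    + intros x Hx; apply Hd.
      unfold ball; simpl; unfold AbsRing_ball, abs, minus, plus, opp; simpl.
      rewrite Rabs_pos_eq; lra.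
    + intros; apply Hc.
  - apply RInt_ge0; auto; try lra; intros; nra.
Qed.

(** * Cauchy-Schwarz and Gronwall inequalities *)

Lemma quadratic_form_ineq A B C : 0 <= A -> 0 <= C ->
  (forall x, 0 <= A + 2 * x * B + x * x * C) -> B * B <= A * C.
Proof.
  intros HA HC H.
  destruct (Req_dec C 0) as [->|HC0].
  - destruct (Req_dec B 0) as [->|HB]; [nra|].
    (* For [C = 0] the form is affine in [x], and at this point it takes the value -1. *)
    specialize (H (- (A + 1) / (2 * B))).
    replace (A + 2 * (- (A + 1) / (2 * B)) * B + - (A + 1) / (2 * B) * (- (A + 1) / (2 * B)) * 0)
      with (-1) in H by (field; auto).
    lra.
  - assert (Hp : 0 < C) by lra.
    specialize (H (- B / C)).
    replace (A + 2 * (- B / C) * B + - B / C * (- B / C) * C) with (A - B * B / C) in H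
      by (field; auto).
    assert (B * B / C * C = B * B) by (field; auto).
    assert (0 <= (A - B * B / C) * C) by (apply Rmult_le_pos; lra).
    nra.
Qed.

Lemma RInt_cauchy_schwarz f g a b : a <= b -> C0 f -> C0 g ->
  RInt (fun x => f x * g x) a b * RInt (fun x => f x * g x) a b
  <= RInt (fun x => f x * f x) a b * RInt (fun x => g x * g x) a b.
Proof.
  intros Hab Hf Hg; apply quadratic_form_ineq.
  - apply RInt_ge0; auto; [c0 | intros; nra].
  - apply RInt_ge0; auto; [c0 | intros; nra].
  - intros x.
    rewrite <- !RInt_mulc by c0.
    rewrite <- !RInt_add by c0.
    apply RInt_ge0; auto; [c0|].
    intros t _.
    replace (f t * f t + 2 * x * (f t * g t) + x * x * (g t * g t))
      with ((f t + x * g t) ^ 2) by ring.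
    apply pow2_ge_0.
Qed.

Lemma derive_nonpos_decr (g dg : R -> R) a b : a <= b ->
  (forall t, a <= t <= b -> is_derive g t (dg t)) ->
  (forall t, a <= t <= b -> dg t <= 0) -> g b <= g a.
Proof.
  intros Hab Hd Hn.
  destruct (MVT_gen g a b dg) as [c [Hc E]].
  - intros x; rewrite Rmin_left, Rmax_right by lra; intros; apply Hd; lra.
  - intros x; rewrite Rmin_left, Rmax_right by lra; intros Hx.
    apply continuity_pt_filterlim; apply (ex_derive_continuous g); exists (dg x); auto.
  - rewrite Rmin_left, Rmax_right in Hc by lra.
    specialize (Hn c Hc). nra.
Qed.

(** The function [exp (- C * s) * G s - RInt k 0 s] is nonincreasing: the exponential factor is at
    most 1 and [k] is nonnegative, so the contribution of [k] is compensated. *)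
Lemma gronwall (G dG k : R -> R) C T t : 0 <= C -> 0 <= t <= T -> C0 k -> (forall s, 0 <= k s) ->
  (forall s, 0 <= s <= T -> is_derive G s (dG s)) ->
  (forall s, 0 <= s <= T -> dG s <= C * G s + k s) ->
  G t <= exp (C * t) * (G 0 + RInt k 0 t).
Proof.
  intros HC Ht Hk Hk0 Hd Hi.
  pose (F := fun s => exp (- C * s) * G s - RInt k 0 s).
  assert (HF : F t <= F 0).
  { apply (derive_nonpos_decr F (fun s => (- C * exp (- C * s)) * G s + exp (- C * s) * dG s - k s)).
    - lra.
    - intros s Hs; unfold F.
      apply (is_derive_minus (fun s => exp (- C * s) * G s) (RInt k 0)).
      + apply (is_derive_mult (fun s => exp (- C * s)) G).
        * auto_derive; auto; ring.
        * apply Hd; lra.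
        * intros; apply Rmult_comm.
      + apply is_derive_RInt_C0; auto.
    - intros s Hs.
      specialize (Hi s ltac:(lra)).
      pose proof (exp_pos (- C * s)) as He.
      assert (exp (- C * s) <= 1).
      { rewrite <- exp_0;
        destruct (Rle_lt_or_eq_dec (- C * s) 0) as [Hl|Hl]; [nra| |].
        - left; apply exp_increasing; auto.
        - rewrite Hl; lra. }
      specialize (Hk0 s).
      assert (exp (- C * s) * k s <= k s) by nra.
      assert (exp (- C * s) * dG s <= exp (- C * s) * (C * G s + k s)) by nra.
      nra. }
  unfold F in HF.
  rewrite RInt_point in HF; unfold zero in HF; simpl in HF.
  rewrite Rmult_0_r, exp_0 in HF.
  assert (E : exp (C * t) * exp (- C * t) = 1).
  { rewrite <- exp_plus; replace (C * t + - C * t) with 0 by ring; apply exp_0. }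
  pose proof (exp_pos (C * t)) as He.
  assert (exp (C * t) * (exp (- C * t) * G t - RInt k 0 t) <= exp (C * t) * (1 * G 0 - 0))
    by (apply Rmult_le_compat_l; lra).
  replace (G t) with (exp (C * t) * exp (- C * t) * G t) by (rewrite E; ring).
  lra.
Qed.

(** * Existence for linear second-order equations *)

(** Solutions are constructed on the whole line; the reflection reduces integral estimates at
    negative [t] to positive ones. *)
Lemma RInt_reflect (f : R -> R) (t : R) : C0 f -> RInt f 0 t = - RInt (fun r => f (- r)) 0 (- t) :> R.
Proof.
  intros Hf.
  pose proof (RInt_comp_lin f (-1) 0 0 (- t)) as H.
  replace (-1 * 0 + 0) with 0 in H by ring.
  replace (-1 * - t + 0) with t in H by ring.
  rewrite <- H by (apply ex_RInt_C0; auto).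
  assert (Hc : C0 (fun r => f (- r))).
  { intros x; apply (continuous_comp (fun r => - r) f); [apply C0_opp, C0_id | apply Hf]. }
  apply (@eq_trans R _ (RInt (fun r => (-1) * f (- r)) 0 (- t))).
  - apply RInt_ext; intros x _; unfold scal; simpl; unfold mult; simpl.
    replace (-1 * x + 0) with (- x) by ring; reflexivity.
  - rewrite RInt_mulc by auto. ring.
Qed.

Lemma RInt_pow_bound_pos f K n t : 0 <= t -> C0 f ->
  (forall r, 0 <= r <= t -> Rabs (f r) <= K * r ^ n) ->
  Rabs (RInt f 0 t) <= K * t ^ S n / INR (S n).
Proof.
  intros Ht Hf Hb.
  assert (Hn : INR (S n) <> 0) by (apply not_0_INR; lia).
  assert (Hint : RInt (fun r => K * r ^ n) 0 t = K * t ^ S n / INR (S n) :> R).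
  { rewrite (RInt_derive (fun r => K * r ^ S n / INR (S n))).
    - simpl (0 ^ S n); field; auto.
    - intros x. auto_derive; auto.
      change (Nat.pred (S n)) with n. field. auto.
    - c0. }
  rewrite <- Hint.
  apply (norm_RInt_le f (fun r => K * r ^ n) 0 t); auto.
  - apply (@RInt_correct R_CompleteNormedModule), ex_RInt_C0; auto.
  - apply (@RInt_correct R_CompleteNormedModule), ex_RInt_C0; c0.
Qed.

Lemma RInt_pow_bound f K n t : C0 f ->
  (forall r, Rabs r <= Rabs t -> Rabs (f r) <= K * Rabs r ^ n) ->
  Rabs (RInt f 0 t) <= K * Rabs t ^ S n / INR (S n).
Proof.
  intros Hf Hb.
  destruct (Rle_dec 0 t) as [Ht|Ht].
  - rewrite (Rabs_pos_eq t) in * by auto.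
    apply RInt_pow_bound_pos; auto; intros r Hr.
    rewrite <- (Rabs_pos_eq r) at 2 by lra.
    apply Hb; rewrite Rabs_pos_eq; lra.
  - rewrite RInt_reflect, Rabs_Ropp by auto.
    rewrite (Rabs_left t) in * by lra.
    apply RInt_pow_bound_pos; try lra.
    + intros x; apply (continuous_comp (fun r => - r) f); [apply C0_opp, C0_id | apply Hf].
    + intros r Hr.
      replace r with (Rabs (- r)) at 2 by (rewrite Rabs_Ropp, Rabs_pos_eq; lra).
      apply Hb; rewrite Rabs_Ropp, Rabs_pos_eq; lra.
Qed.

(** The solution of [u'' = V y] with zero Cauchy data at 0. In terms of it a linear second-order
    equation becomes the fixed-point equation [y = g + iint V y]. *)
Definition iint (V y : R -> R) (t : R) : R :=
  RInt (fun s => RInt (fun r => V r * y r) 0 s) 0 t.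

Lemma C0_iint V y : C0 V -> C0 y -> C0 (iint V y).
Proof. intros HV Hy; apply C0_RInt, C0_RInt; c0. Qed.

Lemma iint_bound V y C K n S t : C0 V -> C0 y -> 0 <= C ->
  (forall r, Rabs (V r) <= C) -> Rabs t <= S ->
  (forall r, Rabs r <= S -> Rabs (y r) <= K * Rabs r ^ n) ->
  Rabs (iint V y t) <= C * K * Rabs t ^ (n + 2) / (INR (n + 1) * INR (n + 2)).
Proof.
  intros HV Hy HC HVb Ht Hb.
  assert (H1 : INR (n + 1) <> 0) by (apply not_0_INR; lia).
  assert (H2 : INR (n + 2) <> 0) by (apply not_0_INR; lia).
  replace (C * K * Rabs t ^ (n + 2) / (INR (n + 1) * INR (n + 2)))
    with (C * K / INR (n + 1) * Rabs t ^ (n + 2) / INR (n + 2)) by (field; auto).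
  replace (n + 2)%nat with (Datatypes.S (n + 1)) by lia.
  apply RInt_pow_bound.
  - apply C0_RInt; c0.
  - intros s Hs.
    replace (C * K / INR (n + 1) * Rabs s ^ (n + 1))
      with (C * K * Rabs s ^ (n + 1) / INR (n + 1)) by (field; auto).
    replace (n + 1)%nat with (Datatypes.S n) by lia.
    apply RInt_pow_bound; [c0|].
    intros r Hr; rewrite Rabs_mult, Rmult_assoc.
    apply Rmult_le_compat; auto using Rabs_pos.
    apply Hb; lra.
Qed.

Fixpoint picard (V g : R -> R) (k : nat) : R -> R :=
  match k with O => g | S k => iint V (picard V g k) end.

Lemma C0_picard V g k : C0 V -> C0 g -> C0 (picard V g k).
Proof. intros HV Hg; induction k; simpl; auto; apply C0_iint; auto. Qed.

(** Each iteration contributes a factor [C t^2 / ((2k+1)(2k+2))]. Weakening the denominator to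
    [k + 1] costs nothing essential and leaves the exponential series in [C * S ^ 2] as majorant. *)
Lemma picard_bound V g C G S k t : C0 V -> C0 g -> 0 <= C -> 0 <= G ->
  (forall r, Rabs (V r) <= C) -> (forall r, Rabs r <= S -> Rabs (g r) <= G) ->
  Rabs t <= S ->
  Rabs (picard V g k t) <= G * C ^ k / INR (fact k) * Rabs t ^ (2 * k).
Proof.
  intros HV Hg HC HG HVb Hgb; revert t; induction k as [|k IH]; intros t Ht.
  - simpl; unfold Rdiv; rewrite Rinv_1, !Rmult_1_r; auto.
  - simpl picard.
    eapply Rle_trans.
    { apply (iint_bound V (picard V g k) C (G * C ^ k / INR (fact k)) (2 * k) S t); auto.
      apply C0_picard; auto. }
    replace (2 * Datatypes.S k)%nat with (2 * k + 2)%nat by lia.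
    pose proof (INR_fact_lt_0 k) as Hf.
    assert (Hk : 0 <= INR k) by apply pos_INR.
    assert (Hpw : 0 <= Rabs t ^ (2 * k + 2)) by (apply pow_le, Rabs_pos).
    rewrite fact_simpl, mult_INR.
    replace (INR (2 * k + 1)) with (2 * INR k + 1) by (rewrite plus_INR, mult_INR; simpl; ring).
    replace (INR (2 * k + 2)) with (2 * INR k + 2) by (rewrite plus_INR, mult_INR; simpl; ring).
    rewrite S_INR.
    replace (C * (G * C ^ k / INR (fact k)) * Rabs t ^ (2 * k + 2)
              / ((2 * INR k + 1) * (2 * INR k + 2)))
      with (G * C ^ Datatypes.S k / ((INR k + 1) * INR (fact k)) * Rabs t ^ (2 * k + 2)
              * / (2 * (2 * INR k + 1))) by (simpl; field; lra).
    set (X := G * C ^ Datatypes.S k / ((INR k + 1) * INR (fact k)) * Rabs t ^ (2 * k + 2)).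
    assert (HX : 0 <= X).
    { unfold X; apply Rmult_le_pos; auto; apply Rmult_le_pos.
      - apply Rmult_le_pos; auto; apply pow_le; auto.
      - left; apply Rinv_0_lt_compat; nra. }
    assert (/ (2 * (2 * INR k + 1)) <= 1).
    { rewrite <- Rinv_1; apply Rinv_le_contravar; lra. }
    nra.
Qed.

Definition picard_sum (V g : R -> R) (n : nat) (t : R) : R :=
  sum_n (fun k => picard V g k t) n.

Lemma C0_picard_sum V g n : C0 V -> C0 g -> C0 (picard_sum V g n).
Proof.
  intros HV Hg; unfold picard_sum; induction n.
  - intros x; apply (continuous_ext (picard V g 0)).
    + intros y; rewrite sum_O; reflexivity.
    + apply C0_picard; auto.
  - intros x; apply (continuous_ext
      (fun t => sum_n (fun k => picard V g k t) n + picard V g (S n) t)).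
    + intros y; rewrite sum_Sn; reflexivity.
    + apply C0_plus; auto; apply C0_picard; auto.
Qed.

Lemma iint_ext V y z t : (forall r, y r = z r) -> iint V y t = iint V z t.
Proof.
  intros H; apply RInt_ext; intros s _; apply RInt_ext; intros r _; rewrite H; auto.
Qed.

Lemma iint_plus V y z t : C0 V -> C0 y -> C0 z ->
  iint V (fun r => y r + z r) t = iint V y t + iint V z t.
Proof.
  intros HV Hy Hz; unfold iint.
  rewrite <- RInt_add by (apply C0_RInt; c0).
  apply RInt_ext; intros s _; rewrite <- RInt_add by c0.
  apply RInt_ext; intros r _; simpl; ring.
Qed.

Lemma iint_minus V y z t : C0 V -> C0 y -> C0 z ->
  iint V (fun r => y r - z r) t = iint V y t - iint V z t.
Proof.
  intros HV Hy Hz; unfold iint.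
  rewrite <- RInt_sub by (apply C0_RInt; c0).
  apply RInt_ext; intros s _; rewrite <- RInt_sub by c0.
  apply RInt_ext; intros r _; simpl; ring.
Qed.

Lemma picard_sum_S V g n t : C0 V -> C0 g ->
  picard_sum V g (S n) t = g t + iint V (picard_sum V g n) t.
Proof.
  intros HV Hg; induction n as [|n IH].
  - unfold picard_sum; rewrite sum_Sn, sum_O; simpl.
    unfold plus; simpl; f_equal; apply iint_ext; intros r; rewrite sum_O; auto.
  - unfold picard_sum; rewrite sum_Sn; fold (picard_sum V g (S n) t).
    rewrite IH; unfold plus; simpl picard.
    rewrite (iint_ext V (fun t => sum_n (fun k => picard V g k t) (S n))
               (fun r => picard_sum V g n r + picard V g (S n) r)).
    + rewrite iint_plus; auto using C0_picard_sum.
      * simpl; ring.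
      * apply (C0_picard V g (S n)); auto.
    + intros r; rewrite sum_Sn; reflexivity.
Qed.

Lemma C0_bounded f S : C0 f -> exists G, 0 <= G /\ forall r, Rabs r <= S -> Rabs (f r) <= G.
Proof.
  intros Hf.
  destruct (Rle_dec 0 S) as [HS|HS].
  - destruct (continuity_ab_maj (fun x => Rabs (f x)) (- S) S) as [m [Hm _]]; [lra| |].
    + intros c _; apply (continuity_pt_comp f Rabs).
      * apply continuity_pt_filterlim, Hf.
      * apply Rcontinuity_abs.
    + exists (Rabs (f m)); split; [apply Rabs_pos|].
      intros r Hr; apply Hm; apply Rabs_le_between; auto.
  - exists 0; split; [lra|]; intros r Hr; pose proof (Rabs_pos r); lra.
Qed.

Lemma picard_uniform V g C S : C0 V -> C0 g -> 0 <= C -> 0 <= S ->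
  (forall r, Rabs (V r) <= C) ->
  forall eps, 0 < eps -> exists N, forall n t, (N <= n)%nat -> Rabs t <= S ->
    Rabs (Series (fun k => picard V g k t) - picard_sum V g n t) < eps.
Proof.
  intros HV Hg HC HS HVb eps Heps.
  destruct (C0_bounded g S Hg) as [G [HG Hgb]].
  pose (M := fun k => G * ((C * S ^ 2) ^ k / INR (fact k))).
  assert (HM : ex_series M).
  { apply (ex_series_scal G (fun k => (C * S ^ 2) ^ k / INR (fact k))).
    exists (exp (C * S ^ 2)).
    apply is_series_ext with (2 := is_exp_Reals (C * S ^ 2)).
    intros n; rewrite pow_n_pow; unfold scal; simpl; unfold mult; simpl.
    unfold Rdiv; ring. }
  assert (Hb : forall t k, Rabs t <= S -> Rabs (picard V g k t) <= M k).
  { intros t k Ht; eapply Rle_trans; [apply (picard_bound V g C G S); auto|].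
    unfold M; rewrite Rpow_mult_distr, <- pow_mult.
    pose proof (INR_fact_lt_0 k).
    replace (G * (C ^ k * S ^ (2 * k) / INR (fact k)))
      with (G * C ^ k / INR (fact k) * S ^ (2 * k)) by (field; lra).
    apply Rmult_le_compat_l.
    - apply Rmult_le_pos; [apply Rmult_le_pos; auto; apply pow_le; auto|].
      left; apply Rinv_0_lt_compat; auto.
    - apply pow_incr; split; [apply Rabs_pos | auto]. }
  assert (Hlim : is_lim_seq (sum_n M) (Series M)) by (apply Series_correct, HM).
  apply is_lim_seq_spec in Hlim.
  destruct (Hlim (mkposreal eps Heps)) as [N HN]; simpl in HN.
  exists N; intros n t Hn Ht.
  assert (Hex : ex_series (fun k => Rabs (picard V g k t))).
  { apply (ex_series_le (fun k => Rabs (picard V g k t)) M); auto.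
    intros k; unfold norm; simpl; unfold abs; simpl; rewrite Rabs_Rabsolu; auto. }
  rewrite (Series_incr_n (fun k => picard V g k t) (Datatypes.S n)); [|lia|apply ex_series_Rabs; auto].
  unfold picard_sum; rewrite sum_n_Reals; simpl pred.
  match goal with |- Rabs (?a + ?b - ?a) < _ => replace (a + b - a) with b by ring end.
  assert (Hex' : ex_series (fun k => Rabs (picard V g (Datatypes.S n + k) t)))
    by (apply (ex_series_incr_n (fun k => Rabs (picard V g k t)) (Datatypes.S n)); auto).
  eapply Rle_lt_trans; [apply Series_Rabs; auto|].
  assert (HMt : ex_series (fun k => M (Datatypes.S n + k)%nat))
    by (apply (ex_series_incr_n M (Datatypes.S n)); auto).
  eapply Rle_lt_trans.
  { apply Series_le with (2 := HMt); intros k; split; [apply Rabs_pos | auto]. }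
  specialize (HN n Hn).
  rewrite (Series_incr_n M (Datatypes.S n)) in HN; [|lia|auto].
  rewrite sum_n_Reals in HN; simpl pred in HN.
  match type of HN with Rabs (?a - (?a + ?b)) < _ =>
    replace (a - (a + b)) with (- b) in HN by ring end.
  rewrite Rabs_Ropp in HN; apply Rabs_def2 in HN; tauto.
Qed.

Lemma picard_fixpoint V g C : C0 V -> C0 g -> 0 <= C -> (forall r, Rabs (V r) <= C) ->
  let y := fun t => Series (fun k => picard V g k t) in
  C0 y /\ forall t, y t = g t + iint V y t.
Proof.
  intros HV Hg HC HVb y.
  assert (Hy : C0 y).
  { intros x; apply continuity_pt_filterlim.
    assert (Hr : 0 < Rabs x + 1) by (pose proof (Rabs_pos x); lra).
    apply (CVU_continuity (picard_sum V g) y 0 (mkposreal _ Hr)).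
    - intros eps Heps.
      destruct (picard_uniform V g C (Rabs x + 1) HV Hg HC ltac:(lra) HVb eps Heps) as [N HN].
      exists N; intros n z Hn Hz; apply HN; auto.
      unfold Boule in Hz; simpl in Hz; rewrite Rminus_0_r in Hz; lra.
    - intros n z _; apply continuity_pt_filterlim, C0_picard_sum; auto.
    - unfold Boule; simpl; rewrite Rminus_0_r; lra. }
  split; auto; intros t. apply Rminus_diag_uniq.
  set (S := Rabs t).
  assert (HS : 0 <= S) by apply Rabs_pos.
  (* Chosen so that a uniform error [e / (2 * K)] of the partial sum, together with its image under
     [iint], adds up to exactly [e / 2], which contradicts the definition of [e]. *)
  set (K := C * S ^ 2 / 2 + 1).
  assert (HK : 0 < K) by (unfold K; nra).
  destruct (Req_dec (y t - (g t + iint V y t)) 0) as [|Hne]; auto; exfalso.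
  set (e := Rabs (y t - (g t + iint V y t))).
  assert (He : 0 < e) by (apply Rabs_pos_lt; auto).
  assert (He2 : 0 < e / (2 * K)) by (apply Rdiv_lt_0_compat; lra).
  destruct (picard_uniform V g C S HV Hg HC HS HVb _ He2) as [N HN].
  assert (H1 := HN (Datatypes.S N) t ltac:(lia) ltac:(unfold S; lra)).
  rewrite picard_sum_S in H1 by auto.
  assert (H2 : Rabs (iint V (fun r => y r - picard_sum V g N r) t)
                <= C * (e / (2 * K)) * Rabs t ^ 2 / 2).
  { replace (C * (e / (2 * K)) * Rabs t ^ 2 / 2)
      with (C * (e / (2 * K)) * Rabs t ^ (0 + 2) / (INR (0 + 1) * INR (0 + 2)))
      by (simpl; field; lra).
    apply (iint_bound V _ C (e / (2 * K)) 0 S); auto.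
    - apply C0_minus; auto using C0_picard_sum.
    - unfold S; lra.
    - intros r Hr; simpl; rewrite Rmult_1_r; left; apply HN; auto. }
  rewrite iint_minus in H2 by auto using C0_picard_sum.
  fold S in H2.
  assert (e <= e / (2 * K) + C * (e / (2 * K)) * S ^ 2 / 2).
  { unfold e at 1.
    replace (y t - (g t + iint V y t))
      with ((y t - (g t + iint V (picard_sum V g N) t))
            + - (iint V y t - iint V (picard_sum V g N) t)) by ring.
    eapply Rle_trans; [apply Rabs_triang|]; rewrite Rabs_Ropp.
    change (Series (fun k => picard V g k t)) with (y t) in H1. lra. }
  replace (e / (2 * K) + C * (e / (2 * K)) * S ^ 2 / 2) with (e / 2) in H
    by (unfold K; field; unfold K in HK; lra).
  lra.
Qed.

(** The initial data and [f] enter through the free term [g] of the Picard equation. The sign of [f]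
    is such that for [V = Q - m] the solution satisfies [- y'' + Q y - m y = f]. *)
Lemma ode_exists V f C y0 z0 : C0 V -> C0 f -> 0 <= C -> (forall r, Rabs (V r) <= C) ->
  exists y z : R -> R, (forall t, is_derive y t (z t)) /\
    (forall t, is_derive z t (V t * y t - f t)) /\ y 0 = y0 /\ z 0 = z0.
Proof.
  intros HV Hf HC HVb.
  pose (g := fun t => y0 + z0 * t - RInt (fun s => RInt f 0 s) 0 t).
  assert (HF : C0 (RInt f 0)) by (apply C0_RInt; auto).
  assert (Hg : C0 g).
  { unfold g; apply C0_minus; [c0|]. apply (C0_RInt (fun s => RInt f 0 s)); auto. }
  destruct (picard_fixpoint V g C HV Hg HC HVb) as [Hy Heq].
  set (y := fun t => Series (fun k => picard V g k t)) in *.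
  assert (HVy : C0 (fun r => V r * y r)) by c0.
  exists y, (fun t => z0 - RInt f 0 t + RInt (fun r => V r * y r) 0 t).
  split; [|split; [|split]].
  - intros t; apply (is_derive_ext (fun t => g t + iint V y t)); [intros; symmetry; apply Heq|].
    apply (is_derive_plus g (iint V y)).
    + unfold g; apply (is_derive_minus (fun t => y0 + z0 * t)).
      * auto_derive; auto; ring.
      * apply (is_derive_RInt_C0 (fun s => RInt f 0 s)); auto.
    + apply (is_derive_RInt_C0 (fun s => RInt (fun r => V r * y r) 0 s)), C0_RInt; auto.
  - intros t.
    replace (V t * y t - f t) with ((0 - f t) + V t * y t) by ring.
    apply (is_derive_plus (fun t => z0 - RInt f 0 t)).
    + apply (is_derive_minus (fun _ => z0)); [apply (is_derive_const z0) | apply is_derive_RInt_C0; auto].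
    + apply (is_derive_RInt_C0 (fun r => V r * y r)); auto.
  - rewrite (Heq 0 : y 0 = g 0 + iint V y 0); unfold g, iint; rewrite !RInt_point; unfold zero; simpl; ring.
  - rewrite !RInt_point; unfold zero; simpl; ring.
Qed.

(** * Sturm-Liouville problems on [0, T] *)

Definition ip (T : R) (f g : R -> R) : R := RInt (fun t => f t * g t) 0 T.

Lemma ip_sym T f g : ip T f g = ip T g f.
Proof. apply RInt_eq; intros; ring. Qed.

Lemma ip_ext T f g f' g' : (forall t, f t = f' t) -> (forall t, g t = g' t) ->
  ip T f g = ip T f' g'.
Proof. intros Hf Hg; apply RInt_eq; intros; rewrite Hf, Hg; auto. Qed.

Lemma ip_plus_l T f g k : C0 f -> C0 g -> C0 k ->
  ip T (fun t => f t + g t) k = ip T f k + ip T g k.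
Proof.
  intros Hf Hg Hk; unfold ip; rewrite <- RInt_add by c0; apply RInt_eq; intros; ring.
Qed.

Lemma ip_minus_l T f g k : C0 f -> C0 g -> C0 k ->
  ip T (fun t => f t - g t) k = ip T f k - ip T g k.
Proof.
  intros Hf Hg Hk; unfold ip; rewrite <- RInt_sub by c0; apply RInt_eq; intros; ring.
Qed.

Lemma ip_scal_l T c f k : C0 f -> C0 k -> ip T (fun t => c * f t) k = c * ip T f k.
Proof.
  intros Hf Hk; unfold ip; rewrite <- RInt_mulc by c0; apply RInt_eq; intros; ring.
Qed.

Lemma ip_bilinear T f g f' g' x : C0 f -> C0 g -> C0 f' -> C0 g' ->
  ip T (fun t => f t + x * g t) (fun t => f' t + x * g' t)
  = ip T f f' + x * ip T f g' + x * ip T g f' + x * x * ip T g g'.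
Proof.
  intros Hf Hg Hf' Hg'.
  rewrite ip_plus_l, ip_scal_l by c0.
  rewrite !(ip_sym T _ (fun t => f' t + x * g' t)).
  rewrite !ip_plus_l, !ip_scal_l by c0.
  rewrite (ip_sym T f f'), (ip_sym T f g'), (ip_sym T g f'), (ip_sym T g g'); ring.
Qed.

Lemma ip_ge0 T f : 0 <= T -> C0 f -> 0 <= ip T f f.
Proof. intros HT Hf; apply RInt_ge0; auto; [c0 | intros; nra]. Qed.

Lemma ip_cauchy_schwarz T f g : 0 <= T -> C0 f -> C0 g ->
  ip T f g * ip T f g <= ip T f f * ip T g g.
Proof. intros; apply RInt_cauchy_schwarz; auto. Qed.

Lemma ip_bound T f M : 0 <= T -> C0 f -> (forall t, 0 <= t <= T -> f t * f t <= M) ->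
  ip T f f <= T * M.
Proof.
  intros HT Hf Hb.
  replace (T * M) with (RInt (fun _ => M) 0 T).
  - apply RInt_le_C0; auto; [c0 | c0 | intros; apply Hb; lra].
  - rewrite RInt_const; unfold scal; simpl; unfold mult; simpl; ring.
Qed.

Lemma green_identity (u u1 u2 v v1 v2 : R -> R) T :
  (forall t, is_derive u t (u1 t)) -> (forall t, is_derive u1 t (u2 t)) ->
  (forall t, is_derive v t (v1 t)) -> (forall t, is_derive v1 t (v2 t)) ->
  C0 u2 -> C0 v2 ->
  RInt (fun t => u t * v2 t - u2 t * v t) 0 T
  = (u T * v1 T - u1 T * v T) - (u 0 * v1 0 - u1 0 * v 0) :> R.
Proof.
  intros Hu Hu1 Hv Hv1 Cu2 Cv2.
  assert (Cu := C0_derive _ _ Hu); assert (Cu1 := C0_derive _ _ Hu1).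
  assert (Cv := C0_derive _ _ Hv); assert (Cv1 := C0_derive _ _ Hv1).
  apply (RInt_derive (fun t => u t * v1 t - u1 t * v t)); [|c0].
  intros t.
  evar_last.
  - apply (is_derive_minus (fun t => u t * v1 t) (fun t => u1 t * v t)).
    + apply (is_derive_mult u v1); [apply Hu | apply Hv1 | intros; apply Rmult_comm].
    + apply (is_derive_mult u1 v); [apply Hu1 | apply Hv | intros; apply Rmult_comm].
  - unfold minus, plus, opp, mult; simpl; ring.
Qed.

Lemma Rabs_double_mult_le a b : Rabs (2 * (a * b)) <= a * a + b * b.
Proof.
  pose proof (Rle_0_sqr (a + b)); pose proof (Rle_0_sqr (a - b)); unfold Rsqr in *.
  apply Rabs_le; lra.
Qed.

(** Gronwall for [y^2 + z^2]: its derivative is [2 y z (1 + V) - 2 z f], where the one term is at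
    most [(1 + C) (y^2 + z^2)] and the other at most [z^2 + f^2]. *)
Lemma ode_bound (V f y z : R -> R) C T t : 0 <= C -> 0 <= t <= T -> C0 f ->
  (forall r, Rabs (V r) <= C) ->
  (forall s, is_derive y s (z s)) -> (forall s, is_derive z s (V s * y s - f s)) ->
  y t * y t + z t * z t <= exp ((2 + C) * T) * (y 0 * y 0 + z 0 * z 0 + ip T f f).
Proof.
  intros HC Ht Hf HV Hy Hz.
  assert (Hff : C0 (fun s => f s * f s)) by c0.
  assert (HG := gronwall (fun s => y s * y s + z s * z s)
    (fun s => 2 * (y s * z s) + 2 * (z s * (V s * y s - f s)))
    (fun s => f s * f s) (2 + C) T t).
  assert (0 <= RInt (fun s => f s * f s) 0 t <= ip T f f).
  { split; [apply RInt_ge0; auto; [lra|intros; nra]|].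
    apply RInt_subinterval; try lra; auto; intros; nra. }
  eapply Rle_trans; [apply HG; auto; try lra|].
  - intros; nra.
  - intros s _; evar_last.
    + apply (is_derive_plus (fun s => y s * y s) (fun s => z s * z s)).
      * apply (is_derive_mult y y); [apply Hy | apply Hy | intros; apply Rmult_comm].
      * apply (is_derive_mult z z); [apply Hz | apply Hz | intros; apply Rmult_comm].
    + unfold plus, mult; simpl; ring.
  - intros s _.
    specialize (HV s); apply Rabs_le_between in HV.
    assert (2 * (y s * z s) * (1 + V s) <= (1 + C) * (y s * y s + z s * z s)).
    { apply Rle_trans with (Rabs (2 * (y s * z s)) * (1 + C)).
      - eapply Rle_trans; [apply Rle_abs|]; rewrite Rabs_mult.
        apply Rmult_le_compat_l; [apply Rabs_pos | apply Rabs_le; lra].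
      - rewrite (Rmult_comm (1 + C)); apply Rmult_le_compat_r; [lra|].
        apply Rabs_double_mult_le. }
    pose proof (Rle_0_sqr (z s + f s)); pose proof (Rle_0_sqr (y s)); unfold Rsqr in *.
    lra.
  - pose proof (exp_pos ((2 + C) * t)).
    assert (exp ((2 + C) * t) <= exp ((2 + C) * T)).
    { destruct (Req_dec t T) as [->|]; [lra|]; left; apply exp_increasing; nra. }
    pose proof (Rle_0_sqr (y 0)) as Sy; pose proof (Rle_0_sqr (z 0)) as Sz.
    unfold Rsqr in Sy, Sz.
    cbv beta; apply Rmult_le_compat; lra.
Qed.

(** Backward uniqueness: [exp ((1 + C) * s) * (y^2 + z^2)] is nondecreasing, so vanishing Cauchy
    data at [T] propagate to 0. *)
Lemma ode_nonvanishing (V y z : R -> R) C T : 0 <= C -> 0 <= T ->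
  (forall r, Rabs (V r) <= C) ->
  (forall s, is_derive y s (z s)) -> (forall s, is_derive z s (V s * y s)) ->
  y T = 0 -> z T = 0 -> y 0 = 0.
Proof.
  intros HC HT HV Hy Hz HyT HzT.
  assert (Hd : (fun s => - (exp ((1 + C) * s) * (y s * y s + z s * z s))) T
    <= (fun s => - (exp ((1 + C) * s) * (y s * y s + z s * z s))) 0).
  { apply (derive_nonpos_decr
      (fun s => - (exp ((1 + C) * s) * (y s * y s + z s * z s)))
      (fun s => - (exp ((1 + C) * s) * ((1 + C) * (y s * y s + z s * z s)
         + 2 * (y s * z s) * (1 + V s))))); auto.
    - intros s _; evar_last.
      + apply (is_derive_opp (fun s => exp ((1 + C) * s) * (y s * y s + z s * z s))).
        apply (is_derive_mult (fun s => exp ((1 + C) * s)) (fun s => y s * y s + z s * z s));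
          [ | | intros; apply Rmult_comm].
        * auto_derive; auto.
        * apply (is_derive_plus (fun s => y s * y s) (fun s => z s * z s)).
          -- apply (is_derive_mult y y); [apply Hy | apply Hy | intros; apply Rmult_comm].
          -- apply (is_derive_mult z z); [apply Hz | apply Hz | intros; apply Rmult_comm].
      + unfold plus, mult, opp; simpl; ring.
    - intros s _.
      specialize (HV s); apply Rabs_le_between in HV.
      pose proof (exp_pos ((1 + C) * s)).
      assert (- (2 * (y s * z s) * (1 + V s)) <= (1 + C) * (y s * y s + z s * z s)).
      { rewrite <- Ropp_mult_distr_l_reverse.
        apply Rle_trans with (Rabs (- (2 * (y s * z s))) * (1 + C)).
        - eapply Rle_trans; [apply Rle_abs|]; rewrite Rabs_mult.
          apply Rmult_le_compat_l; [apply Rabs_pos | apply Rabs_le; lra].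
        - rewrite (Rmult_comm (1 + C)); apply Rmult_le_compat_r; [lra|].
          rewrite Rabs_Ropp; apply Rabs_double_mult_le. }
      nra. }
  simpl in Hd; rewrite HyT, HzT, (Rmult_0_r (1 + C)), exp_0 in Hd.
  pose proof (Rle_0_sqr (y 0)); pose proof (Rle_0_sqr (z 0)).
  apply Rsqr_0_uniq; unfold Rsqr in *; lra.
Qed.

(* Membership of [u] in the domain of the Robin operator; [u1] and [u2] are its derivatives. *)
Definition dom (h H T : R) (u u1 u2 : R -> R) : Prop :=
  (forall t, is_derive u t (u1 t)) /\ (forall t, is_derive u1 t (u2 t)) /\ C0 u2 /\
  u1 0 = h * u 0 /\ u1 T = - H * u T.

Definition sl_op (Q u u2 : R -> R) (t : R) : R := - u2 t + Q t * u t.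

Lemma dom_C0 {h H T u u1 u2} : dom h H T u u1 u2 -> C0 u /\ C0 u1 /\ C0 u2.
Proof. intros (H1 & H2 & H3 & _); eauto using C0_derive. Qed.

Lemma C0_sl_op Q u u2 : C0 Q -> C0 u -> C0 u2 -> C0 (sl_op Q u u2).
Proof. intros; unfold sl_op; c0. Qed.

Lemma dom_lin h H T u u1 u2 v v1 v2 x :
  dom h H T u u1 u2 -> dom h H T v v1 v2 ->
  dom h H T (fun t => u t + x * v t) (fun t => u1 t + x * v1 t) (fun t => u2 t + x * v2 t).
Proof.
  intros (A1 & A2 & A3 & A4 & A5) (B1 & B2 & B3 & B4 & B5); refine (conj _ (conj _ (conj _ (conj _ _)))).
  - intros t; apply (is_derive_plus u); auto; apply (is_derive_scal v); auto.
  - intros t; apply (is_derive_plus u1); auto; apply (is_derive_scal v1); auto.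
  - c0.
  - rewrite A4, B4; ring.
  - rewrite A5, B5; ring.
Qed.

Lemma sl_op_sym Q h H T u u1 u2 v v1 v2 : C0 Q ->
  dom h H T u u1 u2 -> dom h H T v v1 v2 ->
  ip T (sl_op Q u u2) v = ip T (sl_op Q v v2) u.
Proof.
  intros HQ Du Dv.
  destruct (dom_C0 Du) as (Cu & Cu1 & Cu2).
  destruct (dom_C0 Dv) as (Cv & Cv1 & Cv2).
  destruct Du as (A1 & A2 & A3 & A4 & A5), Dv as (B1 & B2 & B3 & B4 & B5).
  assert (G := green_identity u u1 u2 v v1 v2 T A1 A2 B1 B2 A3 B3).
  rewrite A4, B4, A5, B5 in G.
  apply Rminus_diag_uniq.
  unfold ip; rewrite <- RInt_sub by (unfold sl_op; c0).
  rewrite (RInt_eq _ (fun t => u t * v2 t - u2 t * v t)) by (intros; unfold sl_op; ring).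
  rewrite G; ring.
Qed.

(* [rob] interpolates the Robin coefficients: [rob 0 = h] and [rob T = -H], so that
   completing the square in the Dirichlet form absorbs both boundary terms. *)
Definition rob (h H T t : R) : R := h - (h + H) / T * t.

Lemma C0_rob h H T : C0 (rob h H T).
Proof. unfold rob; c0. Qed.

(** The total derivative of [rob * u^2 - u' u] integrates to 0, because the Robin conditions make
    [rob * u = u'] at both ends. Adding it to the quadratic form completes the square. *)
Lemma form_identity Q h H T u u1 u2 : 0 < T -> C0 Q -> dom h H T u u1 u2 ->
  ip T (sl_op Q u u2) u =
  ip T (fun t => u1 t - rob h H T t * u t) (fun t => u1 t - rob h H T t * u t)
  + RInt (fun t => (Q t + (h + H) / T - rob h H T t * rob h H T t) * (u t * u t)) 0 T.
Proof.
  intros HT HQ D.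
  destruct (dom_C0 D) as (Cu & Cu1 & Cu2).
  destruct D as (A1 & A2 & A3 & A4 & A5).
  pose proof (C0_rob h H T) as Cp.
  set (p := rob h H T) in *.
  assert (E : RInt (fun t => p t * (2 * (u t * u1 t)) - (h + H) / T * (u t * u t)
                     - (u2 t * u t + u1 t * u1 t)) 0 T
     = (p T * (u T * u T) - u1 T * u T) - (p 0 * (u 0 * u 0) - u1 0 * u 0) :> R).
  { apply (RInt_derive (fun t => p t * (u t * u t) - u1 t * u t)); [|c0].
    intros t; evar_last.
    - apply (is_derive_minus (fun t => p t * (u t * u t)) (fun t => u1 t * u t)).
      + apply (is_derive_mult p (fun t => u t * u t)); [ | | intros; apply Rmult_comm].
        * unfold p, rob; auto_derive; auto.
        * apply (is_derive_mult u u); [apply A1 | apply A1 | intros; apply Rmult_comm].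
      + apply (is_derive_mult u1 u); [apply A2 | apply A1 | intros; apply Rmult_comm].
    - unfold minus, plus, mult, opp; simpl; ring. }
  rewrite A4, A5 in E.
  replace (p T) with (- H) in E by (unfold p, rob; field; lra).
  replace (p 0) with h in E by (unfold p, rob; ring).
  apply Rminus_diag_uniq.
  unfold ip; rewrite <- RInt_add by c0.
  rewrite <- RInt_sub by (unfold sl_op; c0).
  rewrite <- (RInt_eq (fun t => p t * (2 * (u t * u1 t)) - (h + H) / T * (u t * u t)
                     - (u2 t * u t + u1 t * u1 t))) by (intros; unfold sl_op; ring).
  rewrite E; ring.
Qed.

Lemma rob_bound h H T t : 0 < T -> 0 <= t <= T -> Rabs (rob h H T t) <= Rabs h + Rabs (h + H).
Proof.
  intros HT Ht; unfold rob.
  eapply Rle_trans; [apply Rabs_triang|]; rewrite Rabs_Ropp.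
  replace ((h + H) / T * t) with ((h + H) * (t / T)) by (field; lra).
  rewrite (Rabs_mult (h + H)).
  assert (0 <= t / T <= 1).
  { split; [apply Rdiv_le_0_compat; lra|].
    apply Rmult_le_reg_r with T; auto; replace (t / T * T) with t by (field; lra); lra. }
  rewrite (Rabs_pos_eq (t / T)) by lra.
  pose proof (Rabs_pos (h + H)); nra.
Qed.

(** The zero-order coefficient left over in [form_identity] is bounded below on [[0, T]], so a shift
    of the operator dominates the energy seminorm. The summand 1 in the constant makes it
    positive. *)
Lemma coercive Q h H T C : 0 < T -> C0 Q -> (forall r, Rabs (Q r) <= C) ->
  exists c0, 0 < c0 /\ forall u u1 u2, dom h H T u u1 u2 ->
  ip T (fun t => u1 t - rob h H T t * u t) (fun t => u1 t - rob h H T t * u t)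
  <= ip T (sl_op Q u u2) u + c0 * ip T u u.
Proof.
  intros HT HQ HC.
  set (P := Rabs h + Rabs (h + H)).
  exists (C + Rabs ((h + H) / T) + P * P + 1); split.
  { pose proof (HC 0); pose proof (Rabs_pos (Q 0)); pose proof (Rabs_pos ((h + H) / T)); nra. }
  intros u u1 u2 D.
  rewrite (form_identity Q h H T u u1 u2 HT HQ D).
  destruct (dom_C0 D) as (Cu & Cu1 & Cu2).
  pose proof (C0_rob h H T) as Cp.
  set (K := C + _ + _ + _).
  assert (0 <= RInt (fun t => (Q t + (h + H) / T - rob h H T t * rob h H T t) * (u t * u t)) 0 T
     + K * ip T u u); [|lra].
  unfold ip; rewrite <- RInt_mulc, <- RInt_add by c0.
  apply RInt_ge0; [lra|c0|].
  intros t Ht.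
  assert (Hr := rob_bound h H T t HT ltac:(lra)).
  specialize (HC t); apply Rabs_le_between in HC.
  assert (rob h H T t * rob h H T t <= P * P).
  { rewrite <- (Rabs_pos_eq (_ * _)) by nra; rewrite Rabs_mult.
    apply Rmult_le_compat; auto using Rabs_pos. }
  pose proof (Rle_abs (- ((h + H) / T))) as Hd; rewrite Rabs_Ropp in Hd.
  assert (0 <= Q t + (h + H) / T - rob h H T t * rob h H T t + K) by (unfold K; lra).
  nra.
Qed.

(** The classical problem with all solutions normalised at 0. [sp_all] expresses completeness of the
    list [lam]: a number whose normalised solution meets the condition at [T] occurs in it. The
    other fields only say that each listed number is an eigenvalue. *)
Record spectral (T : R) (Q : R -> R) (h H : R) (lam : nat -> R) (ph ps : nat -> R -> R) : Prop := {
  sp_T : 0 < T;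
  sp_Q : C0 Q;
  sp_bd : exists C, 0 <= C /\ forall r, Rabs (Q r) <= C;
  sp_incr : forall n m, (n < m)%nat -> lam n < lam m;
  sp_ph : forall n t, is_derive (ph n) t (ps n t);
  sp_ps : forall n t, is_derive (ps n) t ((Q t - lam n) * ph n t);
  sp_ph0 : forall n, ph n 0 = 1;
  sp_ps0 : forall n, ps n 0 = h;
  sp_psT : forall n, ps n T = - H * ph n T;
  sp_all : forall m y z,
    (forall t, is_derive y t (z t)) -> (forall t, is_derive z t ((Q t - m) * y t)) ->
    y 0 = 1 -> z 0 = h -> z T = - H * y T -> exists n, lam n = m
}.

Arguments sp_T {T Q h H lam ph ps}.
Arguments sp_Q {T Q h H lam ph ps}.
Arguments sp_bd {T Q h H lam ph ps}.
Arguments sp_incr {T Q h H lam ph ps}.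
Arguments sp_ph {T Q h H lam ph ps}.
Arguments sp_ps {T Q h H lam ph ps}.
Arguments sp_ph0 {T Q h H lam ph ps}.
Arguments sp_ps0 {T Q h H lam ph ps}.
Arguments sp_psT {T Q h H lam ph ps}.
Arguments sp_all {T Q h H lam ph ps}.

(** * Eigenfunctions and the resolvent *)

Lemma sp_shift {T Q h H lam ph ps} m : spectral T Q h H lam ph ps ->
  exists C, 0 <= C /\ forall r, Rabs (Q r - m) <= C.
Proof.
  intros S; destruct (sp_bd S) as [C [HC HQ]].
  exists (C + Rabs m); split; [pose proof (Rabs_pos m); lra|].
  intros r; eapply Rle_trans; [apply Rabs_triang|]; rewrite Rabs_Ropp.
  specialize (HQ r); lra.
Qed.

Lemma sp_C0 {T Q h H lam ph ps} n : spectral T Q h H lam ph ps -> C0 (ph n) /\ C0 (ps n).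
Proof.
  intros S; split; eapply C0_derive; intros t.
  - apply (sp_ph S).
  - apply (sp_ps S).
Qed.

Lemma sp_dom {T Q h H lam ph ps} n : spectral T Q h H lam ph ps ->
  dom h H T (ph n) (ps n) (fun t => (Q t - lam n) * ph n t).
Proof.
  intros S; destruct (sp_C0 n S) as [C1 C2].
  assert (HQ := sp_Q S).
  refine (conj _ (conj _ (conj _ (conj _ _)))).
  - apply (sp_ph S).
  - apply (sp_ps S).
  - c0.
  - rewrite (sp_ps0 S), (sp_ph0 S); ring.
  - apply (sp_psT S).
Qed.

Lemma sl_op_ph Q lam (y : R -> R) t : sl_op Q y (fun t => (Q t - lam) * y t) t = lam * y t.
Proof. unfold sl_op; ring. Qed.

Lemma sp_phT {T Q h H lam ph ps} n : spectral T Q h H lam ph ps -> ph n T <> 0.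
Proof.
  intros S E.
  destruct (sp_shift (lam n) S) as [C [HC HQ]].
  assert (HT := sp_T S).
  assert (E0 : ph n 0 = 0).
  { apply (ode_nonvanishing (fun t => Q t - lam n) (ph n) (ps n) C T); auto; try lra.
    - apply (sp_ph S).
    - apply (sp_ps S).
    - rewrite (sp_psT S), E; ring. }
  rewrite (sp_ph0 S) in E0; lra.
Qed.

Lemma sp_norm_pos {T Q h H lam ph ps} n : spectral T Q h H lam ph ps -> 0 < ip T (ph n) (ph n).
Proof.
  intros S; apply RInt_sqr_pos.
  - apply (sp_T S).
  - apply (sp_C0 n S).
  - rewrite (sp_ph0 S); lra.
Qed.

Lemma sp_neq {T Q h H lam ph ps} n m : spectral T Q h H lam ph ps -> n <> m -> lam n <> lam m.
Proof.
  intros S Hnm; destruct (Nat.lt_total n m) as [L|[L|L]]; [|lia|];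
    pose proof (sp_incr S _ _ L); lra.
Qed.

Lemma sp_weak {T Q h H lam ph ps} n {u u1 u2} : spectral T Q h H lam ph ps ->
  dom h H T u u1 u2 -> ip T (sl_op Q u u2) (ph n) = lam n * ip T u (ph n).
Proof.
  intros S D; rewrite (sl_op_sym Q h H T u u1 u2 _ _ _ (sp_Q S) D (sp_dom n S)).
  rewrite (ip_ext T _ u (fun t => lam n * ph n t) u) by (auto using sl_op_ph).
  destruct (dom_C0 D) as (Cu & _).
  destruct (sp_C0 n S) as [C1 _].
  rewrite ip_scal_l by auto; rewrite (ip_sym T (ph n)); auto.
Qed.

Lemma sp_orth {T Q h H lam ph ps} n m : spectral T Q h H lam ph ps -> n <> m ->
  ip T (ph n) (ph m) = 0.
Proof.
  intros S Hnm.
  assert (E := sp_weak m S (sp_dom n S)).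
  rewrite (ip_ext T _ (ph m) (fun t => lam n * ph n t) (ph m)) in E by (auto using sl_op_ph).
  rewrite ip_scal_l in E by apply (sp_C0 _ S).
  assert (D := sp_neq n m S Hnm).
  apply Rmult_eq_reg_l with (lam n - lam m); lra.
Qed.

(** Shooting: [y] solves the homogeneous equation with the Robin condition at 0, and [D] is its
    defect at [T]. If [D <> 0], a multiple of [y] corrects the particular solution [v]. If [D = 0],
    then [m] is some [lam k] with [k < N]; Green's identity and the orthogonality of [f] to [ph k]
    give [v] the right condition at [T], and only its component along [ph k] has to be removed. *)
Lemma resolvent T Q h H lam ph ps N m : spectral T Q h H lam ph ps ->
  (forall k, (N <= k)%nat -> lam k <> m) ->
  exists C, 0 < C /\ forall f, C0 f -> (forall n, (n < N)%nat -> ip T f (ph n) = 0) ->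
  exists u u1 u2, dom h H T u u1 u2 /\ (forall t, sl_op Q u u2 t - m * u t = f t) /\
    (forall n, (n < N)%nat -> ip T u (ph n) = 0) /\ ip T u u <= C * ip T f f.
Proof.
  intros S Hm.
  destruct (sp_shift m S) as [CV [HCV HV]].
  assert (HT := sp_T S).
  assert (HQ := sp_Q S).
  assert (CQ : C0 (fun t => Q t - m)) by c0.
  destruct (ode_exists (fun t => Q t - m) (fun _ => 0) CV 1 h CQ (C0_const 0) HCV HV)
    as (y & z & Hy & Hz & Hy0 & Hz0).
  assert (Hz' : forall t, is_derive z t ((Q t - m) * y t)).
  { intros t; replace ((Q t - m) * y t) with ((Q t - m) * y t - 0) by ring; auto. }
  clear Hz.
  assert (Cy := C0_derive _ _ Hy); assert (Cz := C0_derive _ _ Hz').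
  set (D := z T + H * y T).
  assert (Hsol : forall f, C0 f -> exists v v1 : R -> R, (forall t, is_derive v t (v1 t)) /\
     (forall t, is_derive v1 t ((Q t - m) * v t - f t)) /\ v 0 = 0 /\ v1 0 = 0).
  { intros f Hf; apply (ode_exists (fun t => Q t - m) f CV 0 0 CQ Hf HCV HV). }
  set (K := exp ((2 + CV) * T)).
  assert (HK : 0 < K) by apply exp_pos.
  assert (Hest : forall (f v v1 : R -> R) t, C0 f -> (forall t, is_derive v t (v1 t)) ->
     (forall t, is_derive v1 t ((Q t - m) * v t - f t)) -> v 0 = 0 -> v1 0 = 0 ->
     0 <= t <= T -> v t * v t + v1 t * v1 t <= K * ip T f f).
  { intros f v v1 t Hf Hv Hv1 E0 E1 Ht.
    assert (B := ode_bound (fun t => Q t - m) f v v1 CV T t HCV Ht Hf HV Hv Hv1).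
    rewrite E0, E1 in B; fold K in B.
    replace (0 * 0 + 0 * 0 + ip T f f) with (ip T f f) in B by ring; auto. }
  assert (Horth : forall (f u u1 u2 : R -> R) n, C0 f -> dom h H T u u1 u2 ->
     (forall t, sl_op Q u u2 t - m * u t = f t) -> lam n <> m -> ip T f (ph n) = 0 ->
     ip T u (ph n) = 0).
  { intros f u u1 u2 n Hf Du He Hn Hfn.
    assert (W := sp_weak n S Du).
    destruct (dom_C0 Du) as (Cu & Cu1 & Cu2).
    destruct (sp_C0 n S) as [C1 _].
    rewrite (ip_ext T _ (ph n) (fun t => f t + m * u t) (ph n)) in W
      by (intros; try rewrite <- He; ring).
    rewrite ip_plus_l, ip_scal_l, Hfn in W by c0.
    apply Rmult_eq_reg_l with (lam n - m); lra. }
  destruct (Req_dec D 0) as [HD|HD].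
  - destruct (sp_all S m y z Hy Hz' Hy0 Hz0) as [k Hk]; [unfold D in HD; lra|].
    assert (HkN : (k < N)%nat).
    { destruct (Nat.le_gt_cases N k) as [L|L]; auto; destruct (Hm k L Hk). }
    destruct (sp_C0 k S) as [Ck Ck1].
    assert (Hal := sp_norm_pos k S).
    assert (Dk := sp_dom k S).
    exists (T * K); split; [nra|].
    intros f Hf Hfo.
    destruct (Hsol f Hf) as (v & v1 & Hv & Hv1 & E0 & E1).
    assert (Cv := C0_derive _ _ Hv); assert (Cv1 := C0_derive _ _ Hv1).
    assert (Cv2 : C0 (fun t => (Q t - m) * v t - f t)) by c0.
    assert (Dv : dom h H T v v1 (fun t => (Q t - m) * v t - f t)).
    { refine (conj _ (conj _ (conj _ (conj _ _)))); auto; [rewrite E0, E1; ring|].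
      assert (G := green_identity v v1 _ (ph k) (ps k) _ T Hv Hv1
        (sp_ph S k) (sp_ps S k) Cv2 ltac:(c0)).
      rewrite (RInt_eq _ (fun t => f t * ph k t)) in G by (intros; rewrite Hk; ring).
      change (ip T f (ph k) = v T * ps k T - v1 T * ph k T - (v 0 * ps k 0 - v1 0 * ph k 0)) in G.
      rewrite (Hfo k HkN), E0, E1, (sp_psT S) in G.
      apply Rmult_eq_reg_r with (ph k T); [lra | apply (sp_phT k S)]. }
    set (c := - (ip T v (ph k) / ip T (ph k) (ph k))).
    assert (Du := dom_lin h H T v v1 _ (ph k) (ps k) _ c Dv Dk).
    eexists _, _, _; split; [exact Du|].
    assert (He : forall t, sl_op Q (fun t => v t + c * ph k t)
      (fun t => (Q t - m) * v t - f t + c * ((Q t - lam k) * ph k t)) t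
      - m * (v t + c * ph k t) = f t) by (intros t; unfold sl_op; rewrite Hk; ring).
    assert (Ek : ip T (fun t => v t + c * ph k t) (ph k) = 0).
    { rewrite ip_plus_l, ip_scal_l by c0; unfold c; field; lra. }
    split; [exact He|]; split.
    + intros n Hn; destruct (Nat.eq_dec n k) as [->|Hnk]; auto.
      apply (Horth f _ _ _ n Hf Du He); auto.
      rewrite <- Hk; apply (sp_neq n k S Hnk).
    (* Removing the component along [ph k] does not increase the norm, so the Gronwall bound for [v]
       carries over. *)
    + apply Rle_trans with (ip T v v).
      * rewrite ip_bilinear by c0.
        rewrite ip_plus_l, ip_scal_l in Ek by c0.
        rewrite (ip_sym T (ph k) v).
        replace (ip T v (ph k)) with (- (c * ip T (ph k) (ph k))) by lra.
        nra.
      * rewrite Rmult_assoc; apply ip_bound; auto; [lra|].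
        intros t Ht; pose proof (Hest f v v1 t Hf Hv Hv1 E0 E1 Ht); nra.
  - assert (Hy2 := ip_ge0 T y ltac:(lra) Cy).
    set (M := 2 * (1 + H * H) / (D * D)).
    assert (HDD : 0 < D * D) by nra.
    assert (HM : 0 < M) by (apply Rdiv_lt_0_compat; nra).
    exists (2 * T * K + 2 * M * K * ip T y y); split.
    { assert (0 <= M * K * ip T y y) by (apply Rmult_le_pos; auto; nra). nra. }
    intros f Hf Hfo.
    destruct (Hsol f Hf) as (v & v1 & Hv & Hv1 & E0 & E1).
    assert (Cv := C0_derive _ _ Hv); assert (Cv1 := C0_derive _ _ Hv1).
    assert (Cv2 : C0 (fun t => (Q t - m) * v t - f t)) by c0.
    set (c := - ((v1 T + H * v T) / D)).
    exists (fun t => v t + c * y t), (fun t => v1 t + c * z t),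
      (fun t => (Q t - m) * v t - f t + c * ((Q t - m) * y t)).
    assert (Du : dom h H T (fun t => v t + c * y t) (fun t => v1 t + c * z t)
      (fun t => (Q t - m) * v t - f t + c * ((Q t - m) * y t))).
    { refine (conj _ (conj _ (conj _ (conj _ _)))).
      - intros t; apply (is_derive_plus v); auto; apply (is_derive_scal y); auto.
      - intros t; apply (is_derive_plus v1); auto; apply (is_derive_scal z); auto.
      - c0.
      - rewrite E0, E1, Hy0, Hz0; ring.
      - assert (c * D = - (v1 T + H * v T)) by (unfold c; field; auto).
        unfold D in *; lra. }
    assert (He : forall t, sl_op Q (fun t => v t + c * y t)
      (fun t => (Q t - m) * v t - f t + c * ((Q t - m) * y t)) t
      - m * (v t + c * y t) = f t) by (intros t; unfold sl_op; ring).
    split; [exact Du|]; split; [exact He|]; split.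
    + intros n Hn; apply (Horth f _ _ _ n Hf Du He); auto.
      (* If [m = lam n], then [y] and [ph n] share equation and Cauchy data; their Wronskian at [T]
         vanishes and, as [ph n T <> 0], forces [D = 0]. *)
      intros Hlm; apply HD.
      destruct (sp_C0 n S) as [Cn Cn1].
      assert (G := green_identity y z _ (ph n) (ps n) _ T Hy Hz'
        (sp_ph S n) (sp_ps S n) ltac:(c0) ltac:(c0)).
      rewrite (RInt_eq _ (fun t => 0)) in G by (intros; rewrite Hlm; ring).
      rewrite RInt_0, Hy0, Hz0, (sp_psT S), (sp_ps0 S),
        (sp_ph0 S) in G.
      apply Rmult_eq_reg_r with (ph n T); [unfold D; lra | apply (sp_phT n S)].
    + assert (Hc : c * c <= M * K * ip T f f).
      { pose proof (Hest f v v1 T Hf Hv Hv1 E0 E1 ltac:(lra)) as B.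
        replace (c * c) with ((v1 T + H * v T) * (v1 T + H * v T) / (D * D))
          by (unfold c; field; auto).
        unfold M; apply Rmult_le_reg_r with (D * D); auto.
        replace ((v1 T + H * v T) * (v1 T + H * v T) / (D * D) * (D * D))
          with ((v1 T + H * v T) * (v1 T + H * v T)) by (field; auto).
        replace (2 * (1 + H * H) / (D * D) * K * ip T f f * (D * D))
          with (2 * (1 + H * H) * (K * ip T f f)) by (field; auto).
        apply Rle_trans with (2 * (1 + H * H) * (v T * v T + v1 T * v1 T)).
        - assert (0 <= (v1 T - H * v T) ^ 2) by apply pow2_ge_0.
          assert (0 <= H * H * (v1 T * v1 T)) by nra.
          nra.
        - apply Rmult_le_compat_l; nra. }
      assert (Hvv : ip T v v <= T * (K * ip T f f)).
      { apply ip_bound; auto; [lra|].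
        intros t Ht; pose proof (Hest f v v1 t Hf Hv Hv1 E0 E1 Ht); nra. }
      (* Nonnegativity of the norm of [v - c y] gives the bound of the norm of [v + c y] by twice
         the sum of the two squared norms. *)
      assert (Hneg := ip_ge0 T (fun t => v t + - c * y t) ltac:(lra) ltac:(c0)).
      rewrite ip_bilinear in Hneg by c0.
      rewrite ip_bilinear by c0.
      assert (c * c * ip T y y <= M * K * ip T f f * ip T y y)
        by (apply Rmult_le_compat_r; auto).
      lra.
Qed.

(** * Variational bounds on the spectrum *)

(** Let [v] be the resolvent at [m] applied to [u]. For the form of the operator shifted by [m],
    which is nonnegative on the complement, the pairing of [u] with [v] is [a = ip T u u] and the
    value at [v] is [ip T u v]. Cauchy-Schwarz for this form gives [a^2 <= A * ip T u v], and
    boundedness of the resolvent turns this into [a <= (1 + C) * A]. *)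
Lemma form_lower_bound_improves T Q h H lam ph ps N m : spectral T Q h H lam ph ps ->
  (forall k, (N <= k)%nat -> lam k <> m) ->
  (forall u u1 u2, dom h H T u u1 u2 -> (forall n, (n < N)%nat -> ip T u (ph n) = 0) ->
     m * ip T u u <= ip T (sl_op Q u u2) u) ->
  exists d, 0 < d /\
  forall u u1 u2, dom h H T u u1 u2 -> (forall n, (n < N)%nat -> ip T u (ph n) = 0) ->
     (m + d) * ip T u u <= ip T (sl_op Q u u2) u.
Proof.
  intros S Hm Hlow.
  assert (HT := sp_T S); assert (HQ := sp_Q S).
  destruct (resolvent T Q h H lam ph ps N m S Hm) as (C & HC & Hres).
  exists (/ (1 + C)); split; [apply Rinv_0_lt_compat; lra|].
  intros u u1 u2 Du Hu.
  destruct (dom_C0 Du) as (Cu & Cu1 & Cu2).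
  destruct (Hres u Cu Hu) as (v & v1 & v2 & Dv & Ev & Hv & Bv).
  destruct (dom_C0 Dv) as (Cv & Cv1 & Cv2).
  assert (CLu := C0_sl_op Q u u2 HQ Cu Cu2).
  assert (CLv := C0_sl_op Q v v2 HQ Cv Cv2).
  set (a := ip T u u) in *.
  assert (Ha : 0 <= a) by (apply ip_ge0; auto; lra).
  assert (Evu : ip T (sl_op Q v v2) u = a + m * ip T v u).
  { rewrite (ip_ext T _ u (fun t => u t + m * v t) u) by (intros; try rewrite <- Ev; ring).
    rewrite ip_plus_l, ip_scal_l by c0; auto. }
  assert (Evv : ip T (sl_op Q v v2) v = ip T u v + m * ip T v v).
  { rewrite (ip_ext T _ v (fun t => u t + m * v t) v) by (intros; try rewrite <- Ev; ring).
    rewrite ip_plus_l, ip_scal_l by c0; auto. }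
  assert (Euv := sl_op_sym Q h H T u u1 u2 v v1 v2 HQ Du Dv).
  set (A := ip T (sl_op Q u u2) u - m * a).
  assert (HA : 0 <= A) by (unfold A; specialize (Hlow u u1 u2 Du Hu); fold a in Hlow; lra).
  assert (Hb : 0 <= ip T u v).
  { specialize (Hlow v v1 v2 Dv Hv); lra. }
  assert (CS : a * a <= A * ip T u v).
  { apply quadratic_form_ineq; auto; intros x.
    assert (B := Hlow _ _ _ (dom_lin h H T u u1 u2 v v1 v2 x Du Dv)).
    assert (Ho : forall n, (n < N)%nat -> ip T (fun t => u t + x * v t) (ph n) = 0).
    { intros n Hn; destruct (sp_C0 n S).
      rewrite ip_plus_l, ip_scal_l, Hu, Hv by c0; ring. }
    specialize (B Ho).
    rewrite (ip_ext T (sl_op Q _ _) (fun t => u t + x * v t)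
      (fun t => sl_op Q u u2 t + x * sl_op Q v v2 t) (fun t => u t + x * v t)) in B
      by (intros; unfold sl_op; ring).
    rewrite !ip_bilinear in B by auto.
    rewrite Euv, Evu, Evv, (ip_sym T v u) in B.
    fold a in B; unfold A; lra. }
  assert (CS2 := ip_cauchy_schwarz T u v ltac:(lra) Cu Cv); fold a in CS2.
  assert (Hb2 : ip T u v <= (1 + C) * a).
  (* The natural factor is the square root of [C]; [1 + C] dominates it without introducing a
     root. *)
  { apply Rsqr_incr_0_var; [|nra]; unfold Rsqr.
    assert (a * ip T v v <= a * (C * a)) by (apply Rmult_le_compat_l; auto).
    nra. }
  assert (Hfin : a <= (1 + C) * A).
  { destruct Ha as [Ha|Ha]; [|rewrite <- Ha; nra].
    apply Rmult_le_reg_l with a; auto.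
    apply Rle_trans with (A * ip T u v); auto.
    assert (A * ip T u v <= A * ((1 + C) * a)) by (apply Rmult_le_compat_l; auto).
    lra. }
  assert (/ (1 + C) * a <= A).
  { apply Rmult_le_reg_l with (1 + C); [lra|].
    replace ((1 + C) * (/ (1 + C) * a)) with a by (field; lra); auto. }
  unfold A in *; lra.
Qed.

(** The admissible lower bounds form a set that is nonempty by coercivity and bounded by [lam N],
    since [ph N] is a test function. Its supremum is again admissible. Were it below [lam N], it
    would differ from every [lam k] with [k >= N], and the improved bound would exceed it. *)
Lemma rayleigh T Q h H lam ph ps N u u1 u2 : spectral T Q h H lam ph ps ->
  dom h H T u u1 u2 -> (forall n, (n < N)%nat -> ip T u (ph n) = 0) ->
  lam N * ip T u u <= ip T (sl_op Q u u2) u.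
Proof.
  intros S Du Hu.
  assert (HT := sp_T S); assert (HQ := sp_Q S).
  pose (E := fun m => forall u u1 u2, dom h H T u u1 u2 ->
     (forall n, (n < N)%nat -> ip T u (ph n) = 0) -> m * ip T u u <= ip T (sl_op Q u u2) u).
  assert (Hub : is_upper_bound E (lam N)).
  { intros m Hm.
    assert (B := Hm _ _ _ (sp_dom N S)).
    rewrite (ip_ext T (sl_op Q _ _) (ph N) (fun t => lam N * ph N t) (ph N)) in B
      by (auto using sl_op_ph).
    destruct (sp_C0 N S) as [CN _].
    rewrite ip_scal_l in B by auto.
    apply Rmult_le_reg_r with (ip T (ph N) (ph N)); [apply (sp_norm_pos N S)|].
    apply B; intros n Hn; apply (sp_orth N n S); lia. }
  destruct (sp_bd S) as (CQ & HCQ & HQb).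
  destruct (coercive Q h H T CQ HT HQ HQb) as (c & Hc & Hco).
  assert (Hne : exists m, E m).
  { exists (- c); intros v v1 v2 Dv _.
    specialize (Hco v v1 v2 Dv).
    destruct (dom_C0 Dv) as (Cv & Cv1 & Cv2).
    pose proof (C0_rob h H T) as Cp.
    assert (0 <= ip T (fun t => v1 t - rob h H T t * v t) (fun t => v1 t - rob h H T t * v t))
      by (apply ip_ge0; [lra | c0]).
    lra. }
  destruct (completeness E (ex_intro _ _ Hub) Hne) as [ms [Hms1 Hms2]].
  assert (HE : E ms).
  { intros v v1 v2 Dv Hv.
    destruct (dom_C0 Dv) as (Cv & _).
    destruct (ip_ge0 T v ltac:(lra) Cv) as [Hp|Hp].
    - apply Rmult_le_reg_r with (/ ip T v v); [apply Rinv_0_lt_compat; auto|].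
      rewrite Rmult_assoc, Rinv_r, Rmult_1_r by lra.
      apply Hms2; intros m Hm; specialize (Hm v v1 v2 Dv Hv).
      apply Rmult_le_reg_r with (ip T v v); auto.
      rewrite Rmult_assoc, Rinv_l by lra; lra.
    - destruct Hne as [m Hm]; specialize (Hm v v1 v2 Dv Hv); rewrite <- Hp in *; lra. }
  assert (Hle : lam N <= ms).
  { destruct (Rle_lt_dec (lam N) ms) as [|Hlt]; auto; exfalso.
    destruct (form_lower_bound_improves T Q h H lam ph ps N ms S) as (d & Hd & HEd); auto.
    - intros k Hk; destruct (Nat.eq_dec N k) as [->|]; [lra|].
      assert (B := sp_incr S N k ltac:(lia)); lra.
    - assert (B : ms + d <= ms) by (apply Hms1; exact HEd); lra. }
  destruct (dom_C0 Du) as (Cu & _).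
  pose proof (ip_ge0 T u ltac:(lra) Cu).
  specialize (HE u u1 u2 Du Hu); nra.
Qed.

(** Otherwise the eigenvalues increase to a finite limit [ls]. By continuous dependence on the
    parameter, two consecutive eigenfunctions of large index are both close to the normalised
    solution [y] at [ls]; but they are orthogonal to each other, while [y] is not zero. *)
Lemma lam_unbounded T Q h H lam ph ps M : spectral T Q h H lam ph ps ->
  exists N0, forall N, (N0 <= N)%nat -> M <= lam N.
Proof.
  intros S.
  assert (HT := sp_T S); assert (HQ := sp_Q S).
  destruct (classic (exists N0, M <= lam N0)) as [[N0 HN0]|Hn].
  { exists N0; intros N HN; destruct (Nat.eq_dec N0 N) as [<-|]; auto.
    pose proof (sp_incr S N0 N ltac:(lia)); lra. }
  exfalso.
  assert (Hb : forall n, lam n < M).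
  { intros n; destruct (Rlt_le_dec (lam n) M); auto; exfalso; eauto. }
  pose (E := fun x => exists n, x = lam n).
  destruct (completeness E) as [ls [L1 L2]].
  { exists M; intros x [n ->]; left; auto. }
  { exists (lam O); exists O; auto. }
  destruct (sp_bd S) as (CQ & HCQ & HQb).
  destruct (sp_shift ls S) as (CV & HCV & HV).
  assert (CQs : C0 (fun t => Q t - ls)) by c0.
  destruct (ode_exists (fun t => Q t - ls) (fun _ => 0) CV 1 h CQs (C0_const 0) HCV HV)
    as (y & z & Hy & Hz & Hy0 & Hz0).
  assert (Cy := C0_derive _ _ Hy).
  assert (Hyy : 0 < ip T y y) by (apply RInt_sqr_pos; auto; lra).
  pose (C := CQ + Rabs (lam O) + Rabs M).
  assert (HC : 0 <= C) by (unfold C; pose proof (Rabs_pos (lam O)); pose proof (Rabs_pos M); lra).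
  assert (HVn : forall n r, Rabs (Q r - lam n) <= C).
  { intros n r; unfold C; specialize (HQb r); specialize (Hb n).
    assert (lam O <= lam n).
    { destruct n; [lra|]; left; apply (sp_incr S); lia. }
    pose proof (Rle_abs M); pose proof (Rle_abs (- lam O)) as B; rewrite Rabs_Ropp in B.
    pose proof (Rabs_pos (lam O)); pose proof (Rabs_pos M).
    apply Rabs_le_between in HQb; apply Rabs_le; lra. }
  set (K := T * exp ((2 + C) * T)).
  assert (HK : 0 < K) by (unfold K; pose proof (exp_pos ((2 + C) * T)); nra).
  assert (Hd : forall n, ip T (fun t => ph n t + -1 * y t) (fun t => ph n t + -1 * y t)
      <= K * ((ls - lam n) * (ls - lam n)) * ip T y y).
  { intros n; destruct (sp_C0 n S) as [Cn Cn1].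
    unfold K; rewrite !Rmult_assoc; apply ip_bound; [lra|c0|].
    intros t Ht.
    (* The difference [ph n - y] has zero Cauchy data and solves the equation at [lam n] with the
       inhomogeneity [(lam n - ls) * y]. *)
    assert (B := ode_bound (fun t => Q t - lam n) (fun t => (lam n - ls) * y t)
      (fun t => ph n t + -1 * y t) (fun t => ps n t + -1 * z t) C T t HC Ht ltac:(c0) (HVn n)).
    assert (B' := B
      ltac:(intros s; apply (is_derive_plus (ph n)); [apply (sp_ph S) | apply (is_derive_scal y); auto])).
    clear B.
    assert (Hz2 : forall s, is_derive (fun t => ps n t + -1 * z t) s
      ((Q s - lam n) * (ph n s + -1 * y s) - (lam n - ls) * y s)).
    { intros s; replace ((Q s - lam n) * (ph n s + -1 * y s) - (lam n - ls) * y s)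
        with ((Q s - lam n) * ph n s + -1 * ((Q s - ls) * y s - 0)) by ring.
      apply (is_derive_plus (ps n)); [apply (sp_ps S) | apply (is_derive_scal z); auto]. }
    specialize (B' Hz2); cbv beta in B'.
    rewrite Hy0, Hz0, (sp_ph0 S), (sp_ps0 S), ip_scal_l, (ip_sym T y), ip_scal_l in B' by c0.
    pose proof (Rle_0_sqr (ps n t + -1 * z t)) as Sq; unfold Rsqr in Sq.
    eapply Rle_trans; [|eapply Rle_trans; [exact B'|]]; [lra|].
    apply Req_le; ring. }
  (* Small enough for [10 * K * e^2 < 1]: both [e] and [K * e] are at most 1/4. *)
  pose (e := / (4 * (1 + K))).
  assert (He : 0 < e) by (apply Rinv_0_lt_compat; lra).
  assert (He4 : e * (4 * (1 + K)) = 1) by (unfold e; field; lra).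
  assert (Hn1 : exists n, ls - e < lam n).
  { apply NNPP; intros Hno; assert (ls <= ls - e); [|lra].
    apply L2; intros x [n ->]; destruct (Rle_lt_dec (lam n) (ls - e)); auto; exfalso; eauto. }
  destruct Hn1 as [n Hn1].
  pose (m := Datatypes.S n).
  assert (Hn2 : lam n < lam m) by (apply (sp_incr S); unfold m; lia).
  assert (Hls1 : lam n <= ls) by (apply L1; exists n; auto).
  assert (Hls2 : lam m <= ls) by (apply L1; exists m; auto).
  set (a := ip T y y) in *.
  assert (Hth : forall k, lam n <= lam k <= ls ->
    K * ((ls - lam k) * (ls - lam k)) * a <= K * (e * e) * a).
  { intros k Hk; apply Rmult_le_compat_r; [lra|]; apply Rmult_le_compat_l; [lra|].
    apply Rmult_le_compat; lra. }
  assert (Dn := Rle_trans _ _ _ (Hd n) (Hth n ltac:(lra))).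
  assert (Dm := Rle_trans _ _ _ (Hd m) (Hth m ltac:(lra))).
  destruct (sp_C0 n S) as [Cn _]; destruct (sp_C0 m S) as [Cm _].
  rewrite ip_bilinear in Dn, Dm by c0.
  assert (P1 := ip_ge0 T (fun t => (ph n t + 1 * ph m t) + -2 * y t) ltac:(lra) ltac:(c0)).
  assert (P2 := ip_ge0 T (fun t => y t + -2 * ph n t) ltac:(lra) ltac:(c0)).
  rewrite ip_bilinear, ip_bilinear, (ip_sym T y (fun t => ph n t + 1 * ph m t)),
    ip_plus_l, ip_scal_l in P1 by c0.
  rewrite ip_bilinear in P2 by c0.
  rewrite (sp_orth n m S), (sp_orth m n S) in P1 by (unfold m; lia).
  rewrite (ip_sym T y (ph n)) in *; rewrite (ip_sym T y (ph m)) in *.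
  fold a in Dn, Dm, P1, P2.
  assert (Hq := ip_ge0 T (ph m) ltac:(lra) Cm).
  (* Put [delta = K * e^2 * a]. By [Dn], [Dm], [P1] and orthogonality, the squared norms of [ph n]
     and [ph m] add up to at most [4 delta]; by [Dn] and [P2], [a] is at most [2 delta] plus twice
     the squared norm of [ph n], hence at most [10 delta]. *)
  assert (Ha : a <= 10 * (K * (e * e) * a)) by lra.
  assert (Hs : 10 * (K * (e * e)) < 1).
  { assert (e <= 1 / 4) by nra.
    assert (K * e <= 1 / 4) by nra.
    assert (K * e * e <= 1 / 4 * (1 / 4)) by (apply Rmult_le_compat; nra).
    lra. }
  nra.
Qed.

(** * Eigenfunction expansions *)

Fixpoint psum (u : nat -> R) (N : nat) : R :=
  match N with O => 0 | S n => psum u n + u n end.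

Fixpoint comb (c : nat -> R) (e : nat -> R -> R) (N : nat) (t : R) : R :=
  match N with O => 0 | S n => comb c e n t + c n * e n t end.

Lemma psum_ext u v N : (forall n, (n < N)%nat -> u n = v n) -> psum u N = psum v N.
Proof.
  induction N as [|N IH]; simpl; intros Huv; auto.
  rewrite IH, Huv; auto.
Qed.

Lemma psum_0 N : psum (fun _ => 0) N = 0.
Proof. induction N as [|N IH]; simpl; [auto | rewrite IH; ring]. Qed.

Lemma C0_comb c e N : (forall n, C0 (e n)) -> C0 (comb c e N).
Proof.
  intros He; induction N as [|N IH]; simpl; [apply C0_const|].
  apply C0_plus; auto; apply C0_mult; auto; apply C0_const.
Qed.

Lemma is_derive_comb c e e1 N : (forall n t, is_derive (e n) t (e1 n t)) ->
  forall t : R, is_derive (comb c e N) t (comb c e1 N t).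
Proof.
  intros He t; induction N as [|N IH]; simpl.
  - apply (is_derive_const 0).
  - apply (is_derive_plus (comb c e N)); auto; apply (is_derive_scal (e N)); auto.
Qed.

Lemma ip_comb T c e N g : (forall n, C0 (e n)) -> C0 g ->
  ip T (comb c e N) g = psum (fun n => c n * ip T (e n) g) N.
Proof.
  intros He Hg; induction N as [|N IH]; simpl.
  - transitivity (RInt (fun _ => 0) 0 T); [apply RInt_eq; intros; ring | apply RInt_0].
  - rewrite <- IH, <- ip_scal_l, <- ip_plus_l; auto.
    + apply C0_comb; auto.
    + apply C0_mult; auto; apply C0_const.
Qed.

Lemma comb_dom T Q h H lam ph ps c N : spectral T Q h H lam ph ps ->
  dom h H T (comb c ph N) (comb c ps N) (comb c (fun n t => (Q t - lam n) * ph n t) N).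
Proof.
  intros S; induction N as [|N IH].
  - simpl; refine (conj _ (conj _ (conj _ (conj _ _)))); try (intros; apply (is_derive_const 0)).
    + apply C0_const.
    + ring.
    + ring.
  - exact (dom_lin _ _ _ _ _ _ _ _ _ (c N) IH (sp_dom N S)).
Qed.

Lemma ip_comb_ph T Q h H lam ph ps c N k : spectral T Q h H lam ph ps ->
  ip T (comb c ph N) (ph k) = if (k <? N)%nat then c k * ip T (ph k) (ph k) else 0.
Proof.
  intros S; rewrite ip_comb by (intros; apply (sp_C0 _ S)).
  induction N as [|N IH]; simpl; auto.
  rewrite IH; destruct (Nat.eq_dec k N) as [->|Hk].
  - replace (N <? N)%nat with false by (symmetry; apply Nat.ltb_ge; lia).
    replace (N <? Datatypes.S N)%nat with true by (symmetry; apply Nat.ltb_lt; lia); ring.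
  - rewrite (sp_orth N k S) by auto.
    destruct (Nat.ltb_spec k N), (Nat.ltb_spec k (Datatypes.S N)); try lia; ring.
Qed.

Lemma ip_comb_comb T Q h H lam ph ps c N : spectral T Q h H lam ph ps ->
  ip T (comb c ph N) (comb c ph N) = psum (fun n => c n * c n * ip T (ph n) (ph n)) N.
Proof.
  intros S; rewrite ip_comb by (try apply C0_comb; intros; apply (sp_C0 _ S)).
  apply psum_ext; intros n Hn.
  rewrite ip_sym, (ip_comb_ph T Q h H lam ph ps c N n S).
  replace (n <? N)%nat with true by (symmetry; apply Nat.ltb_lt; auto); ring.
Qed.

Definition coef (T : R) (ph : nat -> R -> R) (f : R -> R) (n : nat) : R :=
  ip T f (ph n) / ip T (ph n) (ph n).

Definition proj (T : R) (ph : nat -> R -> R) (f : R -> R) (N : nat) : R -> R :=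
  comb (coef T ph f) ph N.

Lemma proj_orth T Q h H lam ph ps f N n : spectral T Q h H lam ph ps -> C0 f -> (n < N)%nat ->
  ip T (fun t => f t - proj T ph f N t) (ph n) = 0.
Proof.
  intros S Hf Hn.
  assert (Cp : C0 (proj T ph f N)) by (apply C0_comb; intros; apply (sp_C0 _ S)).
  rewrite ip_minus_l by (auto; apply (sp_C0 _ S)); unfold proj.
  rewrite (ip_comb_ph T Q h H lam ph ps _ N n S).
  replace (n <? N)%nat with true by (symmetry; apply Nat.ltb_lt; auto).
  unfold coef; field; pose proof (sp_norm_pos n S); lra.
Qed.

Lemma bessel T Q h H lam ph ps f N : spectral T Q h H lam ph ps -> C0 f ->
  psum (fun n => coef T ph f n * coef T ph f n * ip T (ph n) (ph n)) N <= ip T f f.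
Proof.
  intros S Hf; assert (HT := sp_T S).
  assert (Cp : C0 (proj T ph f N)) by (apply C0_comb; intros; apply (sp_C0 _ S)).
  rewrite <- (ip_comb_comb T Q h H lam ph ps _ N S).
  change (ip T (proj T ph f N) (proj T ph f N) <= ip T f f).
  assert (Eo : ip T (fun t => f t - proj T ph f N t) (proj T ph f N) = 0).
  { rewrite ip_sym; unfold proj at 1; rewrite ip_comb by (c0; intros; apply (sp_C0 _ S)).
    rewrite (psum_ext _ (fun _ => 0)); [apply psum_0|].
    intros n Hn; rewrite ip_sym, (proj_orth T Q h H lam ph ps f N n S Hf Hn); ring. }
  rewrite ip_minus_l in Eo by auto.
  assert (Hp := ip_ge0 T (fun t => f t + -1 * proj T ph f N t) ltac:(lra) ltac:(c0)).
  rewrite ip_bilinear, (ip_sym T (proj T ph f N) f) in Hp by auto; lra.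
Qed.

(** The remainder [e] is orthogonal to the span, so its shifted form value [A] equals the pairing of
    [e] with the fixed function [g]. Then [A^2 <= M * X] by Cauchy-Schwarz, while [rayleigh] gives
    [L * X <= A] with [L = lam N + c]. Together [A <= M / L], which tends to 0, and [A] controls the
    energy seminorm by coercivity. *)
Lemma proj_converges T Q h H lam ph ps f f1 f2 eps : spectral T Q h H lam ph ps ->
  dom h H T f f1 f2 -> 0 < eps ->
  exists N0, forall N, (N0 <= N)%nat ->
    let e := fun t => f t - proj T ph f N t in
    let e1 := fun t => f1 t - comb (coef T ph f) ps N t in
    ip T e e <= eps /\
    ip T (fun t => e1 t - rob h H T t * e t) (fun t => e1 t - rob h H T t * e t) <= eps.
Proof.
  intros S Df Heps.
  assert (HT := sp_T S); assert (HQ := sp_Q S).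
  destruct (dom_C0 Df) as (Cf & Cf1 & Cf2).
  destruct (sp_bd S) as (CQ & HCQ & HQb).
  destruct (coercive Q h H T CQ HT HQ HQb) as (c & Hc & Hco).
  set (g := fun t => sl_op Q f f2 t + c * f t).
  assert (Cg : C0 g) by (unfold g; apply C0_plus; [apply C0_sl_op; auto | c0]).
  set (M := ip T g g).
  assert (HM : 0 <= M) by (apply ip_ge0; auto; lra).
  (* The threshold serves two purposes: [L >= 1] yields [X <= A], and [L >= M / eps] yields
     [A <= eps]. *)
  destruct (lam_unbounded T Q h H lam ph ps (1 + M / eps) S) as [N0 HN0].
  exists N0; intros N HN e e1.
  set (w := proj T ph f N) in *.
  set (w1 := comb (coef T ph f) ps N) in *.
  set (w2 := comb (coef T ph f) (fun n t => (Q t - lam n) * ph n t) N).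
  assert (Dw : dom h H T w w1 w2) by apply (comb_dom T Q h H lam ph ps _ N S).
  destruct (dom_C0 Dw) as (Cw & Cw1 & Cw2).
  set (e2 := fun t => f2 t - w2 t).
  assert (De : dom h H T e e1 e2).
  { destruct Df as (A1 & A2 & A3 & A4 & A5), Dw as (B1 & B2 & B3 & B4 & B5).
    refine (conj _ (conj _ (conj _ (conj _ _)))); unfold e, e1, e2.
    - intros t; apply (is_derive_minus f w); auto.
    - intros t; apply (is_derive_minus f1 w1); auto.
    - c0.
    - rewrite A4, B4; ring.
    - rewrite A5, B5; ring. }
  destruct (dom_C0 De) as (Ce & Ce1 & Ce2).
  assert (He : forall n, (n < N)%nat -> ip T e (ph n) = 0)
    by (intros n Hn; apply (proj_orth T Q h H lam ph ps f N n S Cf Hn)).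
  assert (CLw := C0_sl_op Q w w2 HQ Cw Cw2).
  assert (CLe := C0_sl_op Q e e2 HQ Ce Ce2).
  assert (CLf := C0_sl_op Q f f2 HQ Cf Cf2).
  assert (Ewe : ip T w e = 0).
  { unfold w, proj; rewrite ip_comb by (auto; intros; apply (sp_C0 _ S)).
    rewrite (psum_ext _ (fun _ => 0)); [apply psum_0|].
    intros n Hn; rewrite ip_sym, He by auto; ring. }
  assert (ELwe : ip T (sl_op Q w w2) e = 0).
  { rewrite (sl_op_sym Q h H T w w1 w2 e e1 e2 HQ Dw De), ip_sym.
    unfold w, proj; rewrite ip_comb by (auto; intros; apply (sp_C0 _ S)).
    rewrite (psum_ext _ (fun _ => 0)); [apply psum_0|].
    intros n Hn; rewrite ip_sym, (sp_weak n S De), He by auto; ring. }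
  set (X := ip T e e) in *.
  set (A := ip T (sl_op Q e e2) e + c * X).
  assert (EA : A = ip T g e).
  { unfold A, X, g; rewrite ip_plus_l, ip_scal_l by c0.
    rewrite (ip_ext T (sl_op Q e e2) e (fun t => sl_op Q f f2 t - sl_op Q w w2 t) e)
      by (intros; unfold sl_op, e, e2; ring).
    rewrite ip_minus_l, ELwe by auto.
    rewrite (ip_ext T e e (fun t => f t - w t) e) by auto.
    rewrite ip_minus_l, Ewe by auto; ring. }
  assert (HX : 0 <= X) by (apply ip_ge0; auto; lra).
  assert (HR := rayleigh T Q h H lam ph ps N e e1 e2 S De He); fold X in HR.
  assert (CS := ip_cauchy_schwarz T g e ltac:(lra) Cg Ce); rewrite <- EA in CS.
  fold M X in CS.
  specialize (HN0 N HN).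
  specialize (Hco e e1 e2 De); fold X A in Hco.
  set (L := lam N + c).
  assert (HL : 1 + M / eps <= L) by (unfold L; lra).
  assert (HLX : L * X <= A) by (unfold L, A; lra).
  assert (HMe : 0 <= M / eps) by (apply Rdiv_le_0_compat; auto).
  assert (HMeps : M <= eps * L).
  { replace M with (eps * (M / eps)) by (field; lra); apply Rmult_le_compat_l; lra. }
  assert (HXA : X <= A) by nra.
  assert (HAe : A <= eps).
  { destruct (Rle_lt_dec A eps) as [|Hlt]; auto; exfalso.
    assert (M * X <= eps * L * X) by (apply Rmult_le_compat_r; auto).
    assert (eps * (L * X) <= eps * A) by (apply Rmult_le_compat_l; lra).
    nra. }
  split; lra.
Qed.

(** * Finite propagation speed *)

Definition C02 (F : R -> R -> R) : Prop := forall t s, continuity_2d_pt F t s.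

Lemma C02_fst f : C0 f -> C02 (fun t _ => f t).
Proof.
  intros Hf t s; apply (continuity_1d_2d_pt_comp f (fun t _ => t)).
  - apply continuity_pt_filterlim, Hf.
  - apply continuity_2d_pt_id1.
Qed.

Lemma C02_snd f : C0 f -> C02 (fun _ s => f s).
Proof.
  intros Hf t s; apply (continuity_1d_2d_pt_comp f (fun _ s => s)).
  - apply continuity_pt_filterlim, Hf.
  - apply continuity_2d_pt_id2.
Qed.

Lemma C02_plus F G : C02 F -> C02 G -> C02 (fun t s => F t s + G t s).
Proof. intros HF HG t s; apply continuity_2d_pt_plus; auto. Qed.

Lemma C02_mult F G : C02 F -> C02 G -> C02 (fun t s => F t s * G t s).
Proof. intros HF HG t s; apply continuity_2d_pt_mult; auto. Qed.

Lemma C02_minus F G : C02 F -> C02 G -> C02 (fun t s => F t s - G t s).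
Proof. intros HF HG t s; apply continuity_2d_pt_minus; auto. Qed.

Lemma C02_const c : C02 (fun _ _ => c).
Proof. intros t s; apply continuity_2d_pt_const. Qed.

Lemma C02_section F t : C02 F -> C0 (F t).
Proof.
  intros HF s P [eps HP].
  destruct (HF t s eps) as [d Hd].
  exists d; intros y Hy; apply HP, Hd.
  - rewrite Rminus_diag, Rabs_R0; apply cond_pos.
  - exact Hy.
Qed.

Lemma leibniz_moving_endpoint (F Ft : R -> R -> R) b t :
  (forall t s, is_derive (fun t => F t s) t (Ft t s)) -> (forall t, C0 (F t)) -> C02 Ft ->
  is_derive (fun t => RInt (F t) 0 (b - t)) t (RInt (Ft t) 0 (b - t) - F t (b - t)).
Proof.
  intros HF HC HFt.
  assert (HD : forall t s, Derive (fun z => F z s) t = Ft t s)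
    by (intros; apply is_derive_unique, HF).
  assert (HC2 : forall t s, continuity_2d_pt (fun u v => Derive (fun z => F z v) u) t s).
  { intros x s; apply (continuity_2d_pt_ext Ft); [intros; symmetry; apply HD | apply HFt]. }
  evar_last.
  - apply (is_derive_RInt_param_bound_comp_aux3 F 0 (fun t => b - t) t (-1)).
    + apply filter_forall; intros y; apply ex_RInt_C0, HC.
    + exists (mkposreal 1 Rlt_0_1); apply filter_forall; intros y; apply ex_RInt_C0, HC.
    + auto_derive; auto; ring.
    + exists (mkposreal 1 Rlt_0_1); apply filter_forall; intros y s _; exists (Ft y s); apply HF.
    + intros s _; apply HC2.
    + exists (mkposreal 1 Rlt_0_1); intros; apply HC2.
    + apply continuity_pt_filterlim, HC.
  - rewrite (RInt_eq _ (Ft t)) by (intros; apply HD); ring.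
Qed.

(** The energy over the section at time [t] of the characteristic triangle [s <= b - t]. Replacing
    [ws] by [ws - p w] makes this factor vanish at [s = 0] under the Robin condition, so no flux
    passes there; the term [w^2] lets the energy control [w] itself. *)
Definition energy (p : R -> R) (w wt ws : R -> R -> R) (b t : R) : R :=
  RInt (fun s => wt t s * wt t s + (ws t s - p s * w t s) * (ws t s - p s * w t s)
                 + w t s * w t s) 0 (b - t).

(** Apart from the loss [F t (b - t)] at the moving end, the derivative of the energy is the
    integral of [2 J + kap * (2 w wt)], where [J] is the [s]-derivative of [wt * v] and
    [v = ws - p w]. The flux [2 wt v] at [s = b - t] is at most that loss because characteristics
    have slope 1; at [s = 0] it vanishes with [v]. The remaining term is at most [C] times the
    energy. *)
Lemma energy_estimate (Q Qt p : R -> R) dp T b C (w wt wtt ws wss wts : R -> R -> R) t :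
  0 <= t <= b -> b <= T -> 0 <= C ->
  (forall s, is_derive p s dp) -> C0 Q -> C0 Qt ->
  (forall t s, 0 <= s <= T -> Rabs (Qt t - Q s + p s * p s + dp + 1) <= C) ->
  C02 w -> C02 wt -> C02 wtt -> C02 ws -> C02 wss -> C02 wts ->
  (forall t s, is_derive (fun t => w t s) t (wt t s)) ->
  (forall t s, is_derive (fun t => wt t s) t (wtt t s)) ->
  (forall t s, is_derive (fun t => ws t s) t (wts t s)) ->
  (forall t s, is_derive (w t) s (ws t s)) ->
  (forall t s, is_derive (ws t) s (wss t s)) ->
  (forall t s, is_derive (wt t) s (wts t s)) ->
  (forall t s, wtt t s = wss t s + (Qt t - Q s) * w t s) ->
  (forall t, ws t 0 = p 0 * w t 0) ->
  energy p w wt ws b t <= exp (C * t) * energy p w wt ws b 0.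
Proof.
  intros Ht HbT HC Hp HQ HQt Hk Cw Cwt Cwtt Cws Cwss Cwts D1 D2 D3 D4 D5 D6 Heq H0.
  assert (Cp := C0_derive p (fun _ => dp) Hp).
  pose (v := fun t s => ws t s - p s * w t s).
  assert (Cp2 := C02_snd p Cp).
  assert (Cv : C02 v) by (unfold v; apply C02_minus; auto; apply (C02_mult (fun _ s => p s)); auto).
  pose (F := fun t s => wt t s * wt t s + v t s * v t s + w t s * w t s).
  pose (Ft := fun t s => 2 * (wt t s * wtt t s + v t s * (wts t s - p s * wt t s) + w t s * wt t s)).
  assert (CF : C02 F) by (unfold F; repeat apply C02_plus; apply C02_mult; auto).
  assert (CFt : C02 Ft).
  { unfold Ft; apply C02_mult; [apply C02_const|].
    repeat apply C02_plus; apply C02_mult; auto.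
    apply C02_minus; auto; apply (C02_mult (fun _ s => p s)); auto. }
  assert (Dv : forall t s, is_derive (fun t => v t s) t (wts t s - p s * wt t s)).
  { intros x s; unfold v; apply (is_derive_minus (fun t => ws t s)); auto.
    apply (is_derive_scal (fun t => w t s)); auto. }
  assert (DF : forall t s, is_derive (fun t => F t s) t (Ft t s)).
  { intros x s; unfold F, Ft; evar_last.
    - apply (is_derive_plus (fun t => wt t s * wt t s + v t s * v t s) (fun t => w t s * w t s)).
      + apply (is_derive_plus (fun t => wt t s * wt t s) (fun t => v t s * v t s)).
        * apply (is_derive_mult (fun t => wt t s) (fun t => wt t s));
            [apply D2 | apply D2 | intros; apply Rmult_comm].
        * apply (is_derive_mult (fun t => v t s) (fun t => v t s));
            [apply Dv | apply Dv | intros; apply Rmult_comm].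
      + apply (is_derive_mult (fun t => w t s) (fun t => w t s));
          [apply D1 | apply D1 | intros; apply Rmult_comm].
    - unfold plus, mult; simpl; ring. }
  assert (G := gronwall (energy p w wt ws b)
    (fun t => RInt (Ft t) 0 (b - t) - F t (b - t)) (fun _ => 0) C b t HC Ht
    (C0_const 0) (fun _ => Rle_refl 0)).
  rewrite RInt_0, Rplus_0_r in G; apply G; clear G.
  - intros x Hx; apply (leibniz_moving_endpoint F Ft b x); auto.
    intros; apply C02_section; auto.
  - intros x Hx; rewrite Rplus_0_r.
    assert (Sw := C02_section w x Cw); assert (Swt := C02_section wt x Cwt).
    assert (Sws := C02_section ws x Cws); assert (Swts := C02_section wts x Cwts).
    assert (Swss := C02_section wss x Cwss); assert (Sv := C02_section v x Cv).
    pose (kap := fun s => Qt x - Q s + p s * p s + dp + 1).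
    assert (Ck : C0 kap) by (unfold kap; c0).
    pose (J := fun s => wts x s * v x s + wt x s * (wss x s - (dp * w x s + p s * ws x s))).
    assert (CJ : C0 J) by (unfold J; c0).
    assert (EJ : RInt J 0 (b - x) = wt x (b - x) * v x (b - x) - wt x 0 * v x 0 :> R).
    { apply (RInt_derive (fun s => wt x s * v x s)); auto.
      intros s; unfold J.
      apply (is_derive_mult (wt x) (v x)); [apply D6 | | intros; apply Rmult_comm].
      unfold v; apply (is_derive_minus (ws x)); auto.
      evar_last.
      - apply (is_derive_mult p (w x)); [apply Hp | apply D4 | intros; apply Rmult_comm].
      - unfold plus, mult; simpl; ring. }
    rewrite (RInt_eq (Ft x) (fun s => 2 * J s + kap s * (2 * (w x s * wt x s)))).
    2: { intros s; unfold Ft, J, kap; rewrite Heq; unfold v; ring. }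
    rewrite RInt_add, RInt_mulc, EJ by c0.
    assert (RInt (fun s => kap s * (2 * (w x s * wt x s))) 0 (b - x)
            <= C * energy p w wt ws b x).
    { unfold energy; rewrite <- RInt_mulc by (apply (C02_section F x CF)).
      apply RInt_le_C0; [lra | c0 | |].
      - apply C0_mult; [apply C0_const | apply (C02_section F x CF)].
      - intros s Hs; specialize (Hk x s ltac:(lra)); fold (kap s) in Hk; fold (v x s).
        eapply Rle_trans; [apply Rle_abs|]; rewrite Rabs_mult.
        apply Rmult_le_compat; auto using Rabs_pos.
        eapply Rle_trans; [apply Rabs_double_mult_le|].
        pose proof (Rle_0_sqr (v x s)); unfold Rsqr in *; lra. }
    assert (v x 0 = 0) by (unfold v; rewrite H0; ring).
    assert (2 * (wt x (b - x) * v x (b - x)) <= F x (b - x)).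
    { unfold F; pose proof (Rle_0_sqr (wt x (b - x) - v x (b - x)));
      pose proof (Rle_0_sqr (w x (b - x))); unfold Rsqr in *; lra. }
    rewrite H1; lra.
Qed.

(** Integrate the derivative of [(1 - s / d) * u^2], which is [u^2] at 0 and vanishes at [d]. The
    slope of the weight gives [/ d], and writing [u1 = (u1 - p u) + p u] in [2 u u1] gives
    [1 + 2 * P]. *)
Lemma trace_bound (p u u1 : R -> R) P d : 0 < d -> C0 p ->
  (forall s, 0 <= s <= d -> Rabs (p s) <= P) ->
  (forall s, is_derive u s (u1 s)) -> C0 u1 ->
  u 0 * u 0 <= (/ d + 1 + 2 * P) *
    RInt (fun s => (u1 s - p s * u s) * (u1 s - p s * u s) + u s * u s) 0 d.
Proof.
  intros Hd Cp HP Hu Cu1; assert (Cu := C0_derive _ _ Hu).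
  assert (E : RInt (fun s => - (/ d * (u s * u s)) + (1 - s / d) * (2 * (u s * u1 s))) 0 d
    = (1 - d / d) * (u d * u d) - (1 - 0 / d) * (u 0 * u 0) :> R).
  { apply (RInt_derive (fun s => (1 - s / d) * (u s * u s))); [|c0].
    intros s; evar_last.
    - apply (is_derive_mult (fun s => 1 - s / d) (fun s => u s * u s));
        [ | | intros; apply Rmult_comm].
      + auto_derive; auto.
      + apply (is_derive_mult u u); [apply Hu | apply Hu | intros; apply Rmult_comm].
    - unfold plus, mult; simpl; field; lra. }
  replace (1 - d / d) with 0 in E by (field; lra).
  replace (1 - 0 / d) with 1 in E by (field; lra).
  assert (E2 : u 0 * u 0 =
    RInt (fun s => -1 * (- (/ d * (u s * u s)) + (1 - s / d) * (2 * (u s * u1 s)))) 0 d :> R)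
    by (rewrite RInt_mulc, E by c0; ring).
  rewrite E2, <- RInt_mulc by c0.
  apply RInt_le_C0; [lra | c0 | c0 |].
  intros s Hs.
  specialize (HP s ltac:(lra)).
  assert (HP0 : 0 <= P) by (pose proof (Rabs_pos (p s)); lra).
  assert (Hd' : 0 < / d) by (apply Rinv_0_lt_compat; auto).
  assert (Hth : 0 <= 1 - s / d <= 1).
  { assert (0 <= s / d) by (apply Rdiv_le_0_compat; lra).
    assert (s / d <= 1); [|lra].
    apply Rmult_le_reg_r with d; auto; replace (s / d * d) with s by (field; lra); lra. }
  set (th := 1 - s / d) in *; set (v := u1 s - p s * u s).
  replace (u1 s) with (v + p s * u s) by (unfold v; ring).
  assert (B : Rabs (th * (2 * (u s * (v + p s * u s)))) <= u s * u s + v * v + 2 * P * (u s * u s)).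
  { rewrite Rabs_mult, (Rabs_pos_eq th) by lra.
    apply Rle_trans with (1 * (u s * u s + v * v + 2 * P * (u s * u s))); [|lra].
    apply Rmult_le_compat; [lra | apply Rabs_pos | lra |].
    replace (2 * (u s * (v + p s * u s))) with (2 * (u s * v) + 2 * (p s * (u s * u s))) by ring.
    eapply Rle_trans; [apply Rabs_triang|].
    apply Rplus_le_compat; [apply Rabs_double_mult_le|].
    rewrite !Rabs_mult, (Rabs_pos_eq 2) by lra.
    pose proof (Rabs_pos (u s)).
    replace (u s * u s) with (Rabs (u s) * Rabs (u s))
      by (rewrite <- Rabs_mult; apply Rabs_pos_eq; nra).
    nra. }
  apply Rabs_le_between in B.
  assert (0 <= / d * (v * v)) by (apply Rmult_le_pos; nra).
  assert (0 <= P * (v * v)) by (apply Rmult_le_pos; nra).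
  lra.
Qed.

(** Partial sum of the double expansion, as a combination in [s] with coefficients depending on [t].
    Derivatives in [s] come directly from [comb], those in [t] from the symmetry [comb2_sym]. *)
Definition comb2 (c : nat -> R) (a e : nat -> R -> R) (N : nat) (t s : R) : R :=
  comb (fun n => c n * a n t) e N s.

Lemma comb2_sym c a e N t s : comb2 c a e N t s = comb2 c e a N s t.
Proof.
  unfold comb2; induction N as [|N IH]; simpl; auto; rewrite IH; ring.
Qed.

Lemma C02_comb2 c a e N : (forall n, C0 (a n)) -> (forall n, C0 (e n)) -> C02 (comb2 c a e N).
Proof.
  intros Ha He; unfold comb2; induction N as [|N IH]; simpl.
  - apply C02_const.
  - apply C02_plus; auto.
    apply (C02_mult (fun t s => c N * a N t) (fun t s => e N s)).
    + apply (C02_fst (fun t => c N * a N t)); c0; auto.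
    + apply C02_snd; auto.
Qed.

Lemma is_derive_comb2_snd c a e e1 N : (forall n t, is_derive (e n) t (e1 n t)) ->
  forall t s, is_derive (comb2 c a e N t) s (comb2 c a e1 N t s).
Proof. intros He t s; apply is_derive_comb, He. Qed.

Lemma is_derive_comb2_fst c a a1 e N : (forall n t, is_derive (a n) t (a1 n t)) ->
  forall t s, is_derive (fun t => comb2 c a e N t s) t (comb2 c a1 e N t s).
Proof.
  intros Ha t s; rewrite comb2_sym.
  apply (is_derive_ext (fun t => comb2 c e a N s t)); [intros; apply comb2_sym|].
  apply is_derive_comb2_snd, Ha.
Qed.

Lemma comb2_fst1 c a e N t s : (forall n, a n t = 1) -> comb2 c a e N t s = comb c e N s.
Proof.
  intros Ha; unfold comb2; induction N as [|N IH]; simpl; auto; rewrite IH, Ha; ring.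
Qed.

Lemma comb2_fst_cst c a e N t s k : (forall n, a n t = k) -> comb2 c a e N t s = k * comb c e N s.
Proof.
  intros Ha; unfold comb2; induction N as [|N IH]; simpl; [ring|]; rewrite IH, Ha; ring.
Qed.

(** At [t = 0] the double sum is the partial sum of [f], its [t]-derivative is [ht] times that, and
    its [s]-derivative is the partial sum for [f1]; on [[0, b]], where [f] and [f1] vanish, these
    are minus the errors [e] and [e1]. The energy estimate carries their smallness to time [t], and
    the trace at [s = 0] is the claimed combination. The margin [d] keeps the section [[0, b - t]]
    long enough for the trace inequality. *)
Lemma propagation T Q h H lam ph ps Qt ht Ht pht pst f f1 f2 b d eps :
  spectral T Q h H lam ph ps -> spectral T Qt ht Ht lam pht pst ->
  dom h H T f f1 f2 -> (forall t, 0 <= t <= b -> f t = 0 /\ f1 t = 0) ->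
  b <= T -> 0 < d -> 0 < eps ->
  exists N0, forall N t, (N0 <= N)%nat -> 0 <= t <= b - d ->
    comb (coef T ph f) pht N t * comb (coef T ph f) pht N t <= eps.
Proof.
  intros S St Df Hf0 HbT Hd Heps.
  assert (HT := sp_T S); assert (HQ := sp_Q S); assert (HQt := sp_Q St).
  destruct (dom_C0 Df) as (Cf & Cf1 & Cf2).
  destruct (sp_bd S) as (B & HB & HQb); destruct (sp_bd St) as (Bt & HBt & HQtb).
  set (p := rob h H T).
  set (P := Rabs h + Rabs (h + H)).
  set (dp := - ((h + H) / T)).
  assert (Hp : forall s, is_derive p s dp).
  { intros s; unfold p, rob, dp; auto_derive; auto; ring. }
  assert (HP : 0 <= P) by (unfold P; pose proof (Rabs_pos h); pose proof (Rabs_pos (h + H)); lra).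
  assert (Hpb : forall s, 0 <= s <= T -> Rabs (p s) <= P) by (intros; apply rob_bound; auto).
  assert (Cp := C0_derive p (fun _ => dp) Hp).
  set (C := Bt + B + P * P + Rabs dp + 1).
  assert (HC : 0 <= C) by (unfold C; pose proof (Rabs_pos dp); nra).
  assert (Hk : forall t s, 0 <= s <= T -> Rabs (Qt t - Q s + p s * p s + dp + 1) <= C).
  { intros t s Hs; unfold C.
    specialize (HQb s); specialize (HQtb t); specialize (Hpb s Hs).
    eapply Rle_trans; [apply Rabs_triang|]; rewrite Rabs_R1; apply Rplus_le_compat_r.
    eapply Rle_trans; [apply Rabs_triang|]; apply Rplus_le_compat_r.
    eapply Rle_trans; [apply Rabs_triang|]; apply Rplus_le_compat.
    - eapply Rle_trans; [apply Rabs_triang|]; rewrite Rabs_Ropp; lra.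
    - rewrite Rabs_mult; apply Rmult_le_compat; auto using Rabs_pos. }
  (* Product of the trace constant, the Gronwall factor and the initial energy: the weight
     [ht^2 + 1] falls on the squared error of [f], the weight 1 on that of the tilted derivative. *)
  set (K := (/ d + 1 + 2 * P) * (exp (C * T) * (ht * ht + 2))).
  assert (Hdi : 0 < / d) by (apply Rinv_0_lt_compat; auto).
  assert (HK : 0 < K).
  { unfold K; apply Rmult_lt_0_compat; [lra|]; apply Rmult_lt_0_compat; [apply exp_pos | nra]. }
  assert (Heps' : 0 < eps / K) by (apply Rdiv_lt_0_compat; auto).
  destruct (proj_converges T Q h H lam ph ps f f1 f2 (eps / K) S Df Heps') as [N0 HN0].
  exists N0; intros N t HN Htb.
  specialize (HN0 N HN); cbv zeta in HN0; destruct HN0 as [He1 He2].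
  set (c := coef T ph f) in *.
  set (Qph := fun n t => (Q t - lam n) * ph n t).
  set (Qpht := fun n t => (Qt t - lam n) * pht n t).
  assert (C1 : forall n, C0 (ph n)) by (intros; apply (sp_C0 _ S)).
  assert (C2 : forall n, C0 (ps n)) by (intros; apply (sp_C0 _ S)).
  assert (C3 : forall n, C0 (pht n)) by (intros; apply (sp_C0 _ St)).
  assert (C4 : forall n, C0 (pst n)) by (intros; apply (sp_C0 _ St)).
  assert (C5 : forall n, C0 (Qph n)) by (intros; unfold Qph; c0; auto).
  assert (C6 : forall n, C0 (Qpht n)) by (intros; unfold Qpht; c0; auto).
  assert (En := energy_estimate Q Qt p dp T b C (comb2 c pht ph N) (comb2 c pst ph N)
    (comb2 c Qpht ph N) (comb2 c pht ps N) (comb2 c pht Qph N) (comb2 c pst ps N) t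
    ltac:(lra) HbT HC Hp HQ HQt Hk
    (C02_comb2 c pht ph N C3 C1) (C02_comb2 c pst ph N C4 C1) (C02_comb2 c Qpht ph N C6 C1)
    (C02_comb2 c pht ps N C3 C2) (C02_comb2 c pht Qph N C3 C5) (C02_comb2 c pst ps N C4 C2)
    (is_derive_comb2_fst c pht pst ph N (sp_ph St))
    (is_derive_comb2_fst c pst Qpht ph N (sp_ps St))
    (is_derive_comb2_fst c pht pst ps N (sp_ph St))
    (is_derive_comb2_snd c pht ph ps N (sp_ph S))
    (is_derive_comb2_snd c pht ps Qph N (sp_ps S))
    (is_derive_comb2_snd c pst ph ps N (sp_ph S))).
  assert (Heq : forall t s, comb2 c Qpht ph N t s
    = comb2 c pht Qph N t s + (Qt t - Q s) * comb2 c pht ph N t s).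
  { intros x s; unfold comb2; clear; induction N as [|N IH]; simpl; [ring|].
    rewrite IH; unfold Qpht, Qph; ring. }
  assert (Hbd : forall t, comb2 c pht ps N t 0 = p 0 * comb2 c pht ph N t 0).
  { intros x; rewrite !(comb2_sym c pht).
    rewrite (comb2_fst1 c ph pht N 0 x (sp_ph0 S)), (comb2_fst_cst c ps pht N 0 x h (sp_ps0 S)).
    unfold p, rob; ring. }
  specialize (En Heq Hbd).
  set (e := fun t => f t - proj T ph f N t) in *.
  set (e1 := fun t => f1 t - comb c ps N t) in *.
  assert (Cpr : C0 (proj T ph f N)) by (apply C0_comb; auto).
  assert (Ccs : C0 (comb c ps N)) by (apply C0_comb; auto).
  assert (Ce : C0 e) by (unfold e; c0).
  assert (Ce1 : C0 e1) by (unfold e1; c0).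
  set (v := fun t => e1 t - rob h H T t * e t) in *.
  assert (Cv : C0 v) by (unfold v; c0).
  assert (E0 : energy p (comb2 c pht ph N) (comb2 c pst ph N) (comb2 c pht ps N) b 0
      <= (ht * ht + 2) * (eps / K)).
  { unfold energy; rewrite Rminus_0_r.
    apply Rle_trans with (RInt (fun s => (ht * ht + 1) * (e s * e s) + v s * v s) 0 b).
    - apply Req_le, RInt_ext; intros s; rewrite Rmin_left, Rmax_right by lra; intros Hs.
      rewrite (comb2_fst1 c pht ph N 0 s (sp_ph0 St)), (comb2_fst1 c pht ps N 0 s (sp_ph0 St)),
        (comb2_fst_cst c pst ph N 0 s ht (sp_ps0 St)).
      destruct (Hf0 s ltac:(lra)) as [F0 F1].
      unfold v, e1, e, proj; fold c; rewrite F0, F1; fold p; simpl; ring.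
    - eapply Rle_trans.
      + apply (RInt_subinterval _ b T); try lra; [c0|].
        intros x; pose proof (Rle_0_sqr (e x)); pose proof (Rle_0_sqr (v x)); unfold Rsqr in *; nra.
      + rewrite RInt_add, RInt_mulc by c0.
        change (RInt (fun x => e x * e x) 0 T) with (ip T e e).
        change (RInt (fun x => v x * v x) 0 T) with (ip T v v).
        assert ((ht * ht + 1) * ip T e e <= (ht * ht + 1) * (eps / K))
          by (apply Rmult_le_compat_l; nra).
        change (ip T v v <= eps / K) in He2; lra. }
  assert (Tr := trace_bound p (comb2 c pht ph N t) (comb2 c pht ps N t) P (b - t)
    ltac:(lra) Cp ltac:(intros; apply Hpb; lra) (is_derive_comb2_snd c pht ph ps N (sp_ph S) t)
    (C02_section _ t (C02_comb2 c pht ps N C3 C2))).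
  replace (comb2 c pht ph N t 0) with (comb c pht N t) in Tr
    by (rewrite comb2_sym; symmetry; apply comb2_fst1, (sp_ph0 S)).
  eapply Rle_trans; [exact Tr|].
  replace eps with (K * (eps / K)) by (field; lra).
  unfold K at 1; rewrite Rmult_assoc.
  assert (Hen : RInt (fun s => (comb2 c pht ps N t s - p s * comb2 c pht ph N t s) *
      (comb2 c pht ps N t s - p s * comb2 c pht ph N t s)
      + comb2 c pht ph N t s * comb2 c pht ph N t s) 0 (b - t)
    <= energy p (comb2 c pht ph N) (comb2 c pst ph N) (comb2 c pht ps N) b t).
  { assert (X1 := C02_section _ t (C02_comb2 c pht ph N C3 C1)).
    assert (X2 := C02_section _ t (C02_comb2 c pht ps N C3 C2)).
    assert (X3 := C02_section _ t (C02_comb2 c pst ph N C4 C1)).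
    apply RInt_le_C0; [lra | c0 | c0 |].
    intros s _; pose proof (Rle_0_sqr (comb2 c pst ph N t s)); unfold Rsqr in *; lra. }
  assert (Hpos : 0 <= energy p (comb2 c pht ph N) (comb2 c pst ph N) (comb2 c pht ps N) b 0).
  { assert (X1 := C02_section _ 0 (C02_comb2 c pht ph N C3 C1)).
    assert (X2 := C02_section _ 0 (C02_comb2 c pht ps N C3 C2)).
    assert (X3 := C02_section _ 0 (C02_comb2 c pst ph N C4 C1)).
    apply RInt_ge0; [lra | c0 |].
    intros s _; pose proof (Rle_0_sqr (comb2 c pst ph N 0 s));
      pose proof (Rle_0_sqr (comb2 c pht ph N 0 s));
      pose proof (Rle_0_sqr (comb2 c pht ps N 0 s - p s * comb2 c pht ph N 0 s)); unfold Rsqr in *; lra. }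
  assert (Hexp : exp (C * t) <= exp (C * T)).
  { destruct (Req_dec (C * t) (C * T)) as [->|]; [lra|]; left; apply exp_increasing; nra. }
  apply Rmult_le_compat.
  - assert (/ (b - t) > 0) by (apply Rinv_0_lt_compat; lra); lra.
  - assert (X1 := C02_section _ t (C02_comb2 c pht ph N C3 C1)).
    assert (X2 := C02_section _ t (C02_comb2 c pht ps N C3 C2)).
    apply RInt_ge0; [lra | c0 |]; intros s _.
    pose proof (Rle_0_sqr (comb2 c pht ph N t s));
      pose proof (Rle_0_sqr (comb2 c pht ps N t s - p s * comb2 c pht ph N t s)); unfold Rsqr in *; lra.
  - assert (/ (b - t) <= / d) by (apply Rinv_le_contravar; lra); lra.
  - eapply Rle_trans; [exact Hen|]; eapply Rle_trans; [exact En|].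
    rewrite Rmult_assoc; apply Rmult_le_compat; auto; left; apply exp_pos.
Qed.

(** * Cutoffs and the cross form *)

Lemma C0_comp f g : C0 f -> C0 g -> C0 (fun x => g (f x)).
Proof. intros Hf Hg x; apply (continuous_comp f g); auto. Qed.

Lemma is_derive_Rmax_sqr (x : R) : is_derive (fun x => Rmax 0 x ^ 2) x (2 * Rmax 0 x).
Proof.
  apply is_derive_Reals; intros eps Heps; exists (mkposreal eps Heps); intros k Hk Hke.
  simpl in Hke.
  eapply Rle_lt_trans; [|exact Hke].
  (* The second-order remainder of the squared positive part is at most [k^2] in each of the four
     sign cases. *)
  assert (B : Rabs (Rmax 0 (x + k) ^ 2 - Rmax 0 x ^ 2 - 2 * Rmax 0 x * k) <= k * k).
  { unfold Rmax; destruct (Rle_dec 0 (x + k)), (Rle_dec 0 x); apply Rabs_le; nra. }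
  replace ((Rmax 0 (x + k) ^ 2 - Rmax 0 x ^ 2) / k - 2 * Rmax 0 x)
    with ((Rmax 0 (x + k) ^ 2 - Rmax 0 x ^ 2 - 2 * Rmax 0 x * k) / k) by (field; auto).
  unfold Rdiv; rewrite Rabs_mult, Rabs_inv.
  assert (Hp : 0 < Rabs k) by (apply Rabs_pos_lt; auto).
  apply Rmult_le_reg_r with (Rabs k); auto.
  rewrite Rmult_assoc, Rinv_l, Rmult_1_r by lra.
  rewrite <- Rabs_mult, (Rabs_pos_eq (k * k)) by nra; auto.
Qed.

Lemma is_derive_Rmax_cube (x : R) : is_derive (fun x => Rmax 0 x ^ 3) x (3 * Rmax 0 x ^ 2).
Proof.
  apply (is_derive_ext (fun x => x * Rmax 0 x ^ 2)).
  { intros t; unfold Rmax; destruct (Rle_dec 0 t); simpl; ring. }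
  evar_last.
  - apply (is_derive_mult (fun x => x) (fun x => Rmax 0 x ^ 2));
      [apply (is_derive_id x) | apply is_derive_Rmax_sqr | intros; apply Rmult_comm].
  - unfold plus, mult, one; simpl; unfold Rmax; destruct (Rle_dec 0 x); ring.
Qed.

Lemma C0_Rmax : C0 (fun x => Rmax 0 x).
Proof.
  intros x; apply (continuous_ext (fun x => (x + Rabs x) / 2)).
  - intros t; unfold Rmax; destruct (Rle_dec 0 t); [rewrite Rabs_pos_eq | rewrite Rabs_left]; lra.
  - apply (C0_div (fun x => x + Rabs x)), (C0_plus (fun x => x) Rabs); [apply C0_id|].
    intros y; apply continuous_Rabs.
Qed.

(** Third backward difference with unit step. It annihilates quadratics and sends [x^3 / 6] to 1, so
    applied to truncated powers it is constant to the right of 3. *)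
Definition knot3 (g : R -> R) (x : R) : R := g x - 3 * g (x - 1) + 3 * g (x - 2) - g (x - 3).

Lemma is_derive_knot3 (g g1 : R -> R) (x : R) : (forall x, is_derive g x (g1 x)) ->
  is_derive (knot3 g) x (knot3 g1 x).
Proof.
  intros Hg.
  assert (Hs : forall c, is_derive (fun x => g (x - c)) x (g1 (x - c))).
  { intros c; evar_last.
    - apply (is_derive_comp g (fun x => x - c)); [apply Hg | auto_derive; auto].
    - unfold scal; simpl; unfold mult; simpl; ring. }
  unfold knot3.
  apply (is_derive_minus (fun x => g x - 3 * g (x - 1) + 3 * g (x - 2))); [|apply Hs].
  apply (is_derive_plus (fun x => g x - 3 * g (x - 1))); [|apply (is_derive_scal (fun x => g (x - 2))), Hs].
  apply (is_derive_minus g); [apply Hg | apply (is_derive_scal (fun x => g (x - 1))), Hs].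
Qed.

(* Integrated quadratic B-spline: the third difference of [x_+^3 / 6] is a C^2 step
   from 0 to 1 on [0, 3], rescaled here to [l, r]. *)
Lemma smooth_step_exists l r : l < r -> exists s s1 s2 : R -> R,
  (forall x, is_derive s x (s1 x)) /\ (forall x, is_derive s1 x (s2 x)) /\ C0 s2 /\
  (forall x, x <= l -> s x = 0 /\ s1 x = 0) /\ (forall x, r <= x -> s x = 1 /\ s1 x = 0) /\
  (forall x, 0 <= s x <= 1).
Proof.
  intros Hlr.
  set (k := 3 / (r - l)).
  assert (Hk : 0 < k) by (apply Rdiv_lt_0_compat; lra).
  set (g := fun x => Rmax 0 x ^ 3 / 6).
  set (g1 := fun x => Rmax 0 x ^ 2 / 2).
  set (g2 := fun x => Rmax 0 x).
  assert (Hg : forall x, is_derive g x (g1 x)).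
  { intros x; unfold g, g1, Rdiv.
    apply (is_derive_ext (fun x => / 6 * Rmax 0 x ^ 3)); [intros; apply Rmult_comm|].
    replace (Rmax 0 x ^ 2 * / 2) with (/ 6 * (3 * Rmax 0 x ^ 2)) by field.
    apply (is_derive_scal (fun x => Rmax 0 x ^ 3)), is_derive_Rmax_cube. }
  assert (Hg1 : forall x, is_derive g1 x (g2 x)).
  { intros x; unfold g2, g1, Rdiv.
    apply (is_derive_ext (fun x => / 2 * Rmax 0 x ^ 2)); [intros; apply Rmult_comm|].
    replace (Rmax 0 x) with (/ 2 * (2 * Rmax 0 x)) by field.
    apply (is_derive_scal (fun x => Rmax 0 x ^ 2)), is_derive_Rmax_sqr. }
  assert (Hsc : forall (f f1 : R -> R) (x : R), (forall x, is_derive f x (f1 x)) ->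
    is_derive (fun x => f (k * (x - l))) x (k * f1 (k * (x - l)))).
  { intros f f1 x Hf; apply (is_derive_comp f (fun x => k * (x - l))); [apply Hf|].
    auto_derive; auto; ring. }
  assert (Hkl : forall x, x <= l -> k * (x - l) <= 0) by (intros; nra).
  assert (Hkr : forall x, r <= x -> 3 <= k * (x - l)).
  { intros x Hx; replace 3 with (k * (r - l)) by (unfold k; field; lra); nra. }
  assert (Hlow : forall x, x <= 0 -> knot3 g x = 0 /\ knot3 g1 x = 0).
  { intros x Hx; unfold knot3, g, g1; rewrite !Rmax_left by lra; split; field. }
  assert (Hhigh : forall x, 3 <= x -> knot3 g x = 1 /\ knot3 g1 x = 0).
  { intros x Hx; unfold knot3, g, g1; rewrite !Rmax_right by lra; split; field. }
  assert (Hbd : forall x, 0 <= knot3 g x <= 1).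
  { intros x; destruct (Rle_dec x 0) as [H0|H0]; [destruct (Hlow x H0); lra|].
    destruct (Rle_dec 3 x) as [H3|H3]; [destruct (Hhigh x H3); lra|].
    unfold knot3, g.
    rewrite (Rmax_right 0 x), (Rmax_left 0 (x - 3)) by lra.
    destruct (Rle_dec x 1) as [H1|H1].
    - rewrite !Rmax_left by lra.
      assert (0 <= x ^ 3 <= 1 ^ 3) by (split; [apply pow_le; lra | apply pow_incr; lra]).
      lra.
    - rewrite (Rmax_right 0 (x - 1)) by lra.
      destruct (Rle_dec x 2) as [H2|H2].
      + rewrite !Rmax_left by lra.
        assert (0 <= (x - 1) * (2 - x)) by nra.
        split; nra.
      + rewrite Rmax_right by lra.
        (* The symmetry of the step about 3/2 reduces the last piece to the one on [[0, 1]]. *)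
        replace (x ^ 3 / 6 - 3 * ((x - 1) ^ 3 / 6) + 3 * ((x - 2) ^ 3 / 6) - 0 ^ 3 / 6)
          with (1 - (3 - x) ^ 3 / 6) by field.
        assert (0 <= (3 - x) ^ 3 <= 1 ^ 3) by (split; [apply pow_le; lra | apply pow_incr; lra]).
        lra. }
  exists (fun x => knot3 g (k * (x - l))), (fun x => k * knot3 g1 (k * (x - l))),
    (fun x => k * (k * knot3 g2 (k * (x - l)))).
  refine (conj _ (conj _ (conj _ (conj _ (conj _ _))))).
  - intros x; apply (Hsc (knot3 g) (knot3 g1)); intros; apply is_derive_knot3; auto.
  - intros x; apply (is_derive_scal (fun x => knot3 g1 (k * (x - l)))).
    apply (Hsc (knot3 g1) (knot3 g2)); intros; apply is_derive_knot3; auto.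
  - assert (Hg2 : forall c, C0 (fun x => g2 (k * (x - l) - c))).
    { intros c; apply (C0_comp (fun x => k * (x - l) - c) g2); [c0 | apply C0_Rmax]. }
    assert (Hg20 : C0 (fun x => g2 (k * (x - l)))).
    { apply (C0_comp (fun x => k * (x - l)) g2); [c0 | apply C0_Rmax]. }
    unfold knot3; apply C0_mult; [c0|]; apply C0_mult; [c0|].
    apply C0_minus; auto; apply C0_plus; [apply C0_minus; auto|]; (apply C0_mult; [c0|]; auto).
  - intros x Hx; destruct (Hlow _ (Hkl x Hx)) as [-> ->]; split; ring.
  - intros x Hx; destruct (Hhigh _ (Hkr x Hx)) as [-> ->]; split; ring.
  - intros x; apply Hbd.
Qed.

Lemma dom_cutoff h H T u u1 u2 s s1 s2 : dom h H T u u1 u2 ->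
  (forall x, is_derive s x (s1 x)) -> (forall x, is_derive s1 x (s2 x)) -> C0 s2 ->
  s1 0 = 0 -> s1 T = 0 ->
  dom h H T (fun t => u t * s t) (fun t => u1 t * s t + u t * s1 t)
    (fun t => u2 t * s t + 2 * (u1 t * s1 t) + u t * s2 t).
Proof.
  intros Du Hs Hs1 Cs2 E0 ET.
  destruct (dom_C0 Du) as (Cu & Cu1 & Cu2).
  assert (Cs := C0_derive _ _ Hs); assert (Cs1 := C0_derive _ _ Hs1).
  destruct Du as (A1 & A2 & A3 & A4 & A5).
  refine (conj _ (conj _ (conj _ (conj _ _)))).
  - intros t; apply (is_derive_mult u s); [apply A1 | apply Hs | intros; apply Rmult_comm].
  - intros t; evar_last.
    + apply (is_derive_plus (fun t => u1 t * s t) (fun t => u t * s1 t)).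
      * apply (is_derive_mult u1 s); [apply A2 | apply Hs | intros; apply Rmult_comm].
      * apply (is_derive_mult u s1); [apply A1 | apply Hs1 | intros; apply Rmult_comm].
    + unfold plus, mult; simpl; ring.
  - c0.
  - rewrite A4, E0; ring.
  - rewrite A5, ET; ring.
Qed.

Lemma psum_single u N : (forall n, n <> O -> u n = 0) -> psum u (S N) = u O.
Proof.
  intros Hu; induction N as [|N IH]; [simpl; ring|].
  change (psum u (S N) + u (S N) = u O); rewrite IH, (Hu (S N)) by lia; ring.
Qed.

Lemma psum_plus u v N : psum (fun n => u n + v n) N = psum u N + psum v N.
Proof. induction N as [|N IH]; simpl; [ring | rewrite IH; ring]. Qed.

(* [cross f g] is [<U f, g>] for the map [U] sending each [ph n] to [pht n], truncated at [N]. *)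
Definition cross (T : R) (ph pht : nat -> R -> R) (N : nat) (f g : R -> R) : R :=
  psum (fun n => coef T ph f n * ip T (pht n) g) N.

Lemma cross_plus_l T ph pht N f1 f2 g : (forall n, C0 (ph n)) -> C0 f1 -> C0 f2 ->
  cross T ph pht N (fun t => f1 t + f2 t) g = cross T ph pht N f1 g + cross T ph pht N f2 g.
Proof.
  intros Hp H1 H2; unfold cross; rewrite <- psum_plus; apply psum_ext; intros n _.
  unfold coef; rewrite ip_plus_l by auto; unfold Rdiv; ring.
Qed.

(** With equal norming constants the map sending each [pht n] to [ph n] is the adjoint of [U], and
    this holds already for the truncations. *)
Lemma cross_swap T ph pht N f g : (forall n, ip T (ph n) (ph n) = ip T (pht n) (pht n)) ->
  cross T ph pht N f g = cross T pht ph N g f.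
Proof.
  intros Ha; apply psum_ext; intros n _; unfold coef.
  rewrite Ha, (ip_sym T (pht n) g), (ip_sym T f (ph n)); unfold Rdiv; ring.
Qed.

Lemma cross_comb T ph pht N f g : (forall n, C0 (pht n)) -> C0 g ->
  cross T ph pht N f g = ip T (comb (coef T ph f) pht N) g.
Proof. intros Hp Hg; rewrite ip_comb; auto. Qed.

(** [U] is a contraction on truncations: the combination of the [pht n] has the same norm as the
    projection of [f], to which Bessel's inequality applies. *)
Lemma cross_bound T Q h H lam ph ps Qt ht Ht pht pst N f g :
  spectral T Q h H lam ph ps -> spectral T Qt ht Ht lam pht pst ->
  (forall n, ip T (ph n) (ph n) = ip T (pht n) (pht n)) -> C0 f -> C0 g ->
  cross T ph pht N f g * cross T ph pht N f g <= ip T f f * ip T g g.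
Proof.
  intros S St Ha Hf Hg; assert (HT := sp_T S).
  assert (Cp : forall n, C0 (pht n)) by (intros; apply (sp_C0 _ St)).
  rewrite cross_comb by auto.
  assert (Cc := C0_comb (coef T ph f) pht N Cp).
  eapply Rle_trans; [apply ip_cauchy_schwarz; auto; lra|].
  apply Rmult_le_compat_r; [apply ip_ge0; auto; lra|].
  rewrite (ip_comb_comb T Qt ht Ht lam pht pst _ N St).
  erewrite psum_ext; [apply (bessel T Q h H lam ph ps f N S Hf)|].
  intros n _; simpl; rewrite Ha; auto.
Qed.

(** By orthogonality only the coefficient of index 0 survives, so [U] maps [ph O] to [pht O] under
    every nonempty truncation; hence the successor. *)
Lemma cross_ph0 T Q h H lam ph ps pht N g : spectral T Q h H lam ph ps ->
  cross T ph pht (S N) (ph O) g = ip T (pht O) g.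
Proof.
  intros S; unfold cross; rewrite psum_single.
  - unfold coef; field; pose proof (sp_norm_pos O S); lra.
  - intros n Hn; unfold coef; rewrite (sp_orth O n S) by auto; unfold Rdiv; ring.
Qed.

(** By [propagation] the image of [f] is uniformly small on [[0, b - d]], the only part of [[0, T]]
    where [g] can be nonzero. *)
Lemma cross_disjoint T Q h H lam ph ps Qt ht Ht pht pst f f1 f2 g b d eps :
  spectral T Q h H lam ph ps -> spectral T Qt ht Ht lam pht pst ->
  dom h H T f f1 f2 -> (forall t, 0 <= t <= b -> f t = 0 /\ f1 t = 0) ->
  b <= T -> 0 < d < b -> C0 g -> (forall t, b - d <= t -> g t = 0) -> 0 < eps ->
  exists N0, forall N, (N0 <= N)%nat ->
    cross T ph pht N f g * cross T ph pht N f g <= eps.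
Proof.
  intros S St Df Hf HbT Hd Cg Hg Heps; assert (HT := sp_T S).
  set (G := RInt (fun t => g t * g t) 0 (b - d)).
  assert (HG : 0 <= G) by (apply RInt_ge0; [lra | c0 | intros; nra]).
  (* [T] bounds the length [b - d], and [G + 1] replaces [G] to allow for [g = 0]. *)
  assert (Heps' : 0 < eps / (T * (G + 1))) by (apply Rdiv_lt_0_compat; nra).
  destruct (propagation T Q h H lam ph ps Qt ht Ht pht pst f f1 f2 b d _ S St Df Hf HbT
    (proj1 Hd) Heps') as [N0 HN0].
  exists N0; intros N HN.
  assert (Cp : forall n, C0 (pht n)) by (intros; apply (sp_C0 _ St)).
  rewrite cross_comb by auto.
  set (w := comb (coef T ph f) pht N).
  assert (Cw : C0 w) by (apply C0_comb; auto).
  assert (E : ip T w g = RInt (fun t => w t * g t) 0 (b - d)).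
  { unfold ip; rewrite (RInt_split _ 0 (b - d) T) by c0.
    assert (Z : RInt (fun t => w t * g t) (b - d) T = 0 :> R).
    { rewrite <- (RInt_0 (b - d) T); apply RInt_ext.
      rewrite Rmin_left, Rmax_right by lra; intros x Hx; rewrite Hg by lra; simpl; ring. }
    rewrite Z; ring. }
  rewrite E.
  eapply Rle_trans; [apply RInt_cauchy_schwarz; auto; lra|]; fold G.
  assert (B : RInt (fun t => w t * w t) 0 (b - d) <= (b - d) * (eps / (T * (G + 1)))).
  { apply ip_bound; auto; [lra|]; intros t Ht'; apply HN0; auto. }
  apply Rle_trans with (T * (eps / (T * (G + 1))) * (G + 1)).
  - apply Rmult_le_compat; try lra.
    + apply RInt_ge0; [lra | c0 | intros; nra].
    + eapply Rle_trans; [exact B|]; apply Rmult_le_compat_r; lra.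
  - apply Req_le; field; lra.
Qed.

Lemma RInt_window f T l r K : 0 <= l -> l <= r -> r <= T -> C0 f ->
  (forall t, 0 <= t <= T -> f t <= K) ->
  (forall t, 0 < t < l -> f t = 0) -> (forall t, r < t < T -> f t = 0) ->
  RInt f 0 T <= (r - l) * K.
Proof.
  intros Hl Hlr Hr Cf Hb H1 H2.
  rewrite (RInt_split f 0 l T), (RInt_split f l r T) by auto.
  assert (Z1 : RInt f 0 l = 0 :> R).
  { apply (@eq_trans R _ (RInt (fun _ => 0) 0 l)); [apply RInt_ext | apply RInt_0].
    rewrite Rmin_left, Rmax_right by lra; intros x Hx; apply H1; lra. }
  assert (Z2 : RInt f r T = 0 :> R).
  { rewrite <- (RInt_0 r T); apply RInt_ext.
    rewrite Rmin_left, Rmax_right by lra; intros x Hx; apply H2; lra. }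
  rewrite Z1, Z2.
  assert (RInt f l r <= RInt (fun _ => K) l r).
  { apply RInt_le_C0; auto; [c0 | intros; apply Hb; lra]. }
  rewrite RInt_const in H; unfold scal in H; simpl in H; unfold mult in H; simpl in H; lra.
Qed.

(** * Uniqueness in the variable t *)

Lemma Rabs_le_of_sqr x y : 0 <= y -> x * x <= y * y -> Rabs x <= y.
Proof.
  intros Hy Hx; rewrite <- (Rabs_pos_eq y) by auto; apply Rsqr_le_abs_0; exact Hx.
Qed.

Lemma cross_ext T ph pht N f f' g : (forall t, f t = f' t) ->
  cross T ph pht N f g = cross T ph pht N f' g.
Proof.
  intros Hf; apply psum_ext; intros n _; unfold coef.
  rewrite (ip_ext T f (ph n) f' (ph n)); auto.
Qed.

(** The width of the transition zones around [b] used below. Two conditions keep the zones inside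
    [(0, T)]; the product condition makes the pairing of a middle piece with a head at most [eta];
    the last one bounds the change of the local norm when the sharp cut is replaced by a smooth
    one. *)
Lemma small_width b T m eta : 0 < b < T -> 1 <= m -> 0 < eta ->
  exists e, 0 < e /\ 2 * e < b /\ b + e < T /\ 3 * e * m * (T * m) <= eta * eta /\ 2 * e * m <= eta.
Proof.
  intros Hb Hm Heta.
  set (x := Rmin (b / 3) ((T - b) / 2)); set (y := eta * eta / (3 * m * (T * m))).
  set (z := eta / (2 * m)).
  assert (Hp : 0 < 3 * m * (T * m)) by (repeat apply Rmult_lt_0_compat; lra).
  assert (Hx : 0 < x) by (apply Rmin_glb_lt; lra).
  assert (Hy : 0 < y) by (apply Rdiv_lt_0_compat; nra).
  assert (Hz : 0 < z) by (apply Rdiv_lt_0_compat; lra).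
  exists (Rmin x (Rmin y z)).
  pose proof (Rmin_l x (Rmin y z)) as M1; pose proof (Rmin_r x (Rmin y z)) as M2.
  pose proof (Rmin_l y z) as M3; pose proof (Rmin_r y z) as M4.
  pose proof (Rmin_l (b / 3) ((T - b) / 2)) as M5; pose proof (Rmin_r (b / 3) ((T - b) / 2)) as M6.
  fold x in M5, M6.
  assert (He : 0 < Rmin x (Rmin y z)) by (apply Rmin_glb_lt; [|apply Rmin_glb_lt]; auto).
  set (e := Rmin x (Rmin y z)) in *.
  assert (e <= y) by lra; assert (e <= z) by lra.
  refine (conj He (conj _ (conj _ (conj _ _)))); try lra.
  - replace (eta * eta) with (y * (3 * m * (T * m))) by (unfold y; field; split; lra).
    replace (3 * e * m * (T * m)) with (e * (3 * m * (T * m))) by ring.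
    apply Rmult_le_compat_r; lra.
  - replace eta with (z * (2 * m)) by (unfold z; field; lra).
    replace (2 * e * m) with (e * (2 * m)) by ring.
    apply Rmult_le_compat_r; lra.
Qed.

(** Split [u = u0 + um + u1] and [v = v0 + vm + v1] with the weights [1 - s], [s - r] and [r]. Since
    [U u = v], the pairing of [v] with [v0] is that of [U u0] with [v0] up to the contributions of
    [um] and [u1], each at most [eta]. The inverse map gives the pairing of [u] with [u0] in the
    same way, with the same main term by [cross_swap]. Two further errors [eta] come from replacing
    the sharp cut at [b] by [s], hence the factor 6. *)
Lemma local_norms_close T Q h H lam ph ps Qt ht Ht pht pst b eta :
  spectral T Q h H lam ph ps -> spectral T Qt ht Ht lam pht pst ->
  (forall n, ip T (ph n) (ph n) = ip T (pht n) (pht n)) -> 0 < b < T -> 0 < eta ->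
  Rabs (ip b (ph O) (ph O) - ip b (pht O) (pht O)) <= 6 * eta.
Proof.
  intros S St Ha Hb Heta.
  assert (HT := sp_T S).
  assert (C1 : forall n, C0 (ph n)) by (intros; apply (sp_C0 _ S)).
  assert (C2 : forall n, C0 (pht n)) by (intros; apply (sp_C0 _ St)).
  set (u := ph O); set (v := pht O).
  assert (Cu : C0 u) by apply C1; assert (Cv : C0 v) by apply C2.
  destruct (C0_bounded (fun t => u t * u t) T ltac:(c0)) as (m1 & Hm1 & Bu').
  destruct (C0_bounded (fun t => v t * v t) T ltac:(c0)) as (m2 & Hm2 & Bv').
  set (m := 1 + m1 + m2).
  assert (Bu : forall t, 0 <= t <= T -> u t * u t <= m).
  { intros t Ht'; eapply Rle_trans; [apply Rle_abs|].
    eapply Rle_trans; [apply Bu'; rewrite Rabs_pos_eq; lra|]; unfold m; lra. }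
  assert (Bv : forall t, 0 <= t <= T -> v t * v t <= m).
  { intros t Ht'; eapply Rle_trans; [apply Rle_abs|].
    eapply Rle_trans; [apply Bv'; rewrite Rabs_pos_eq; lra|]; unfold m; lra. }
  destruct (small_width b T m eta Hb ltac:(unfold m; lra) Heta) as (e & He & Heb & HeT & He1 & He2).
  (* The step [s] is complete at [b - e], whereas [r] starts only at [b]. The gap of length [e]
     between head and tail is the margin that [cross_disjoint] requires. *)
  destruct (smooth_step_exists (b - 2 * e) (b - e)) as (s & s' & s'' & Ds & Ds' & Cs'' & Sl & Sr & Sb); [lra|].
  destruct (smooth_step_exists b (b + e)) as (r & r' & r'' & Dr & Dr' & Cr'' & Rl & Rr & Rb); [lra|].
  assert (Cs := C0_derive _ _ Ds); assert (Cs' := C0_derive _ _ Ds').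
  assert (Cr := C0_derive _ _ Dr); assert (Cr' := C0_derive _ _ Dr').
  assert (Near : forall w : R -> R, C0 w -> (forall t, 0 <= t <= T -> w t * w t <= m) ->
     Rabs (ip b w w - ip T w (fun t => w t * (1 - s t))) <= eta).
  { intros w Cw Bw.
    assert (E : ip b w w - ip T w (fun t => w t * (1 - s t)) = RInt (fun t => w t * w t * s t) 0 b :> R).
    { unfold ip; rewrite (RInt_split (fun t => w t * (w t * (1 - s t))) 0 b T) by c0.
      assert (Z : RInt (fun t => w t * (w t * (1 - s t))) b T = 0 :> R).
      { apply (@eq_trans R _ (RInt (fun _ => 0) b T)); [apply RInt_ext | apply RInt_0].
        rewrite Rmin_left, Rmax_right by lra; intros x Hx.
        destruct (Sr x ltac:(lra)) as [-> _]; simpl; ring. }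
      rewrite Z, Rplus_0_r, <- RInt_sub by c0; apply RInt_eq; intros; ring. }
    rewrite E, Rabs_pos_eq.
    - eapply Rle_trans; [apply (RInt_window _ b (b - 2 * e) b m); try lra; [c0 | | |]|].
      + intros t Ht'; specialize (Bw t ltac:(lra)); specialize (Sb t).
        pose proof (Rle_0_sqr (w t)); unfold Rsqr in *; nra.
      + intros t Ht'; destruct (Sl t ltac:(lra)) as [-> _]; ring.
      + intros t Ht'; lra.
      + lra.
    - apply RInt_ge0; [lra | c0 |]; intros t _; specialize (Sb t).
      pose proof (Rle_0_sqr (w t)); unfold Rsqr in *; nra. }
  assert (Mid : forall w : R -> R, C0 w -> (forall t, 0 <= t <= T -> w t * w t <= m) ->
     ip T (fun t => w t * (s t - r t)) (fun t => w t * (s t - r t)) <= 3 * e * m).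
  { intros w Cw Bw; unfold ip.
    eapply Rle_trans; [apply (RInt_window _ T (b - 2 * e) (b + e) m); try lra; [c0 | | |]|].
    - intros t Ht'; specialize (Bw t ltac:(lra)); specialize (Sb t); specialize (Rb t).
      pose proof (Rle_0_sqr (w t)); unfold Rsqr in *.
      assert (0 <= (s t - r t) * (s t - r t) <= 1)
        by (assert (-1 <= s t - r t <= 1) by lra; generalize dependent (s t - r t); intros; nra).
      replace (w t * (s t - r t) * (w t * (s t - r t)))
        with (w t * w t * ((s t - r t) * (s t - r t))) by ring.
      nra.
    - intros t Ht'; destruct (Sl t ltac:(lra)) as [-> _]; destruct (Rl t ltac:(lra)) as [-> _]; ring.
    - intros t Ht'; destruct (Sr t ltac:(lra)) as [-> _]; destruct (Rr t ltac:(lra)) as [-> _]; ring.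
    - lra. }
  assert (Low : forall w : R -> R, C0 w -> (forall t, 0 <= t <= T -> w t * w t <= m) ->
     ip T (fun t => w t * (1 - s t)) (fun t => w t * (1 - s t)) <= T * m).
  { intros w Cw Bw; apply ip_bound; [lra | c0 |].
    intros t Ht'; specialize (Bw t ltac:(lra)); specialize (Sb t).
    pose proof (Rle_0_sqr (w t)); unfold Rsqr in *.
    assert (0 <= (1 - s t) * (1 - s t) <= 1) by nra.
    replace (w t * (1 - s t) * (w t * (1 - s t)))
      with (w t * w t * ((1 - s t) * (1 - s t))) by ring.
    nra. }
  set (u0 := fun t => u t * (1 - s t)); set (um := fun t => u t * (s t - r t)).
  set (v0 := fun t => v t * (1 - s t)); set (vm := fun t => v t * (s t - r t)).
  set (u1 := fun t => u t * r t); set (v1 := fun t => v t * r t).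
  assert (Cu0 : C0 u0) by (unfold u0; c0); assert (Cum : C0 um) by (unfold um; c0).
  assert (Cv0 : C0 v0) by (unfold v0; c0); assert (Cvm : C0 vm) by (unfold vm; c0).
  assert (Cu1 : C0 u1) by (unfold u1; c0); assert (Cv1 : C0 v1) by (unfold v1; c0).
  assert (r0 : r' 0 = 0) by (apply Rl; lra).
  assert (rT : r' T = 0) by (apply Rr; lra).
  assert (Du1 := dom_cutoff h H T _ _ _ r r' r'' (sp_dom O S) Dr Dr' Cr'' r0 rT).
  assert (Dv1 := dom_cutoff ht Ht T _ _ _ r r' r'' (sp_dom O St) Dr Dr' Cr'' r0 rT).
  assert (Z0 : forall w : R -> R, forall t, b - e <= t -> w t * (1 - s t) = 0).
  { intros w t Ht'; destruct (Sr t ltac:(lra)) as [-> _]; ring. }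
  assert (Heta2 : 0 < eta * eta) by nra.
  assert (Zr : forall (w w1 : R -> R) t, 0 <= t <= b ->
    w t * r t = 0 /\ w1 t * r t + w t * r' t = 0).
  { intros w w1 t Ht'; destruct (Rl t ltac:(lra)) as [-> ->]; split; ring. }
  destruct (cross_disjoint T Q h H lam ph ps Qt ht Ht pht pst _ _ _ v0 b e (eta * eta) S St Du1
    (Zr _ _) ltac:(lra) ltac:(lra) Cv0 (Z0 v) Heta2) as [N1 HN1].
  destruct (cross_disjoint T Qt ht Ht lam pht pst Q h H ph ps _ _ _ u0 b e (eta * eta) St S Dv1
    (Zr _ _) ltac:(lra) ltac:(lra) Cu0 (Z0 u) Heta2) as [N2 HN2].
  set (N := (N1 + N2)%nat).
  assert (X1 := HN1 (Datatypes.S N) ltac:(unfold N; lia)); fold u u1 in X1.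
  assert (X2 := HN2 (Datatypes.S N) ltac:(unfold N; lia)); fold v v1 in X2.
  assert (Ha' : forall n, ip T (pht n) (pht n) = ip T (ph n) (ph n)) by auto.
  assert (X3 := cross_bound T Q h H lam ph ps Qt ht Ht pht pst (Datatypes.S N) um v0 S St Ha Cum Cv0).
  assert (X4 := cross_bound T Qt ht Ht lam pht pst Q h H ph ps (Datatypes.S N) vm u0 St S Ha' Cvm Cu0).
  assert (P3 : ip T um um * ip T v0 v0 <= eta * eta).
  { eapply Rle_trans; [|exact He1]; apply Rmult_le_compat;
      [apply ip_ge0; auto; lra | apply ip_ge0; auto; lra | apply (Mid u); auto | apply (Low v); auto]. }
  assert (P4 : ip T vm vm * ip T u0 u0 <= eta * eta).
  { eapply Rle_trans; [|exact He1]; apply Rmult_le_compat;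
      [apply ip_ge0; auto; lra | apply ip_ge0; auto; lra | apply (Mid v); auto | apply (Low u); auto]. }
  assert (Y1 := Rabs_le_of_sqr _ _ (Rlt_le _ _ Heta) X1).
  assert (Y2 := Rabs_le_of_sqr _ _ (Rlt_le _ _ Heta) X2).
  assert (Y3 := Rabs_le_of_sqr _ _ (Rlt_le _ _ Heta) (Rle_trans _ _ _ X3 P3)).
  assert (Y4 := Rabs_le_of_sqr _ _ (Rlt_le _ _ Heta) (Rle_trans _ _ _ X4 P4)).
  assert (E1 := cross_ph0 T Q h H lam ph ps pht N v0 S); fold u v in E1.
  assert (E2 := cross_ph0 T Qt ht Ht lam pht pst ph N u0 St); fold u v in E2.
  rewrite (cross_ext _ _ _ _ u (fun t => (u0 t + um t) + u1 t)) in E1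
    by (intros; unfold u0, um, u1; ring).
  rewrite (cross_ext _ _ _ _ v (fun t => (v0 t + vm t) + v1 t)) in E2
    by (intros; unfold v0, vm, v1; ring).
  rewrite !cross_plus_l in E1 by c0.
  rewrite !cross_plus_l in E2 by c0.
  rewrite (cross_swap T pht ph (Datatypes.S N) v0 u0 Ha') in E2.
  assert (Nu := Near u Cu Bu); assert (Nv := Near v Cv Bv); fold u0 in Nu; fold v0 in Nv.
  apply Rabs_le_between in Y1, Y2, Y3, Y4, Nu, Nv.
  apply Rabs_le; lra.
Qed.

Lemma C0_eq_closure f g T t : 0 < T -> C0 f -> C0 g -> (forall t, 0 < t < T -> f t = g t) ->
  0 <= t <= T -> f t = g t.
Proof.
  intros HT Cf Cg Hfg Ht.
  destruct (Req_dec (f t) (g t)) as [|Hne]; auto; exfalso.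
  assert (Ck : C0 (fun t => Rabs (f t - g t))).
  { apply (C0_comp (fun t => f t - g t) Rabs); [c0 | intros y; apply continuous_Rabs]. }
  assert (Hp : 0 < Rabs (f t - g t)) by (apply Rabs_pos_lt; lra).
  assert (HL : locally t (fun x => 0 < Rabs (f x - g x)))
    by (apply (Ck t); apply (open_gt 0); exact Hp).
  destruct HL as [d Hd]; pose proof (cond_pos d) as Hd0.
  set (k := Rmin d T / 2).
  assert (Hk : 0 < k /\ k < d /\ k <= T / 2).
  { unfold k; assert (0 < Rmin d T) by (apply Rmin_glb_lt; lra).
    pose proof (Rmin_l d T); pose proof (Rmin_r d T); lra. }
  assert (Hx : exists x, 0 < x < T /\ Rabs (x - t) < d).
  { destruct (Rle_dec t (T / 2)) as [L|L].
    - destruct (Req_dec (t + k) T).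
      + exists (t + k / 2); split; [lra|]; rewrite Rabs_pos_eq; lra.
      + exists (t + k); split; [lra|]; rewrite Rabs_pos_eq; lra.
    - exists (t - k); split; [lra|]; rewrite Rabs_left; lra. }
  destruct Hx as (x & Hx & Hxd).
  assert (B := Hd x Hxd); rewrite (Hfg x Hx), Rminus_diag, Rabs_R0 in B; lra.
Qed.

Lemma derive_eq_on_open (f g f1 g1 : R -> R) T t : 0 < t < T ->
  (forall t, is_derive f t (f1 t)) -> (forall t, is_derive g t (g1 t)) ->
  (forall t, 0 < t < T -> f t = g t) -> f1 t = g1 t.
Proof.
  intros Ht Hf Hg He.
  rewrite <- (is_derive_unique f t (f1 t)), <- (is_derive_unique g t (g1 t)) by auto.
  apply Derive_ext_loc.
  assert (Hd : 0 < Rmin t (T - t)) by (apply Rmin_glb_lt; lra).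
  exists (mkposreal _ Hd); intros y Hy.
  assert (B : Rabs (y - t) < Rmin t (T - t)) by exact Hy.
  pose proof (Rmin_l t (T - t)); pose proof (Rmin_r t (T - t)).
  apply Rabs_def2 in B; apply He; lra.
Qed.

(** Two differentiations of [u^2 = v^2] give [u u1 = v v1] and an identity containing the
    potentials. Where [u <> 0] these yield [u1^2 = v1^2] and then [Q = Qt]. At a zero of [u] with
    [Q <> Qt], the potentials would differ on a neighbourhood, so [u] would vanish there with its
    derivative and hence also at 0. The identity [u u1 = v v1] at the two ends gives the boundary
    coefficients. *)
Theorem spectral_uniqueness T Q h H lam ph ps Qt ht Ht pht pst :
  spectral T Q h H lam ph ps -> spectral T Qt ht Ht lam pht pst ->
  (forall n, ip T (ph n) (ph n) = ip T (pht n) (pht n)) ->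
  (forall t, 0 <= t <= T -> Q t = Qt t) /\ h = ht /\ H = Ht.
Proof.
  intros S St Ha; assert (HT := sp_T S).
  assert (HQ := sp_Q S); assert (HQt := sp_Q St).
  destruct (sp_C0 O S) as [Cu Cu1]; destruct (sp_C0 O St) as [Cv Cv1].
  assert (Du := sp_ph S O); assert (Du1 := sp_ps S O).
  assert (Dv := sp_ph St O); assert (Dv1 := sp_ps St O).
  assert (U0 := sp_ph0 S O); assert (U1 := sp_ps0 S O); assert (UT := sp_psT S O).
  assert (V0 := sp_ph0 St O); assert (V1 := sp_ps0 St O); assert (VT := sp_psT St O).
  assert (UTn := sp_phT O S).
  assert (Hint : forall b, 0 < b < T -> ip b (ph O) (ph O) = ip b (pht O) (pht O)).
  { intros b Hb; apply Rminus_diag_uniq.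
    destruct (Req_dec (ip b (ph O) (ph O) - ip b (pht O) (pht O)) 0) as [|Hne]; auto; exfalso.
    apply Rabs_pos_lt in Hne.
    (* With a twelfth of the discrepancy as [eta], the bound [6 * eta] is half the discrepancy. *)
    assert (B := local_norms_close T Q h H lam ph ps Qt ht Ht pht pst b
      (Rabs (ip b (ph O) (ph O) - ip b (pht O) (pht O)) / 12) S St Ha Hb ltac:(lra)).
    lra. }
  set (u := ph O) in *; set (u1 := ps O) in *; set (v := pht O) in *; set (v1 := pst O) in *.
  assert (Esq : forall t, 0 < t < T -> u t * u t = v t * v t).
  { intros t Ht'.
    apply (derive_eq_on_open (fun b => ip b u u) (fun b => ip b v v)
      (fun t => u t * u t) (fun t => v t * v t) T); auto.
    - intros x; apply (is_derive_RInt_C0 (fun t => u t * u t)); c0.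
    - intros x; apply (is_derive_RInt_C0 (fun t => v t * v t)); c0. }
  assert (Dsq : forall (y z : R -> R) (t : R), (forall t, is_derive y t (z t)) ->
    is_derive (fun t => y t * y t) t (2 * (y t * z t))).
  { intros y z t Hy; evar_last.
    - apply (is_derive_mult y y); [apply Hy | apply Hy | intros; apply Rmult_comm].
    - unfold plus, mult; simpl; ring. }
  assert (Epr : forall t, 0 < t < T -> 2 * (u t * u1 t) = 2 * (v t * v1 t)).
  { intros t Ht'.
    apply (derive_eq_on_open (fun t => u t * u t) (fun t => v t * v t)
      (fun t => 2 * (u t * u1 t)) (fun t => 2 * (v t * v1 t)) T); auto. }
  assert (Esec : forall t, 0 < t < T ->
    2 * (u1 t * u1 t + u t * ((Q t - lam O) * u t)) = 2 * (v1 t * v1 t + v t * ((Qt t - lam O) * v t))).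
  { intros t Ht'.
    apply (derive_eq_on_open (fun t => 2 * (u t * u1 t)) (fun t => 2 * (v t * v1 t))
      (fun t => 2 * (u1 t * u1 t + u t * ((Q t - lam O) * u t)))
      (fun t => 2 * (v1 t * v1 t + v t * ((Qt t - lam O) * v t))) T); auto.
    - intros x; apply (is_derive_scal (fun t => u t * u1 t)).
      apply (is_derive_mult u u1); [apply Du | apply Du1 | intros; apply Rmult_comm].
    - intros x; apply (is_derive_scal (fun t => v t * v1 t)).
      apply (is_derive_mult v v1); [apply Dv | apply Dv1 | intros; apply Rmult_comm]. }
  assert (EQ : forall t, 0 < t < T -> u t <> 0 -> Q t = Qt t).
  { intros t Ht' Hu.
    specialize (Esq t Ht'); specialize (Epr t Ht'); specialize (Esec t Ht').
    assert (Hp : 0 < u t * u t) by nra.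
    assert (E1 : u t * u t * (u1 t * u1 t) = u t * u t * (v1 t * v1 t)).
    { rewrite Esq at 2.
      replace (u t * u t * (u1 t * u1 t)) with ((u t * u1 t) * (u t * u1 t)) by ring.
      replace (u t * u1 t) with (v t * v1 t) by lra; ring. }
    apply Rmult_eq_reg_l in E1; [|lra].
    apply Rmult_eq_reg_l with (u t * u t); [|lra].
    replace (v t * ((Qt t - lam O) * v t)) with ((Qt t - lam O) * (v t * v t)) in Esec by ring.
    rewrite <- Esq in Esec; lra. }
  assert (EQ' : forall t, 0 < t < T -> Q t = Qt t).
  { intros t Ht'.
    destruct (Req_dec (u t) 0) as [Hu|Hu]; [|auto].
    destruct (Req_dec (Q t) (Qt t)) as [|Hne]; auto; exfalso.
    assert (Ck : C0 (fun t => Rabs (Q t - Qt t))).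
    { apply (C0_comp (fun t => Q t - Qt t) Rabs); [c0 | intros y; apply continuous_Rabs]. }
    assert (Hp : 0 < Rabs (Q t - Qt t)) by (apply Rabs_pos_lt; lra).
    assert (HL : locally t (fun x => 0 < Rabs (Q x - Qt x)))
      by (apply (Ck t); apply (open_gt 0); exact Hp).
    assert (HI : locally t (fun x => 0 < x < T)).
    { apply filter_and; [apply (open_gt 0); lra | apply (open_lt T); lra]. }
    assert (Hz : locally t (fun x => u x = 0)).
    { generalize (filter_and _ _ HL HI); apply filter_imp; intros x [A B].
      destruct (Req_dec (u x) 0) as [|Hx]; auto.
      rewrite (EQ x B Hx), Rminus_diag, Rabs_R0 in A; lra. }
    assert (Hu1 : u1 t = 0).
    { rewrite <- (is_derive_unique u t (u1 t)) by auto.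
      rewrite (Derive_ext_loc u (fun _ => 0) t Hz); apply Derive_const. }
    destruct (sp_shift (lam O) S) as (C & HC & HV).
    assert (u 0 = 0) by
      (apply (ode_nonvanishing (fun t => Q t - lam O) u u1 C t); auto; lra).
    lra. }
  assert (Epr' : forall t, 0 <= t <= T -> 2 * (u t * u1 t) = 2 * (v t * v1 t)).
  { intros t Ht'; apply (C0_eq_closure (fun t => 2 * (u t * u1 t)) (fun t => 2 * (v t * v1 t)) T);
      auto; c0. }
  assert (EsqT : u T * u T = v T * v T).
  { apply (C0_eq_closure (fun t => u t * u t) (fun t => v t * v t) T); auto; try c0; lra. }
  split; [|split].
  - intros t Ht'; apply (C0_eq_closure Q Qt T); auto.
  - specialize (Epr' 0 ltac:(lra)); rewrite U0, U1, V0, V1 in Epr'; lra.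
  - specialize (Epr' T ltac:(lra)); rewrite UT, VT in Epr'.
    assert (0 < u T * u T) by nra.
    apply Rmult_eq_reg_r with (u T * u T); [|lra].
    rewrite EsqT at 2; lra.
Qed.

(** * The change of variable t = x^a / a *)

(* Stdlib's [Rpower 0 e] is [1] (because [ln 0 = 0]), so the value at 0 must be forced. *)
Definition pospow (e x : R) : R := if Rle_dec x 0 then 0 else Rpower x e.

Lemma pospow_pos e x : 0 < x -> pospow e x = Rpower x e.
Proof. intros Hx; unfold pospow; destruct (Rle_dec x 0); [lra | auto]. Qed.

Lemma pospow_neg e x : x <= 0 -> pospow e x = 0.
Proof. intros Hx; unfold pospow; destruct (Rle_dec x 0); [auto | lra]. Qed.

Lemma pospow_gt0 e x : 0 < x -> 0 < pospow e x.
Proof. intros Hx; rewrite pospow_pos by auto; apply exp_pos. Qed.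

Lemma pospow_incr e x y : 0 < e -> 0 <= x -> x < y -> pospow e x < pospow e y.
Proof.
  intros He Hx Hxy; destruct Hx as [Hx| <-].
  - rewrite !pospow_pos by lra; apply Rlt_Rpower_l; lra.
  - rewrite (pospow_neg e 0) by lra; apply pospow_gt0; auto.
Qed.

Lemma pospow_inv e x : 0 < e -> 0 <= x -> pospow (/ e) (pospow e x) = x.
Proof.
  intros He Hx; destruct Hx as [Hx| <-].
  - rewrite (pospow_pos (/ e)) by (apply pospow_gt0; auto); rewrite pospow_pos by auto.
    rewrite Rpower_mult, Rinv_r, Rpower_1 by lra; auto.
  - rewrite !pospow_neg; auto; try lra; rewrite pospow_neg; lra.
Qed.

Lemma is_derive_Rpower e x : 0 < x -> is_derive (fun x => Rpower x e) x (e * Rpower x (e - 1)).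
Proof. intros Hx; apply is_derive_Reals, derivable_pt_lim_power; auto. Qed.

Lemma is_derive_pospow e x : 0 < x -> is_derive (pospow e) x (e * Rpower x (e - 1)).
Proof.
  intros Hx; apply (is_derive_ext_loc (fun x => Rpower x e)).
  - apply (filter_imp (fun y => 0 < y)); [|apply (open_gt 0); auto].
    intros y Hy; rewrite pospow_pos; auto.
  - apply is_derive_Rpower; auto.
Qed.

Lemma C0_pospow e : 0 < e -> C0 (pospow e).
Proof.
  intros He x.
  destruct (Rtotal_order x 0) as [Hx|[->|Hx]].
  - apply (continuous_ext_loc (pospow e) (fun _ => 0) x); [|apply continuous_const].
    apply (filter_imp (fun y => y < 0)); [|apply (open_lt 0); auto].
    intros y Hy; rewrite pospow_neg; lra.
  - intros P [eps HP].
    set (d := Rpower (eps) (/ e)).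
    exists (mkposreal d (exp_pos _)); intros y Hy; apply HP.
    assert (B : Rabs (y - 0) < d) by exact Hy.
    rewrite (pospow_neg e 0) by lra.
    change (Rabs (pospow e y - 0) < eps).
    pose proof (cond_pos eps) as Hep.
    rewrite Rminus_0_r in B |- *.
    destruct (Rle_dec y 0) as [Hy0|Hy0].
    + rewrite pospow_neg, Rabs_R0 by auto; auto.
    + rewrite Rabs_pos_eq by (left; apply pospow_gt0; lra).
      rewrite Rabs_pos_eq in B by lra.
      rewrite pospow_pos by lra.
      replace (pos eps) with (Rpower d e).
      * apply Rlt_Rpower_l; lra.
      * unfold d; rewrite Rpower_mult, Rinv_l, Rpower_1 by lra; auto.
  - apply (ex_derive_continuous (pospow e)); eexists; apply is_derive_pospow; auto.
Qed.

(** At a fixed point the conformable increment is the ordinary one rescaled by the positive constant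
    [Rpower x (1 - a)], so the defining limit alone implies differentiability. *)
Lemma conf_deriv_is_derive a y x l : conf_deriv a y x l -> is_derive y x (l / Rpower x (1 - a)).
Proof.
  intros Hl; unfold conf_deriv in Hl; apply is_lim_spec in Hl.
  set (k := Rpower x (1 - a)) in *.
  assert (Hk : 0 < k) by apply exp_pos.
  apply is_derive_Reals; intros eps Heps.
  assert (Hek : 0 < eps * k) by nra.
  destruct (Hl (mkposreal _ Hek)) as [d Hd]; simpl in Hd.
  assert (Hdk : 0 < d * k) by (pose proof (cond_pos d); nra).
  exists (mkposreal _ Hdk); intros t Ht Htd; simpl in Htd.
  assert (B : Rabs ((y (x + t / k * k) - y x) / (t / k) - l) < eps * k).
  { apply Hd.
    - change (Rabs (t / k - 0) < d); rewrite Rminus_0_r.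
      unfold Rdiv; rewrite Rabs_mult, Rabs_inv, (Rabs_pos_eq k) by lra.
      apply Rmult_lt_reg_r with k; auto; rewrite Rmult_assoc, Rinv_l, Rmult_1_r; lra.
    - unfold Rdiv; apply Rmult_integral_contrapositive_currified; auto.
      apply Rinv_neq_0_compat; lra. }
  replace (t / k * k) with t in B by (field; lra).
  replace ((y (x + t) - y x) / t - l / k) with (((y (x + t) - y x) / (t / k) - l) / k)
    by (field; split; lra).
  unfold Rdiv at 1; rewrite Rabs_mult, Rabs_inv, (Rabs_pos_eq k) by lra.
  apply Rmult_lt_reg_r with k; auto; rewrite Rmult_assoc, Rinv_l, Rmult_1_r; lra.
Qed.

Lemma is_derive_conf_deriv a (y : R -> R) x l : is_derive y x l -> conf_deriv a y x (l * Rpower x (1 - a)).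
Proof.
  intros Hl; unfold conf_deriv; apply is_lim_spec; intros eps.
  set (k := Rpower x (1 - a)).
  assert (Hk : 0 < k) by apply exp_pos.
  apply is_derive_Reals in Hl.
  assert (Hek : 0 < eps / k) by (apply Rdiv_lt_0_compat; [apply cond_pos | auto]).
  destruct (Hl _ Hek) as [d Hd].
  assert (Hdk : 0 < d / k) by (apply Rdiv_lt_0_compat; [apply cond_pos | auto]).
  exists (mkposreal _ Hdk); intros t Ht Ht0.
  assert (B : Rabs (t - 0) < d / k) by exact Ht.
  rewrite Rminus_0_r in B.
  assert (Htk : t * k <> 0) by (apply Rmult_integral_contrapositive_currified; lra).
  assert (D := Hd (t * k) Htk).
  assert (Htd : Rabs (t * k) < d).
  { rewrite Rabs_mult, (Rabs_pos_eq k) by lra.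
    replace (pos d) with (d / k * k) by (field; lra); apply Rmult_lt_compat_r; auto. }
  specialize (D Htd).
  replace ((y (x + t * k) - y x) / t - l * k) with (((y (x + t * k) - y x) / (t * k) - l) * k)
    by (field; split; lra).
  rewrite Rabs_mult, (Rabs_pos_eq k) by lra.
  replace (pos eps) with (eps / k * k) by (field; lra); apply Rmult_lt_compat_r; auto.
Qed.

(** The new variable; [xi] is its inverse on the nonnegative half-line. The derivative of [xi] is
    [x^(1-a)], which is why the conformable derivative in [x] becomes [d/dt]. *)
Definition tau (a x : R) : R := pospow a x / a.
Definition xi (a t : R) : R := pospow (/ a) (a * t).

Lemma C0_tau a : 0 < a -> C0 (tau a).
Proof. intros Ha; unfold tau; apply C0_div, C0_pospow; auto. Qed.

Lemma C0_xi a : 0 < a -> C0 (xi a).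
Proof.
  intros Ha; apply (C0_comp (fun t => a * t) (pospow (/ a))); [c0|].
  apply C0_pospow, Rinv_0_lt_compat; auto.
Qed.

Lemma tau_0 a : tau a 0 = 0.
Proof. unfold tau; rewrite pospow_neg by lra; unfold Rdiv; ring. Qed.

Lemma xi_0 a : xi a 0 = 0.
Proof. unfold xi; rewrite Rmult_0_r; apply pospow_neg; lra. Qed.

Lemma xi_tau a x : 0 < a -> 0 <= x -> xi a (tau a x) = x.
Proof.
  intros Ha Hx; unfold xi, tau; replace (a * (pospow a x / a)) with (pospow a x) by (field; lra).
  apply pospow_inv; auto.
Qed.

Lemma tau_incr a x y : 0 < a -> 0 <= x -> x < y -> tau a x < tau a y.
Proof.
  intros Ha Hx Hxy; unfold tau; apply Rmult_lt_compat_r; [apply Rinv_0_lt_compat; auto|].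
  apply pospow_incr; auto.
Qed.

Lemma xi_incr a t s : 0 < a -> 0 <= t -> t < s -> xi a t < xi a s.
Proof.
  intros Ha Ht Hts; apply pospow_incr; [apply Rinv_0_lt_compat; auto | nra | nra].
Qed.

Lemma is_derive_tau a x : 0 < a -> 0 < x -> is_derive (tau a) x (Rpower x (a - 1)).
Proof.
  intros Ha Hx; unfold tau.
  apply (is_derive_ext (fun x => / a * pospow a x)); [intros; unfold Rdiv; apply Rmult_comm|].
  replace (Rpower x (a - 1)) with (/ a * (a * Rpower x (a - 1))) by (field; lra).
  apply (is_derive_scal (pospow a)), is_derive_pospow; auto.
Qed.

Lemma is_derive_xi a t : 0 < a -> 0 < t -> is_derive (xi a) t (Rpower (xi a t) (1 - a)).
Proof.
  intros Ha Ht; unfold xi; evar_last.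
  - apply (is_derive_comp (pospow (/ a)) (fun t => a * t)).
    + apply is_derive_pospow; nra.
    + auto_derive; auto.
  - unfold scal; simpl; unfold mult; simpl.
    rewrite pospow_pos by nra; rewrite Rpower_mult.
    replace (/ a * (1 - a)) with (/ a - 1) by (field; lra); field; lra.
Qed.

(** A conformable solution is differentiable only in the open interval and has its data at 0 as
    limits. The nonincreasing quantity [G] is therefore compared on [[s, t]] with [s] tending to 0,
    where it becomes arbitrarily small. *)
Lemma ode_zero_open (V U W : R -> R) C T t : 0 <= C -> 0 < t < T ->
  (forall r, Rabs (V r) <= C) ->
  (forall s, 0 < s < T -> is_derive U s (W s)) ->
  (forall s, 0 < s < T -> is_derive W s (V s * U s)) ->
  filterlim U (at_right 0) (locally 0) -> filterlim W (at_right 0) (locally 0) ->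
  U t = 0 /\ W t = 0.
Proof.
  intros HC Ht HV HU HW LU LW.
  set (G := fun s => exp (- (1 + C) * s) * (U s * U s + W s * W s)).
  assert (Hdec : forall s, 0 < s <= t -> G t <= G s).
  { intros s Hs; apply (derive_nonpos_decr G
      (fun s => exp (- (1 + C) * s) * (2 * (U s * W s) * (1 + V s)
         - (1 + C) * (U s * U s + W s * W s)))); [lra | |].
    - intros r Hr; unfold G; evar_last.
      + apply (is_derive_mult (fun s => exp (- (1 + C) * s)) (fun s => U s * U s + W s * W s));
          [ | | intros; apply Rmult_comm].
        * auto_derive; auto.
        * apply (is_derive_plus (fun s => U s * U s) (fun s => W s * W s)).
          -- apply (is_derive_mult U U); [apply HU; lra | apply HU; lra | intros; apply Rmult_comm].
          -- apply (is_derive_mult W W); [apply HW; lra | apply HW; lra | intros; apply Rmult_comm].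
      + unfold plus, mult; simpl; ring.
    - intros r Hr; specialize (HV r); apply Rabs_le_between in HV.
      pose proof (exp_pos (- (1 + C) * r)).
      assert (2 * (U r * W r) * (1 + V r) <= (1 + C) * (U r * U r + W r * W r)).
      { apply Rle_trans with (Rabs (2 * (U r * W r)) * (1 + C)).
        - eapply Rle_trans; [apply Rle_abs|]; rewrite Rabs_mult.
          apply Rmult_le_compat_l; [apply Rabs_pos | apply Rabs_le; lra].
        - rewrite (Rmult_comm (1 + C)); apply Rmult_le_compat_r; [lra|].
          apply Rabs_double_mult_le. }
      nra. }
  assert (SU := Rle_0_sqr (U t)); assert (SW := Rle_0_sqr (W t)); unfold Rsqr in SU, SW.
  destruct (Req_dec (U t * U t + W t * W t) 0) as [E|E].
  { split; apply Rsqr_0_uniq; unfold Rsqr; lra. }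
  exfalso.
  assert (HG : 0 < G t) by (unfold G; apply Rmult_lt_0_compat; [apply exp_pos | lra]).
  (* Numbers below [k] in absolute value have squares below [G t / 2], because [k <= 1] and
     [k <= G t / 2]. *)
  set (k := Rmin 1 (G t / 2)).
  assert (Hk : 0 < k /\ k <= 1 /\ k <= G t / 2).
  { unfold k; pose proof (Rmin_l 1 (G t / 2)); pose proof (Rmin_r 1 (G t / 2)).
    split; [apply Rmin_glb_lt; lra | lra]. }
  assert (Hb : locally 0 (fun x => Rabs (x - 0) < k)) by (exists (mkposreal k (proj1 Hk)); auto).
  assert (BU := LU _ Hb); assert (BW := LW _ Hb); unfold filtermap in BU, BW.
  assert (Bt : at_right 0 (fun s => s < t)).
  { apply filter_le_within; apply (open_lt t); lra. }
  assert (B0 : at_right 0 (fun s => 0 < s)).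
  { unfold at_right, within; apply filter_forall; auto. }
  destruct (filter_ex _ (filter_and _ _ (filter_and _ _ BU BW) (filter_and _ _ Bt B0)))
    as [s [[B1 B2] [B3 B4]]].
  rewrite Rminus_0_r in B1, B2.
  assert (Sq : forall x, Rabs x < k -> x * x < G t / 2).
  { intros x Hx; rewrite <- (Rabs_pos_eq (x * x)) by nra; rewrite Rabs_mult.
    pose proof (Rabs_pos x); nra. }
  assert (A1 := Sq _ B1); assert (A2 := Sq _ B2).
  assert (A3 := Hdec s ltac:(lra)).
  assert (Hexp : exp (- (1 + C) * s) <= 1).
  { rewrite <- exp_0 at 2; left; apply exp_increasing; nra. }
  assert (0 < exp (- (1 + C) * s)) by apply exp_pos.
  assert (G s <= U s * U s + W s * W s).
  { unfold G; pose proof (Rle_0_sqr (U s)); pose proof (Rle_0_sqr (W s)); unfold Rsqr in *; nra. }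
  lra.
Qed.

(** Projection onto [[0, T]] for [T >= 0], written with [Rmax 0] only, so that continuity reduces to
    [C0_Rmax]. *)
Definition clamp (T t : R) : R := Rmax 0 (T - Rmax 0 (T - t)).

Lemma clamp_range T t : 0 <= T -> 0 <= clamp T t <= T.
Proof.
  intros HT; unfold clamp; split; [apply Rmax_l|].
  apply Rmax_lub; auto; pose proof (Rmax_l 0 (T - t)); lra.
Qed.

Lemma clamp_id T t : 0 <= t <= T -> clamp T t = t.
Proof. intros Ht; unfold clamp; rewrite (Rmax_right 0 (T - t)), Rmax_right; lra. Qed.

Lemma C0_clamp T : C0 (clamp T).
Proof.
  unfold clamp; apply (C0_comp (fun t => T - Rmax 0 (T - t)) (Rmax 0)); [|apply C0_Rmax].
  apply C0_minus; [c0|]; apply (C0_comp (fun t => T - t) (Rmax 0)); [c0 | apply C0_Rmax].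
Qed.

(** The potential in the variable [t], extended by its end values; this makes it continuous and
    bounded on the whole line although [q] is controlled on [[0, PI]] only. *)
Definition pull (a : R) (q : R -> R) (t : R) : R := q (xi a (clamp (tau a PI) t)).

Lemma tau_PI_pos a : 0 < a -> 0 < tau a PI.
Proof. intros Ha; rewrite <- (tau_0 a); apply tau_incr; auto; [lra | apply PI_RGT_0]. Qed.

Lemma xi_clamp_range a t : 0 < a -> 0 <= xi a (clamp (tau a PI) t) <= PI.
Proof.
  intros Ha; assert (HT := tau_PI_pos a Ha); assert (HP := PI_RGT_0).
  destruct (clamp_range (tau a PI) t) as [[H1|H1] [H2|H2]]; try lra.
  - assert (B1 := xi_incr a _ _ Ha (Rle_refl 0) H1); rewrite xi_0 in B1.
    assert (B2 := xi_incr a _ _ Ha (Rlt_le _ _ H1) H2); rewrite xi_tau in B2; lra.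
  - rewrite H2, xi_tau by lra; lra.
  - rewrite <- H1, xi_0; lra.
Qed.

Lemma C0_pull a q : 0 < a -> cont_on_0pi q -> C0 (pull a q).
Proof.
  intros Ha Hq t.
  assert (Cx : C0 (fun t => xi a (clamp (tau a PI) t))) by (apply C0_comp; [apply C0_clamp | apply C0_xi; auto]).
  unfold pull; eapply (filterlim_comp _ _ _ (fun t => xi a (clamp (tau a PI) t)) q (locally t) _ _);
    [|apply Hq; apply xi_clamp_range; auto].
  intros P HP; unfold within in HP; unfold filtermap.
  apply (filter_imp (fun s => 0 <= xi a (clamp (tau a PI) s) <= PI -> P (xi a (clamp (tau a PI) s)))).
  - intros s Hs; apply Hs, xi_clamp_range; auto.
  - apply (Cx t _ HP).
Qed.

Lemma pull_bounded a q : 0 < a -> cont_on_0pi q -> exists C, 0 <= C /\ forall t, Rabs (pull a q t) <= C.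
Proof.
  intros Ha Hq; assert (HT := tau_PI_pos a Ha).
  destruct (C0_bounded (pull a q) (tau a PI) (C0_pull a q Ha Hq)) as (C & HC & HB).
  exists C; split; auto; intros t.
  destruct (clamp_range (tau a PI) t ltac:(lra)) as [H1 H2].
  replace (pull a q t) with (pull a q (clamp (tau a PI) t)).
  - apply HB; rewrite Rabs_pos_eq; auto.
  - unfold pull; rewrite (clamp_id _ (clamp _ t)); auto.
Qed.

Lemma tau_range a x : 0 < a -> 0 <= x <= PI -> 0 <= tau a x <= tau a PI.
Proof.
  intros Ha Hx; split.
  - destruct (Req_dec x 0) as [E|E]; [rewrite E, tau_0; lra|].
    rewrite <- (tau_0 a); left; apply tau_incr; lra.
  - destruct (Req_dec x PI) as [E|E]; [rewrite E; lra | left; apply tau_incr; lra].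
Qed.

Lemma pull_tau a q x : 0 < a -> 0 <= x <= PI -> pull a q (tau a x) = q x.
Proof.
  intros Ha Hx; unfold pull; rewrite clamp_id by (apply tau_range; auto).
  rewrite xi_tau; lra.
Qed.

Lemma pull_xi a q t : 0 < a -> 0 <= t <= tau a PI -> pull a q t = q (xi a t).
Proof. intros Ha Ht; unfold pull; rewrite clamp_id; auto. Qed.

Lemma xi_open a t : 0 < a -> 0 < t < tau a PI -> 0 < xi a t < PI.
Proof.
  intros Ha Ht; assert (HP := PI_RGT_0); split.
  - rewrite <- (xi_0 a); apply xi_incr; lra.
  - assert (B := xi_incr a t _ Ha ltac:(lra) (proj2 Ht)); rewrite xi_tau in B; lra.
Qed.

Lemma tau_open a x : 0 < a -> 0 < x < PI -> 0 < tau a x < tau a PI.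
Proof.
  intros Ha Hx; split; [rewrite <- (tau_0 a)|]; apply tau_incr; lra.
Qed.

Lemma xi_at_right a : 0 < a -> filterlim (xi a) (at_right 0) (at_right 0).
Proof.
  intros Ha P HP; unfold at_right, within, filtermap in *.
  assert (B := C0_xi a Ha 0); unfold continuous in B; rewrite xi_0 in B.
  assert (B' : locally 0 (fun t => 0 < xi a t -> P (xi a t))) by exact (B _ HP).
  revert B'; apply filter_imp; intros t Ht Ht0; apply Ht.
  rewrite <- (xi_0 a); apply xi_incr; lra.
Qed.

Lemma xi_at_left a : 0 < a -> filterlim (xi a) (at_left (tau a PI)) (at_left PI).
Proof.
  intros Ha P HP; unfold at_left, within, filtermap in *.
  assert (HT := tau_PI_pos a Ha); assert (HPI := PI_RGT_0).
  assert (B := C0_xi a Ha (tau a PI)); unfold continuous in B; rewrite xi_tau in B by lra.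
  assert (B2 : locally (tau a PI) (fun t => 0 < t)) by (apply (open_gt 0); auto).
  assert (B' : locally (tau a PI) (fun t => xi a t < PI -> P (xi a t))) by exact (B _ HP).
  generalize (filter_and _ _ B' B2); apply filter_imp; intros t [Ht Ht2] Ht0; apply Ht.
  apply xi_open; lra.
Qed.

(** * Transfer of solutions, eigenvalues and norming constants *)

Lemma C0_filterlim_within g D x : C0 g -> filterlim g (within D (locally x)) (locally (g x)).
Proof.
  intros Hg; apply filterlim_filter_le_1 with (2 := Hg x).
  apply filter_le_within; typeclasses eauto.
Qed.

Lemma filterlim_at_left_unique (f g : R -> R) T l : 0 < T ->
  filterlim f (at_left T) (locally l) -> C0 g -> (forall t, 0 < t < T -> f t = g t) -> g T = l.
Proof.
  intros HT Hf Hg He.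
  apply (filterlim_locally_unique (F := at_left T) g).
  - apply C0_filterlim_within, Hg.
  - apply (filterlim_ext_loc f); auto.
    unfold at_left, within; apply (filter_imp (fun t => 0 < t)); [intros; apply He; lra|].
    apply (open_gt 0); auto.
Qed.

(** The transformed equation is solved on the whole line with Cauchy data [y 0] and [d0]. Its
    difference from the pulled-back solution has zero limits at 0 and so vanishes inside by
    [ode_zero_open]; the values at the right end follow from the one-sided limits. *)
Lemma solution_transfer a q lam y Dy d0 dpi : 0 < a -> cont_on_0pi q ->
  conf_solution a q lam y Dy d0 dpi ->
  exists Y Z : R -> R, (forall t, is_derive Y t (Z t)) /\
    (forall t, is_derive Z t ((pull a q t - lam) * Y t)) /\
    Z 0 = d0 /\ Z (tau a PI) = dpi /\ forall x, 0 <= x <= PI -> y x = Y (tau a x).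
Proof.
  intros Ha Hq (D1 & D2 & _ & L1 & L2 & L3 & L4).
  assert (HT := tau_PI_pos a Ha); set (T := tau a PI) in *.
  assert (CQ := C0_pull a q Ha Hq).
  destruct (pull_bounded a q Ha Hq) as (C & HC & HB).
  set (V := fun t => pull a q t - lam).
  assert (CV : C0 V) by (unfold V; c0).
  assert (HV : forall t, Rabs (V t) <= C + Rabs lam).
  { intros t; unfold V; eapply Rle_trans; [apply Rabs_triang|]; rewrite Rabs_Ropp.
    specialize (HB t); lra. }
  assert (HC' : 0 <= C + Rabs lam) by (pose proof (Rabs_pos lam); lra).
  destruct (ode_exists V (fun _ => 0) (C + Rabs lam) (y 0) d0 CV (C0_const 0) HC' HV)
    as (Y & Z & HY & HZ0 & Y0 & Z0).
  assert (HZ : forall t, is_derive Z t (V t * Y t)).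
  { intros t; replace (V t * Y t) with (V t * Y t - 0) by ring; auto. }
  assert (CY := C0_derive _ _ HY); assert (CZ := C0_derive _ _ HZ).
  assert (Dc : forall (f : R -> R) l t, 0 < t < T -> conf_deriv a f (xi a t) l ->
     is_derive (fun t => f (xi a t)) t l).
  { intros f l t Ht Hf; evar_last.
    - apply (is_derive_comp f (xi a)); [apply conf_deriv_is_derive, Hf | apply is_derive_xi; lra].
    - unfold scal; simpl; unfold mult; simpl; field.
      apply Rgt_not_eq, exp_pos. }
  assert (Lz : forall (f g : R -> R) l, filterlim f (at_right 0) (locally l) -> C0 g -> g 0 = l ->
     filterlim (fun t => f (xi a t) - g t) (at_right 0) (locally 0)).
  { intros f g l Hf Cg Hg.
    replace 0 with (l + - g 0) at 2 by (rewrite Hg; ring).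
    apply (filterlim_comp_2 (G := locally l) (H := locally (- g 0)) (fun t => f (xi a t)) (fun t => - g t) Rplus).
    - eapply filterlim_comp; [apply xi_at_right; auto | exact Hf].
    - apply (C0_filterlim_within (fun t => - g t)), C0_opp, Cg.
    - apply (filterlim_plus l (- g 0)). }
  assert (Heq : forall t, 0 < t < T -> y (xi a t) = Y t /\ Dy (xi a t) = Z t).
  { intros t Ht.
    destruct (ode_zero_open V (fun t => y (xi a t) - Y t) (fun t => Dy (xi a t) - Z t)
      (C + Rabs lam) T t HC' Ht HV) as [E1 E2].
    - intros s Hs; apply (is_derive_minus (fun t => y (xi a t)) Y); auto.
      apply Dc; auto; apply D1, xi_open; auto.
    - intros s Hs.
      replace (V s * (y (xi a s) - Y s))
        with (minus (q (xi a s) * y (xi a s) - lam * y (xi a s)) (V s * Y s)).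
      + apply (is_derive_minus (fun t => Dy (xi a t)) Z); auto.
        apply Dc; auto; apply D2, xi_open; auto.
      + unfold V; rewrite pull_xi by (fold T; lra); unfold minus, plus, opp; simpl; ring.
    - apply (Lz y Y (y 0)); auto.
    - apply (Lz Dy Z d0); auto.
    - lra. }
  exists Y, Z; refine (conj HY (conj HZ (conj Z0 (conj _ _)))).
  - apply (filterlim_at_left_unique (fun t => Dy (xi a t)) Z T); auto.
    + eapply filterlim_comp; [apply xi_at_left; auto | exact L4].
    + intros; apply Heq; auto.
  - intros x Hx.
    destruct (Req_dec x 0) as [->|Hx0]; [rewrite tau_0; auto|].
    destruct (Req_dec x PI) as [->|HxP].
    + fold T; symmetry; apply (filterlim_at_left_unique (fun t => y (xi a t)) Y T); auto.
      * eapply filterlim_comp; [apply xi_at_left; auto | exact L2].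
      * intros; apply Heq; auto.
    + rewrite <- (proj1 (Heq (tau a x) (tau_open a x Ha ltac:(lra)))), xi_tau by lra; auto.
Qed.

(** The converse passage, needed to deduce [sp_all] from the completeness of the given
    enumeration. *)
Lemma eigenvalue_transfer a q h H m (Y Z : R -> R) : 0 < a ->
  (forall t, is_derive Y t (Z t)) -> (forall t, is_derive Z t ((pull a q t - m) * Y t)) ->
  Y 0 = 1 -> Z 0 = h -> Z (tau a PI) = - H * Y (tau a PI) -> is_eigenvalue a q h H m.
Proof.
  intros Ha HY HZ Y0 Z0 ZT.
  assert (HPI := PI_RGT_0).
  assert (CY := C0_comp _ _ (C0_tau a Ha) (C0_derive _ _ HY)).
  assert (CZ := C0_comp _ _ (C0_tau a Ha) (C0_derive _ _ HZ)).
  assert (Dc : forall (f f1 : R -> R) x, 0 < x -> (forall t, is_derive f t (f1 t)) ->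
     conf_deriv a (fun x => f (tau a x)) x (f1 (tau a x))).
  { intros f f1 x Hx Hf.
    replace (f1 (tau a x)) with (Rpower x (a - 1) * f1 (tau a x) * Rpower x (1 - a)).
    - apply is_derive_conf_deriv.
      apply (is_derive_comp f (tau a)); [apply Hf | apply is_derive_tau; auto].
    - replace (Rpower x (a - 1) * f1 (tau a x) * Rpower x (1 - a))
        with (f1 (tau a x) * (Rpower x (a - 1) * Rpower x (1 - a))) by ring.
      rewrite <- Rpower_plus; replace (a - 1 + (1 - a)) with 0 by ring.
      rewrite Rpower_O by auto; ring. }
  exists (fun x => Y (tau a x)), (fun x => Z (tau a x)), h, (Z (tau a PI)).
  refine (conj (conj _ (conj _ (conj _ (conj _ (conj _ (conj _ _)))))) (conj _ (conj _ _))).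
  - intros x Hx; apply (Dc Y Z); auto; lra.
  - intros x Hx.
    replace (q x * Y (tau a x) - m * Y (tau a x)) with ((pull a q (tau a x) - m) * Y (tau a x))
      by (rewrite pull_tau by lra; ring).
    apply (Dc Z (fun t => (pull a q t - m) * Y t)); auto; lra.
  - intros x _; apply CY.
  - apply (C0_filterlim_within (fun x => Y (tau a x))), CY.
  - apply (C0_filterlim_within (fun x => Y (tau a x))), CY.
  - replace h with (Z (tau a 0)) by (rewrite tau_0; auto).
    apply (C0_filterlim_within (fun x => Z (tau a x))), CZ.
  - apply (C0_filterlim_within (fun x => Z (tau a x))), CZ.
  - rewrite tau_0, Y0; ring.
  - rewrite ZT; ring.
  - exists 0; rewrite tau_0, Y0; lra.
Qed.

(** Substitution on [[e, PI]] with the primitive [F], then [e] tends to 0 by continuity of [F] and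
    [tau]. The integral is improper because the weight is unbounded at 0 for [a < 1]. *)
Lemma norming_transfer a phi (Y : R -> R) c : 0 < a -> C0 Y ->
  (forall x, 0 <= x <= PI -> phi x = Y (tau a x)) -> norming_const a phi c ->
  c = ip (tau a PI) Y Y.
Proof.
  intros Ha CY Hphi Hc.
  assert (HPI := PI_RGT_0).
  set (F := fun t => ip t Y Y).
  assert (DF : forall t, is_derive F t (Y t * Y t)).
  { intros t; apply (is_derive_RInt_C0 (fun t => Y t * Y t)); c0. }
  assert (CF := C0_derive _ _ DF).
  rewrite <- (is_RInt_gen_unique _ _ Hc).
  apply is_RInt_gen_unique.
  assert (Hfin : forall e, 0 < e < PI -> is_RInt (fun x => phi x ^ 2 * Rpower x (a - 1)) e PI
     (F (tau a PI) - F (tau a e))).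
  { intros e He.
    apply (is_RInt_ext (fun x => Rpower x (a - 1) * (Y (tau a x) * Y (tau a x)))).
    - rewrite Rmin_left, Rmax_right by lra; intros x Hx; rewrite Hphi by lra; simpl; ring.
    - apply (is_RInt_derive (fun x => F (tau a x))
        (fun x => Rpower x (a - 1) * (Y (tau a x) * Y (tau a x)))).
      + rewrite Rmin_left, Rmax_right by lra; intros x Hx.
        apply (is_derive_comp F (tau a)); [apply DF | apply is_derive_tau; lra].
      + rewrite Rmin_left, Rmax_right by lra; intros x Hx.
        apply (continuous_mult (fun x => Rpower x (a - 1))).
        * apply (ex_derive_continuous (fun x => Rpower x (a - 1))); eexists.
          apply is_derive_Rpower; lra.
        * apply (C0_comp (tau a) (fun t => Y t * Y t)); [apply C0_tau; auto | c0]. }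
  intros P HP.
  assert (L : at_right 0 (fun e => P (F (tau a PI) - F (tau a e)))).
  { apply filter_le_within.
    assert (CG : C0 (fun e => F (tau a PI) - F (tau a e))).
    { apply C0_minus; [c0|]; apply C0_comp; auto; apply C0_tau; auto. }
    apply (CG 0); rewrite tau_0.
    assert (F0 : F 0 = 0) by (apply (@RInt_point R_CompleteNormedModule)).
    rewrite F0, Rminus_0_r; exact HP. }
  apply (Filter_prod _ _ _ (fun e => 0 < e < PI /\ P (F (tau a PI) - F (tau a e))) (fun b => b = PI)).
  - apply filter_and; auto; apply filter_and.
    + unfold at_right, within; apply filter_forall; auto.
    + apply filter_le_within; apply (open_lt PI); auto.
  - unfold at_point; auto.
  - intros e b [He HPe] ->; simpl; eexists; split; [apply Hfin; auto | exact HPe].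
Qed.

(** The solution [phi n] comes without a condition at [PI]. It inherits one from an eigenfunction
    for [lams n], to which it is proportional because both satisfy the Robin condition at 0. *)
Lemma spectral_transfer a q h H lams phi al : 0 < a -> cont_on_0pi q ->
  eigen_enum a q h H lams -> (forall n, is_phi a q h (lams n) (phi n)) ->
  (forall n, norming_const a (phi n) (al n)) ->
  exists ph ps, spectral (tau a PI) (pull a q) h H lams ph ps /\
    forall n, al n = ip (tau a PI) (ph n) (ph n).
Proof.
  intros Ha Hq (Hinc & Hev & Hall) Hphi Hal.
  assert (HT := tau_PI_pos a Ha); assert (HPI := PI_RGT_0).
  assert (CQ := C0_pull a q Ha Hq).
  destruct (pull_bounded a q Ha Hq) as (C & HC & HB).
  assert (Hex : forall n, exists Y : (R -> R) * (R -> R),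
    (forall t, is_derive (fst Y) t (snd Y t)) /\
    (forall t, is_derive (snd Y) t ((pull a q t - lams n) * fst Y t)) /\
    snd Y 0 = h /\ forall x, 0 <= x <= PI -> phi n x = fst Y (tau a x)).
  { intros n; destruct (Hphi n) as (Dphi & dpi & Hs & _).
    destruct (solution_transfer _ _ _ _ _ _ _ Ha Hq Hs) as (Y & Z & A1 & A2 & A3 & _ & A4).
    exists (Y, Z); simpl; auto. }
  assert (HF : exists F : nat -> (R -> R) * (R -> R), forall n,
    (forall t, is_derive (fst (F n)) t (snd (F n) t)) /\
    (forall t, is_derive (snd (F n)) t ((pull a q t - lams n) * fst (F n) t)) /\
    snd (F n) 0 = h /\ forall x, 0 <= x <= PI -> phi n x = fst (F n) (tau a x)).
  { exists (fun n => proj1_sig (constructive_indefinite_description _ (Hex n))).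
    intros n; exact (proj2_sig (constructive_indefinite_description _ (Hex n))). }
  destruct HF as [F HF].
  exists (fun n => fst (F n)), (fun n => snd (F n)).
  assert (H0 : forall n, fst (F n) 0 = 1).
  { intros n; destruct (HF n) as (_ & _ & _ & A); specialize (A 0 ltac:(lra)).
    rewrite tau_0 in A; rewrite <- A; destruct (Hphi n) as (? & ? & _ & ?); auto. }
  split.
  2: { intros n; destruct (HF n) as (A1 & A2 & _ & A).
       apply (norming_transfer a (phi n)); auto; apply (C0_derive _ _ A1). }
  constructor; auto.
  - exists C; auto.
  - intros n; apply HF.
  - intros n; apply HF.
  - intros n; apply HF.
  - intros n; destruct (HF n) as (A1 & A2 & A3 & _); specialize (H0 n).
    set (u := fst (F n)) in *; set (u1 := snd (F n)) in *.
    destruct (Hev n) as (y & Dy & d0 & dpi & Hs & E0 & ET & x & Hx & Hyx).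
    destruct (solution_transfer _ _ _ _ _ _ _ Ha Hq Hs) as (Y & Z & B1 & B2 & B3 & B4 & B5).
    assert (Y0 := B5 0 ltac:(lra)); rewrite tau_0 in Y0.
    assert (YT := B5 PI ltac:(lra)).
    set (T := tau a PI) in *.
    assert (CV : forall r, Rabs (pull a q r - lams n) <= C + Rabs (lams n)).
    { intros r; eapply Rle_trans; [apply Rabs_triang|]; rewrite Rabs_Ropp.
      specialize (HB r); lra. }
    assert (HC' : 0 <= C + Rabs (lams n)) by (pose proof (Rabs_pos (lams n)); lra).
    assert (CY := C0_derive _ _ B1); assert (Cu := C0_derive _ _ A1).
    assert (Yn0 : Y 0 <> 0).
    (* If the eigenfunction vanished at 0, the Robin condition would annihilate its derivative too,
       and [ode_bound] would make it zero on the whole interval. *)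
    { intros Z0; apply Hyx; rewrite B5 by auto.
      assert (Z1 : Z 0 = 0) by (rewrite B3; rewrite Y0, Z0 in E0; lra).
      assert (Ht : 0 <= tau a x <= T).
      { apply tau_range; auto. }
      assert (B := ode_bound (fun t => pull a q t - lams n) (fun _ => 0) Y Z (C + Rabs (lams n)) T
        (tau a x) HC' Ht (C0_const 0) CV B1).
      assert (B2' : forall s, is_derive Z s ((pull a q s - lams n) * Y s - 0)).
      { intros s; rewrite Rminus_0_r; auto. }
      specialize (B B2'); rewrite Z0, Z1 in B.
      assert (I0 : ip T (fun _ => 0) (fun _ => 0) = 0).
      { unfold ip; rewrite (RInt_eq _ (fun _ => 0)) by (intros; ring); apply RInt_0. }
      rewrite I0 in B; replace (0 * 0 + 0 * 0 + 0) with 0 in B by ring; rewrite Rmult_0_r in B.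
      pose proof (Rle_0_sqr (Y (tau a x))); pose proof (Rle_0_sqr (Z (tau a x))).
      apply Rsqr_0_uniq; unfold Rsqr in *; lra. }
    assert (YnT : Y T <> 0).
    { intros ZT; apply Yn0.
      apply (ode_nonvanishing (fun t => pull a q t - lams n) Y Z (C + Rabs (lams n)) T); auto; [lra|].
      rewrite B4; rewrite YT, ZT in ET; lra. }
    assert (CQl : C0 (fun t => pull a q t - lams n)) by c0.
    (* The Wronskian of [u] and [Y] is constant and vanishes at 0; at [T] it transports the Robin
       condition from [Y] to [u], after division by [Y T <> 0]. *)
    assert (G := green_identity u u1 _ Y Z _ T A1 A2 B1 B2 ltac:(c0) ltac:(c0)).
    rewrite (RInt_eq _ (fun _ => 0)) in G by (intros; ring).
    rewrite RInt_0, H0, A3, B3, B4 in G.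
    apply Rmult_eq_reg_r with (Y T); auto.
    rewrite YT in ET; rewrite Y0 in E0.
    replace dpi with (- H * Y T) in G by lra.
    replace d0 with (h * Y 0) in G by lra.
    lra.
  - intros m Y Z HY HZ Y0 Z0 ZT; apply Hall.
    apply (eigenvalue_transfer a q h H m Y Z); auto.
Qed.

Theorem theorem3 (a : R) (q qt : R -> R) (h H ht Ht : R)
  (lams lamst : nat -> R) (phi phit : nat -> R -> R) (al alt : nat -> R) :
  0 < a <= 1 ->
  cont_on_0pi q -> cont_on_0pi qt ->
  eigen_enum a q h H lams -> eigen_enum a qt ht Ht lamst ->
  (forall n, is_phi a q h (lams n) (phi n)) ->
  (forall n, is_phi a qt ht (lamst n) (phit n)) ->
  (forall n, norming_const a (phi n) (al n)) ->
  (forall n, norming_const a (phit n) (alt n)) ->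
  (forall n, lams n = lamst n) ->
  (forall n, al n = alt n) ->
  (forall x, 0 <= x <= PI -> q x = qt x) /\ h = ht /\ H = Ht.
Proof.
  intros [Ha _] Hq Hqt He Het Hp Hpt Hn Hnt Hl Hal.
  destruct (spectral_transfer a q h H lams phi al Ha Hq He Hp Hn) as (ph & ps & S & Es).
  destruct (spectral_transfer a qt ht Ht lamst phit alt Ha Hqt Het Hpt Hnt) as (pht & pst & St & Est).
  (* [spectral_uniqueness] takes one eigenvalue sequence for both problems, so the second is
     restated with [lams]. *)
  assert (St' : spectral (tau a PI) (pull a qt) ht Ht lams pht pst).
  { destruct St as [? ? ? Hinc ? ? ? ? ? Hall]; constructor; auto.
    - intros n m Hnm; rewrite !Hl; auto.
    - intros n t; rewrite Hl; auto.
    - intros m y z A1 A2 A3 A4 A5; destruct (Hall m y z A1 A2 A3 A4 A5) as [n <-].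
      exists n; auto. }
  destruct (spectral_uniqueness _ _ _ _ _ _ _ _ _ _ _ _ S St') as (EQ & Eh & EH).
  { intros n; rewrite <- Es, <- Est; auto. }
  split; auto.
  intros x Hx; rewrite <- (pull_tau a q x Ha Hx), <- (pull_tau a qt x Ha Hx).
  apply EQ, tau_range; auto.
Qed.
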